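(* There exists an odometer system $(X,\mu,f)$ such that, for $\mathbb{K}=\mathbb{R}$ or $\mathbb{C}$ and every $1\le p<\infty$, the composition operator $T_f:L^p(X;\mathbb{K})\to L^p(X;\mathbb{K})$, $T_f(\varphi)=\varphi\circ f$, is continuous, mixing, distributionally chaotic and Devaney chaotic. Moreover, for $p\ge2$, $T_f$ fails to satisfy the Frequent Hypercyclicity Criterion.
   Context: Odometer system. Let $(\alpha_n)_{n\ge1}$ be a sequence of integers with $\alpha_n\ge2$ for all $n$, let $A_n=\{0,\ldots,\alpha_n-1\}$ and let $X=\prod_{n=1}^\infty A_n$ with the product topology and its Borel $\sigma$-algebra $\mathcal{B}$. The odometer $f:X\to X$ is defined as follows: $f(\alpha_1-1,\alpha_2-1,\alpha_3-1,\ldots)=(0,0,0,\ldots)$, and for any other $x=(x_1,x_2,\ldots)$, with $l(x)=\min\{j\ge1:x_j\ne\alpha_j-1\}$, one sets $f(x)_n=0$ if $n<l(x)$, $f(x)_n=x_n+1$ if $n=l(x)$, and $f(x)_n=x_n$ if $n>l(x)$. For each $n\ge1$ let $\mu_n$ be a probability measure on $A_n$ with $\mu_n(a)>0$ for all $a\in A_n$, let $\mu=\prod_{n=1}^\infty\mu_n$ be the product probability on $X$, and assume $\prod_{n=1}^\infty\max\{\mu_n(a):a\in A_n\}=0$ (so $\mu$ is non-atomic). Any such triple $(X,\mu,f)$ is called an odometer system. $L^p(X;\mathbb{K})$ is taken with respect to $\mu$. Continuity of $T_f$ means that $\varphi\mapsto\varphi\circ f$ is a bounded linear operator of $L^p(X;\mathbb{K})$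 into itself. $\mathbb{N}=\{1,2,\ldots\}$. For a continuous linear operator $T$ on a separable Banach space $\mathcal{X}$: - $T$ is mixing if for every pair of nonempty open sets $U,V\subseteq\mathcal{X}$ there is $n_0\in\mathbb{N}$ such that $T^n(U)\cap V\ne\varnothing$ for all $n\ge n_0$; - $T$ is hypercyclic if there is $x\in\mathcal{X}$ such that $\{T^nx:n\ge1\}$ is dense in $\mathcal{X}$; - $T$ is Devaney chaotic if it is hypercyclic and its set of periodic points (vectors $x$ with $T^nx=x$ for some $n\ge1$) is dense in $\mathcal{X}$; - $T$ is distributionally chaotic if there are $x\in\mathcal{X}$ and sets $D,E\subseteq\mathbb{N}$ with $\overline{\mathrm{dens}}(D)=\overline{\mathrm{dens}}(E)=1$ such that $\lim_{n\to\infty,\,n\in D}\|T^nx\|=0$ and $\lim_{n\to\infty,\,n\in E}\|T^nx\|=\infty$, where $\overline{\mathrm{dens}}(D)=\limsup_{N\to\infty}\frac1N\#(D\cap\{1,\ldots,N\})$; - $T$ satisfies the Frequent Hypercyclicity Criterion if there exist a dense subset $\mathcal{X}_0\subseteq\mathcal{X}$ and a map $S:\mathcal{X}_0\to\mathcal{X}_0$ such that for every $x\in\mathcal{X}_0$: (i) $\sum_{n=1}^\infty T^nx$ converges unconditionally; (ii) $\sum_{n=1}^\infty S^nx$ converges unconditionally; (iii) $TSx=x$. *)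

(* Defs.v *)
From HB Require Import structures.
From mathcomp Require Import all_boot all_order all_algebra generic_quotient.
From mathcomp Require Import all_classical all_reals all_analysis.
From mathcomp Require Import measurable_realfun.
From mathcomp.real_closed Require Import complex.

Set Implicit Arguments.
Unset Strict Implicit.
Unset Printing Implicit Defensive.

Import Order.TTheory GRing.Theory Num.Theory.
Import numFieldNormedType.Exports.

Local Open Scope classical_set_scope.
Local Open Scope ring_scope.

(** Scalars. A [scalarField R] is a subfield of the complex numbers over [R]
    containing [R]; it serves only to treat the two scalar fields
    [real_scalars R] and [complex_scalars R] at once. In MathComp-Analysis the
    norm of a normed space takes its values in the scalar field, hence the
    embedding [sf_inj]. *)
Record scalarField (R : realType) := ScalarField {
  sf_field :> numFieldType;
  sf_re : sf_field -> R;
  sf_im : sf_field -> R;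
  sf_inj : R -> sf_field;
  sf_reD : {morph sf_re : x y / x + y};
  sf_imD : {morph sf_im : x y / x + y};
  sf_reM : forall x y, sf_re (x * y) = sf_re x * sf_re y - sf_im x * sf_im y;
  sf_imM : forall x y, sf_im (x * y) = sf_re x * sf_im y + sf_im x * sf_re y;
  sf_injD : {morph sf_inj : a b / a + b};
  sf_injM : {morph sf_inj : a b / a * b};
  sf_inj_le : {mono sf_inj : a b / a <= b};
  sf_norm : forall x,
    `|x| = sf_inj (Num.sqrt (sf_re x ^+ 2 + sf_im x ^+ 2))
}.
Arguments ScalarField {R}.
Arguments sf_re {R s}.
Arguments sf_im {R s}.
Arguments sf_inj {R s}.

Section scalars.
Variable R : realType.

Fact real_reM (x y : R) : x * y = x * y - 0 * 0.
Proof. by rewrite mul0r subr0. Qed.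

Fact real_imM (x y : R) : 0 = x * 0 + 0 * y :> R.
Proof. by rewrite mulr0 mul0r addr0. Qed.

Fact real_norm (x : R) : `|x| = Num.sqrt (x ^+ 2 + 0 ^+ 2).
Proof. by rewrite expr0n addr0 sqrtr_sqr. Qed.

Definition real_scalars : scalarField R :=
  @ScalarField R R id (fun=> 0) id
    (fun _ _ => erefl) (fun _ _ => esym (addr0 0)) real_reM real_imM
    (fun _ _ => erefl) (fun _ _ => erefl) (fun _ _ => erefl) real_norm.

Fact complex_reD : {morph (@complex.Re R) : x y / x + y}.
Proof. by case=> [a b] [c d]. Qed.

Fact complex_imD : {morph (@complex.Im R) : x y / x + y}.
Proof. by case=> [a b] [c d]. Qed.

Fact complex_reM (x y : R[i]) :
  complex.Re (x * y) = complex.Re x * complex.Re y - complex.Im x * complex.Im y.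
Proof. by case: x y => [a b] [c d]. Qed.

Fact complex_imM (x y : R[i]) :
  complex.Im (x * y) = complex.Re x * complex.Im y + complex.Im x * complex.Re y.
Proof. by case: x y => [a b] [c d]. Qed.

Fact complex_inj_le : {mono (real_complex R) : a b / a <= b}.
Proof. by move=> a b; rewrite lecE /= eqxx. Qed.

Fact complex_norm (x : R[i]) :
  `|x| = real_complex R (Num.sqrt (complex.Re x ^+ 2 + complex.Im x ^+ 2)).
Proof. by case: x. Qed.

Definition complex_scalars : scalarField R :=
  @ScalarField R R[i] (@complex.Re R) (@complex.Im R) (real_complex R)
    complex_reD complex_imD complex_reM complex_imM
    (rmorphD (real_complex R)) (rmorphM (real_complex R))
    complex_inj_le complex_norm.

End scalars.

Section scalar_theory.
Context (R : realType) (K : scalarField R).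
Implicit Types (x y : K) (a b : R).

Definition modulus x : R := Num.sqrt (sf_re x ^+ 2 + sf_im x ^+ 2).

Lemma modulusE x : `|x| = sf_inj (modulus x).
Proof. exact: sf_norm. Qed.

Lemma sf_inj_inj : injective (@sf_inj R K).
Proof. exact/inc_inj/sf_inj_le. Qed.

Lemma sf_inj0 : sf_inj 0 = 0 :> K.
Proof. by apply: (addIr (sf_inj 0)); rewrite -sf_injD !add0r. Qed.

Lemma sf_re0 : sf_re (0 : K) = 0.
Proof. by apply: (addIr (sf_re (0 : K))); rewrite -sf_reD !add0r. Qed.

Lemma sf_im0 : sf_im (0 : K) = 0.
Proof. by apply: (addIr (sf_im (0 : K))); rewrite -sf_imD !add0r. Qed.

Lemma modulus_ge0 x : 0 <= modulus x.
Proof. exact: sqrtr_ge0. Qed.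

Lemma modulus0 : modulus 0 = 0.
Proof. by apply: sf_inj_inj; rewrite -modulusE normr0 sf_inj0. Qed.

Lemma modulus_eq0 x : modulus x = 0 -> x = 0.
Proof. by move=> x0; apply/normr0_eq0; rewrite modulusE x0 sf_inj0. Qed.

Lemma modulusM x y : modulus (x * y) = modulus x * modulus y.
Proof. by apply: sf_inj_inj; rewrite sf_injM -!modulusE normrM. Qed.

Lemma modulusD x y : modulus (x + y) <= modulus x + modulus y.
Proof. by rewrite -(sf_inj_le K) sf_injD -!modulusE ler_normD. Qed.

End scalar_theory.

Lemma modulus_real (R : realType) (x : R) : modulus (x : real_scalars R) = `|x|.
Proof. by rewrite [RHS]real_norm. Qed.

Lemma modulus_complex (R : realType) (z : R[i]) :
  modulus (z : complex_scalars R) = complex.Re `|z|.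
Proof. by rewrite complex_norm. Qed.

(** The space [L^p(mu; K)] for [1 <= p < oo], as a quotient of the space of
    [p]-integrable functions. *)
Section Lp.
Context d (T : measurableType d) (R : realType).
Variables (mu : {measure set T -> \bar R}) (K : scalarField R).
Variables (p : R) (p1 : 1 <= p).
Implicit Types f g : T -> K.

(* Borel measurability of a [K]-valued function, for [K] = [R] or [R[i]]. *)
Definition kmeasurable f : Prop :=
  measurable_fun [set: T] (sf_re \o f) /\ measurable_fun [set: T] (sf_im \o f).

Definition kLnorm f : \bar R := 'N[mu]_p%:E [EFin \o (@modulus R K \o f)].

(* The proof argument lets the structure of vector space be inferred. *)
Definition Lp_pred (_ : 1 <= p) : {pred T -> K^o} :=
  fun f => `[< kmeasurable f /\ (kLnorm f < +oo)%E >].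

Lemma measurable_modulus f : kmeasurable f ->
  measurable_fun [set: T] (@modulus R K \o f).
Proof.
move=> [mr mi].
apply: (measurableT_comp (continuous_measurable_fun (@sqrt_continuous R))).
by apply: measurable_funD; exact: measurable_funX.
Qed.

Lemma measurable_modulusX f : kmeasurable f ->
  measurable_fun [set: T] (fun x => (`|modulus (f x)| `^ p)%:E).
Proof.
move=> /measurable_modulus mf; apply/measurable_EFinP.
apply: (measurableT_comp (@measurable_powR R p)).
exact: measurableT_comp mf.
Qed.

Lemma ae_eq_kLnorm f g : kmeasurable f -> kmeasurable g ->
  {ae mu, forall x, f x = g x} -> kLnorm f = kLnorm g.
Proof.
move=> mf mg fg; rewrite /kLnorm unlock.
suff -> : (\int[mu]_x (`|(EFin \o (@modulus R K \o f)) x| `^ p) =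
    \int[mu]_x (`|(EFin \o (@modulus R K \o g)) x| `^ p))%E by [].
apply: ae_eq_integral => //; [exact: measurable_modulusX..|].
by apply: filterS fg => x + _ => /= ->.
Qed.

Lemma Lp_gt0 : 0 < p. Proof. exact: lt_le_trans p1. Qed.

Lemma kLnorm_le f (h : T -> R) : kmeasurable f -> measurable_fun [set: T] h ->
  (forall x, modulus (f x) <= h x) -> (kLnorm f <= 'N[mu]_p%:E [EFin \o h])%E.
Proof.
move=> mf mh fh; rewrite /kLnorm unlock /=.
apply: gt0_ler_poweR; rewrite ?invr_ge0 ?(ltW Lp_gt0) //.
- by rewrite in_itv/= leey andbT integral_ge0 // => x _; rewrite lee_fin powR_ge0.
- by rewrite in_itv/= leey andbT integral_ge0 // => x _; rewrite lee_fin powR_ge0.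
apply: ge0_le_integral => //.
- exact: measurable_modulusX.
- apply/measurable_EFinP; apply: (measurableT_comp (@measurable_powR R p)).
  exact: measurableT_comp mh.
move=> x _ /=; rewrite lee_fin ge0_ler_powR ?nnegrE ?(ltW Lp_gt0) //.
rewrite (ger0_norm (modulus_ge0 _)) (le_trans (fh x)) //; exact: ler_norm.
Qed.

Lemma kmeasurableD f g : kmeasurable f -> kmeasurable g -> kmeasurable (f \+ g).
Proof.
move=> [fr fi] [gr gi]; split.
  rewrite (_ : _ \o _ = (sf_re \o f) \+ (sf_re \o g)); first exact: measurable_funD.
  by apply/funext => x /=; rewrite sf_reD.
rewrite (_ : _ \o _ = (sf_im \o f) \+ (sf_im \o g)); first exact: measurable_funD.
by apply/funext => x /=; rewrite sf_imD.
Qed.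

Lemma kmeasurableZ (a : K) f : kmeasurable f -> kmeasurable (fun x => a * f x).
Proof.
move=> [fr fi]; split.
  rewrite (_ : _ \o _ = (fun x => sf_re a * sf_re (f x) - sf_im a * sf_im (f x))).
    by apply: measurable_funB; apply: measurable_funM.
  by apply/funext => x /=; rewrite sf_reM.
rewrite (_ : _ \o _ = (fun x => sf_re a * sf_im (f x) + sf_im a * sf_re (f x))).
  by apply: measurable_funD; apply: measurable_funM.
by apply/funext => x /=; rewrite sf_imM.
Qed.

Lemma kLnormD f g : kmeasurable f -> kmeasurable g ->
  (kLnorm (f \+ g)%R <= kLnorm f + kLnorm g)%E.
Proof.
move=> mf mg; have mf' := measurable_modulus mf.
have mg' := measurable_modulus mg.
apply: le_trans (minkowski_EFin mu mf' mg' p1).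
apply: kLnorm_le; first exact: kmeasurableD.
- exact: measurable_funD.
- by move=> x /=; exact: modulusD.
Qed.

Lemma kLnormZ (a : K) f : kmeasurable f ->
  kLnorm (fun x => a * f x) = ((modulus a)%:E * kLnorm f)%E.
Proof.
move=> mf; rewrite /kLnorm unlock /=.
under eq_integral => x _.
  rewrite /= modulusM normrM (powRM _ (normr_ge0 _) (normr_ge0 _)) EFinM; over.
rewrite ge0_integralZl //=; last exact: measurable_modulusX.
rewrite poweRM ?integral_ge0 ?lee_fin ?powR_ge0 //; congr (_ * _)%E.
rewrite poweR_EFin -powRrM mulfV ?gt_eqF ?Lp_gt0 // powRr1 ?normr_ge0 //.
by rewrite ger0_norm ?modulus_ge0.
Qed.

Lemma kLnorm0 : kLnorm (fun=> 0) = 0%E.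
Proof.
rewrite /kLnorm (_ : EFin \o _ = cst 0%E); first by rewrite Lnorm0 // eqe gt_eqF ?Lp_gt0.
by apply/funext => x /=; rewrite modulus0.
Qed.

Lemma kLnorm_eq0 f : kmeasurable f -> kLnorm f = 0%E ->
  {ae mu, forall x, f x = 0}.
Proof.
move=> /measurable_modulus mf /Lnorm_eq0_eq0 H.
have := H ((measurable_EFinP _ _).2 mf).
rewrite lte_fin => /(_ Lp_gt0); apply: filterS => x /(_ Logic.I) [].
exact: modulus_eq0.
Qed.

Lemma Lp_submod_closed : submod_closed (Lp_pred p1).
Proof.
split=> [|a f g].
  apply/asboolP; split; last by rewrite kLnorm0.
  split; rewrite (_ : _ \o _ = cst 0); try exact: measurable_cst;
    apply/funext => x /=; [exact: sf_re0|exact: sf_im0].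
move=> /asboolP[mf nf] /asboolP[mg ng].
have maf := kmeasurableZ a mf; apply/asboolP; split; first exact: kmeasurableD.
apply: (le_lt_trans (kLnormD maf mg)); rewrite lte_add_pinfty //.
by rewrite kLnormZ // lte_mul_pinfty // lee_fin modulus_ge0.
Qed.

HB.instance Definition _ :=
  GRing.isSubmodClosed.Build K (T -> K^o) (Lp_pred p1) Lp_submod_closed.

End Lp.

Section Lp_functions.
Context d (T : measurableType d) (R : realType).
Variables (mu : {measure set T -> \bar R}) (K : scalarField R).
Variables (p : R).

Record Lpfun (p1 : 1 <= p) := MkLpfun {
  Lpfun_val :> T -> K^o;
  Lpfun_valP : Lpfun_val \in Lp_pred mu p1
}.
Variable p1 : 1 <= p.

HB.instance Definition _ := [isSub of Lpfun p1 for @Lpfun_val p1].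
HB.instance Definition _ := [Choice of Lpfun p1 by <:].
HB.instance Definition _ := [SubChoice_isSubLmodule of Lpfun p1 by <:].
End Lp_functions.

Section Lp_space.
Context d (T : measurableType d) (R : realType).
Variables (mu : {measure set T -> \bar R}) (K : scalarField R).
Variables (p : R) (p1 : 1 <= p).
Local Notation fun_ := (Lpfun mu K p1).
Local Open Scope quotient_scope.

Lemma LpfunD (f g : fun_) x : (f + g) x = f x + g x. Proof. by []. Qed.

Lemma LpfunN (f : fun_) x : (- f) x = - f x. Proof. by []. Qed.

Lemma LpfunZ (a : K) (f : fun_) x : (a *: f) x = a * f x. Proof. by []. Qed.

Definition Lp_eq (f g : fun_) : bool := `[< {ae mu, forall x, f x = g x} >].

Fact Lp_eq_refl : reflexive Lp_eq.
Proof. by move=> f; apply/asboolP; exact: aeW. Qed.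

Fact Lp_eq_sym : symmetric Lp_eq.
Proof.
by move=> f g; apply/asboolP/asboolP; apply: filterS => x ->.
Qed.

Fact Lp_eq_trans : transitive Lp_eq.
Proof.
move=> g f h /asboolP fg /asboolP gh; apply/asboolP.
by apply: filterS2 fg gh => x -> ->.
Qed.

Canonical Lp_equiv := EquivRel Lp_eq Lp_eq_refl Lp_eq_sym Lp_eq_trans.

Definition Lp : Type := {eq_quot Lp_eq}.
HB.instance Definition _ := Choice.on Lp.
HB.instance Definition _ := EqQuotient.on Lp.

Definition Lp_class (f : fun_) : Lp := \pi_Lp f.

Lemma Lp_classP (f g : fun_) :
  Lp_class f = Lp_class g <-> {ae mu, forall x, f x = g x}.
Proof.
split=> [/eqmodP/asboolP //|fg]; exact/eqmodP/asboolP.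
Qed.

Lemma Lp_classK (u : Lp) : Lp_class (repr u) = u.
Proof. exact: reprK. Qed.

Lemma repr_class (f : fun_) : {ae mu, forall x, repr (Lp_class f) x = f x}.
Proof. by apply/Lp_classP; rewrite Lp_classK. Qed.

Definition Lp_add (u v : Lp) : Lp := Lp_class (repr u + repr v).
Definition Lp_opp (u : Lp) : Lp := Lp_class (- repr u).
Definition Lp_scale (a : K) (u : Lp) : Lp := Lp_class (a *: repr u).

Lemma Lp_classD f g : Lp_class (f + g) = Lp_add (Lp_class f) (Lp_class g).
Proof.
apply/Lp_classP; apply: filterS2 (repr_class f) (repr_class g) => x fx gx.
by rewrite !LpfunD fx gx.
Qed.

Lemma Lp_classN f : Lp_class (- f) = Lp_opp (Lp_class f).
Proof.
apply/Lp_classP; apply: filterS (repr_class f) => x fx.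
by rewrite !LpfunN fx.
Qed.

Lemma Lp_classZ a f : Lp_class (a *: f) = Lp_scale a (Lp_class f).
Proof.
apply/Lp_classP; apply: filterS (repr_class f) => x fx.
by rewrite !LpfunZ fx.
Qed.

Lemma Lp_ind (P : Lp -> Prop) : (forall f, P (Lp_class f)) -> forall u, P u.
Proof. by move=> H u; rewrite -[u]Lp_classK. Qed.

Fact Lp_addA : associative Lp_add.
Proof.
elim/Lp_ind=> f; elim/Lp_ind=> g; elim/Lp_ind=> h.
by rewrite -!Lp_classD addrA.
Qed.

Fact Lp_addC : commutative Lp_add.
Proof. by elim/Lp_ind=> f; elim/Lp_ind=> g; rewrite -!Lp_classD addrC. Qed.

Fact Lp_add0 : left_id (Lp_class 0) Lp_add.
Proof. by elim/Lp_ind=> f; rewrite -!Lp_classD add0r. Qed.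

Fact Lp_addN : left_inverse (Lp_class 0) Lp_opp Lp_add.
Proof. by elim/Lp_ind=> f; rewrite -Lp_classN -!Lp_classD addNr. Qed.

HB.instance Definition _ :=
  GRing.isZmodule.Build Lp Lp_addA Lp_addC Lp_add0 Lp_addN.

Lemma Lp_addE (u v : Lp) : u + v = Lp_add u v. Proof. by []. Qed.

Fact Lp_scaleA a b (u : Lp) : Lp_scale a (Lp_scale b u) = Lp_scale (a * b) u.
Proof. by elim/Lp_ind: u => f; rewrite -!Lp_classZ scalerA. Qed.

Fact Lp_scale1 : left_id 1 Lp_scale.
Proof. by elim/Lp_ind=> f; rewrite -Lp_classZ scale1r. Qed.

Fact Lp_scaleDr : right_distributive Lp_scale +%R.
Proof.
move=> a; elim/Lp_ind=> f; elim/Lp_ind=> g.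
by rewrite !Lp_addE -Lp_classD -!Lp_classZ -Lp_classD scalerDr.
Qed.

Fact Lp_scaleDl (u : Lp) : {morph Lp_scale^~ u : a b / a + b}.
Proof.
by elim/Lp_ind: u => f a b; rewrite Lp_addE -!Lp_classZ -Lp_classD scalerDl.
Qed.

HB.instance Definition _ := GRing.Zmodule_isLmodule.Build K Lp
  Lp_scaleA Lp_scale1 Lp_scaleDr Lp_scaleDl.

Lemma Lp_scaleE (a : K) (u : Lp) : a *: u = Lp_scale a u. Proof. by []. Qed.

Definition Lp_norm (u : Lp) : K := sf_inj (fine (kLnorm mu p (repr u))).

Lemma Lpfun_kmeasurable (f : fun_) : kmeasurable f.
Proof. by have /asboolP[] := Lpfun_valP f. Qed.

Lemma Lpfun_fin_num (f : fun_) : kLnorm mu p f \is a fin_num.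
Proof.
have /asboolP[_ nf] := Lpfun_valP f.
by rewrite ge0_fin_numE // Lnorm_ge0.
Qed.

Lemma Lp_norm_class (f : fun_) : Lp_norm (Lp_class f) = sf_inj (fine (kLnorm mu p f)).
Proof.
rewrite /Lp_norm (@ae_eq_kLnorm _ _ _ mu K p _ f) //.
- exact: Lpfun_kmeasurable.
- exact: Lpfun_kmeasurable.
exact: repr_class.
Qed.

Fact Lp_normD (u v : Lp) : Lp_norm (u + v) <= Lp_norm u + Lp_norm v.
Proof.
elim/Lp_ind: u => f; elim/Lp_ind: v => g.
rewrite Lp_addE -Lp_classD !Lp_norm_class -sf_injD sf_inj_le -lee_fin EFinD.
rewrite !fineK ?Lpfun_fin_num //.
by apply: kLnormD => //; exact: Lpfun_kmeasurable.
Qed.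

Fact Lp_normZ (a : K) (u : Lp) : Lp_norm (a *: u) = `|a| * Lp_norm u.
Proof.
elim/Lp_ind: u => f.
rewrite Lp_scaleE -Lp_classZ !Lp_norm_class modulusE -sf_injM; congr sf_inj.
have -> : kLnorm mu p (a *: f) = ((modulus a)%:E * kLnorm mu p f)%E.
  by rewrite -kLnormZ //; exact: Lpfun_kmeasurable.
by rewrite fineM // Lpfun_fin_num.
Qed.

Fact Lp_norm0_eq0 (u : Lp) : Lp_norm u = 0 -> u = 0.
Proof.
elim/Lp_ind: u => f; rewrite Lp_norm_class -sf_inj0 => /sf_inj_inj f0.
apply/Lp_classP.
have /(kLnorm_eq0 p1 (Lpfun_kmeasurable _)) : kLnorm mu p f = 0%E.
  by rewrite -[LHS]fineK ?f0 ?Lpfun_fin_num.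
by apply: filterS => x ->.
Qed.

HB.instance Definition _ :=
  Lmodule_isNormed.Build K Lp Lp_normD Lp_normZ Lp_norm0_eq0.

Lemma Lp_normE (f : fun_) : `|Lp_class f| = sf_inj (fine (kLnorm mu p f)).
Proof. exact: Lp_norm_class. Qed.

End Lp_space.

Section dynamics.
Variables (R : realType) (K : numFieldType) (V : normedModType K).
Implicit Types T S : V -> V.

Definition bounded_operator T : Prop :=
  exists M : K, forall x, `|T x| <= M * `|x|.

Definition mixing T : Prop :=
  forall U W : set V, open U -> U !=set0 -> open W -> W !=set0 ->
  exists n0 : nat, (0 < n0)%N /\
    forall n, (n0 <= n)%N -> (iter n T @` U) `&` W !=set0.

Definition hypercyclic T : Prop :=
  exists x, dense [set iter n T x | n in [set n | (0 < n)%N]].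

Definition periodic_point T : set V :=
  [set x | exists n, (0 < n)%N /\ iter n T x = x].

Definition Devaney_chaotic T : Prop :=
  hypercyclic T /\ dense (periodic_point T).

Definition upper_density (D : set nat) : \bar R :=
  limn_esup (fun N => ((\sum_(1 <= k < N.+1) (k \in D))%N%:R / N%:R)%:E).

Definition distributionally_chaotic T : Prop :=
  exists (x : V) (D E : set nat),
    [/\ D `<=` [set n | (0 < n)%N] /\ E `<=` [set n | (0 < n)%N],
        upper_density D = 1%E /\ upper_density E = 1%E,
        `|iter n T x| @[n --> within D \oo] --> (0 : K) &
        `|iter n T x| @[n --> within E \oo] --> pinfty_nbhs K].

Definition unconditionally_convergent (u : nat -> V) : Prop :=
  forall s : nat -> nat, bijective s -> cvgn (series (u \o s)).

(* The series start at [n = 1], hence the shift [n.+1]. *)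
Definition frequent_hypercyclicity_criterion T : Prop :=
  exists (X0 : set V) (S : V -> V),
    [/\ dense X0, (forall x, X0 x -> X0 (S x)) &
        forall x, X0 x ->
          [/\ unconditionally_convergent (fun n => iter n.+1 T x),
              unconditionally_convergent (fun n => iter n.+1 S x) &
              T (S x) = x]].

End dynamics.

(** Odometers. Sequences are indexed from [0]: [odo_alpha b n] is the
    [(n+1)]-st term of the usual sequence [alpha_1, alpha_2, ...]. *)
Record odometer_base := OdometerBase {
  odo_alpha :> nat -> nat;
  odo_alpha_ge2 : forall n, (2 <= odo_alpha n)%N
}.

Section odometer.
Variable b : odometer_base.

Definition digit0 n : 'I_(b n) := Ordinal (ltnW (odo_alpha_ge2 b n)).

Definition digit_product : Type :=
  prod_topology (fun n => discrete_topology 'I_(b n) : topologicalType).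

HB.instance Definition _ := Topological.on digit_product.
HB.instance Definition _ := isPointed.Build digit_product digit0.

Definition odometer_space := g_sigma_algebraType (@open digit_product).

(* [ordS] is the successor modulo [b n]; it is only applied here to a digit
   other than the largest one. *)
Definition odometer (x : odometer_space) : odometer_space := fun n =>
  if pselect (exists j, x j != (b j).-1 :> nat) is left carry_stops then
    let l := ex_minn carry_stops in
    if (n < l)%N then digit0 n else if n == l then ordS (x n) else x n
  else digit0 n.

End odometer.

(* A probability measure on the finite set ['I_(b n)] is given by its masses. *)
Record odometer_system (R : realType) := OdometerSystem {
  odo_base : odometer_base;
  odo_mass : forall n, 'I_(odo_base n) -> R;
  odo_mu : probability (odometer_space odo_base) R;
  odo_mass_gt0 : forall n (a : 'I_(odo_base n)), 0 < odo_mass a;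
  odo_mass_sum1 : forall n, \sum_(a : 'I_(odo_base n)) odo_mass a = 1;
  odo_mu_product : forall (N : nat) (B : forall n, {set 'I_(odo_base n)}),
    odo_mu [set x | forall n, (n < N)%N -> x n \in B n] =
    (\prod_(n < N) \sum_(a in B n) odo_mass a)%:E;
  odo_mass_max :
    (\prod_(n < N) \big[Num.max/0]_(a : 'I_(odo_base n)) odo_mass a)
      @[N --> \oo] --> (0 : R)
}.

(* For every [phi] in [L^p] the function [phi \o f] is again in [L^p], and [T]
   sends the class of [phi] to that of [phi \o f]; there is at most one such [T],
   and its existence includes the compatibility of [phi |-> phi \o f] with
   almost everywhere equality. *)
Definition composition_operator d (X : measurableType d) (R : realType)
    (mu : {measure set X -> \bar R}) (K : scalarField R) (p : R) (p1 : 1 <= p)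
    (f : X -> X) (T : Lp mu K p1 -> Lp mu K p1) : Prop :=
  forall phi : Lpfun mu K p1, exists psi : Lpfun mu K p1,
    (psi =1 phi \o f) /\ T (Lp_class phi) = Lp_class psi.

(* Main.v *)
Require Import Defs.
From HB Require Import structures.
From mathcomp Require Import all_boot all_order all_algebra.
From mathcomp Require Import all_classical all_reals all_analysis.
From mathcomp Require Import measurable_realfun zify ring lra.
From mathcomp.real_closed Require Import complex.
Set Implicit Arguments.
Unset Strict Implicit.
Unset Printing Implicit Defensive.
Import Order.TTheory GRing.Theory Num.Theory.
Import numFieldNormedType.Exports.
Local Open Scope classical_set_scope.
Local Open Scope ring_scope.

(** The odometer is the binary one, with a digit 1 of probability [1 / (n + 2)] at
    the index [n] (indices start at 0). Reading the first [n] digits as an integer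
    modulo [2 ^ n], their [residue], the odometer [f] adds 1. Let [T] be the
    composition operator.

    Boundedness. When the carry stops at the digit [n], the prefix [1...10] becomes
    [0...01], and the quotient of the masses of these two cylinders is
    [(n + 1) / n!], hence at most 2 ([P_preimage_odometer_le]).

    Mixing and chaos. The [window m s], where some digit between [m] and [m + s] is
    1, has measure at most [(s + 1) / (m + 1)]; nevertheless, for
    [2 ^ m <= k < 2 ^ (m + s)], the iterate [f^k] maps its whole complement into it
    ([window_shift]). So the values of a function on a small window, which hardly
    matter for its norm, are those that [T^k] shows almost everywhere. The functions
    of finitely many digits are dense ([cylinder_Lp_dense]) and periodic under [T],
    so that they can also be moved backward in time; they are the periodic points
    needed for Devaney chaos, and they provide the values to be put on the windows.
    A single window gives mixing ([mixing_binary]). A sequence of windows that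
    escapes to infinity fast enough carries a sequence of prescribed functions
    [g j], and the resulting vector [eta] satisfies [T^n eta] close to [T^n g j] on
    the whole stretch of times of the [j]-th window ([glide_iter],
    [glide_exists]); this uses that the norm of [T^n] is at most [2 ^ n]. Suitable
    [g j] make [eta] hypercyclic ([hypercyclic_binary]) or distributionally
    irregular ([distributionally_chaotic_binary]).

    Failure of the criterion. For [p >= 2], the terms of an unconditionally
    convergent series in L^p have summable [p]-th powers of norms
    ([unconditional_bounded]): by Clarkson's inequality some choice of signs makes
    the [p]-th power of the norm of a signed sum as large as the sum of the [p]-th
    powers. If the series of the [T^n x] converges unconditionally, the measures of
    the preimages by [f^n] of a set where [x] is bounded away from 0 are therefore
    summable, and almost every point visits this set finitely often. But [f] is
    conservative: two points of a wandering set cannot have the same digits from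
    some index on, since they would lie on one orbit, so the measure of the set is
    at most that of the largest cylinder of any given depth ([wandering_null]).
    Hence [x = 0] ([not_FHC]), whereas a dense set contains a nonzero [x]. *)

(** * The real-valued norm of an L^p space *)

Section Lp_interface.
Context d (T : measurableType d) (R : realType).
Variables (mu : {measure set T -> \bar R}) (K : scalarField R).
Variables (p : R) (p1 : 1 <= p).
Local Notation L := (Lp mu K p1).
Local Notation fun_ := (Lpfun mu K p1).
Implicit Types (u v w : L) (phi psi : T -> K) (e : R).

Let p0 : 0 < p. Proof. exact: Lp_gt0 p1. Qed.

Lemma sf_inj_lt (a b : R) : (sf_inj a < sf_inj b :> K) = (a < b).
Proof. exact/leW_mono/sf_inj_le. Qed.

Lemma sf_inj_gt0 (a : R) : (0 < sf_inj a :> K) = (0 < a).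
Proof. by rewrite -sf_inj0 sf_inj_lt. Qed.

Lemma scalar_gt0E (a : K) : 0 < a -> a = sf_inj (modulus a) /\ 0 < modulus a.
Proof.
by move=> a0; have := modulusE a; rewrite gtr0_norm // => ea; rewrite -sf_inj_gt0 -ea.
Qed.

Lemma modulusN (a : K) : modulus (- a) = modulus a.
Proof. by apply: (@sf_inj_inj _ K); rewrite -!modulusE normrN. Qed.

Lemma modulusB (a b : K) : modulus (a - b) <= modulus a + modulus b.
Proof. by rewrite -(modulusN b) modulusD. Qed.

(** The norm as a real number: [`|u|] itself lies in the scalar field [K]. *)
Definition nrm u : R := fine (kLnorm mu p (repr u)).

Lemma nrmE u : `|u| = sf_inj (nrm u). Proof. by []. Qed.

Lemma nrm_class (f : fun_) : nrm (Lp_class f) = fine (kLnorm mu p f).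
Proof. by apply: (@sf_inj_inj _ K); rewrite -Lp_norm_class. Qed.

Lemma nrm_ge0 u : 0 <= nrm u.
Proof. by rewrite fine_ge0 // Lnorm_ge0. Qed.

Lemma nrmD u v : nrm (u + v) <= nrm u + nrm v.
Proof. by rewrite -(sf_inj_le K) sf_injD -!nrmE ler_normD. Qed.

Lemma nrmN u : nrm (- u) = nrm u.
Proof. by apply: (@sf_inj_inj _ K); rewrite -!nrmE normrN. Qed.

Lemma nrm_distC u v : nrm (u - v) = nrm (v - u).
Proof. by rewrite -nrmN opprB. Qed.

Lemma nrm_dist_triangle w u v : nrm (u - v) <= nrm (u - w) + nrm (w - v).
Proof. by apply: le_trans (nrmD _ _); rewrite addrA subrK. Qed.

Lemma open_nrm (U : set L) u : open U -> U u ->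
  exists2 e, 0 < e & forall v, nrm (u - v) < e -> U v.
Proof.
move=> oU Uu; have /nbhs_ballP[a /= a0 H] := open_nbhs_nbhs (conj oU Uu).
have [ea ea0] := scalar_gt0E a0; exists (modulus a) => // v uv; apply: H.
by rewrite -ball_normE /= nrmE ea sf_inj_lt.
Qed.

Lemma dense_nrm (S : set L) :
  (forall u e, 0 < e -> exists2 v, S v & nrm (u - v) < e) -> dense S.
Proof.
move=> H U [u Uu] oU; have [e e0 Ue] := open_nrm oU Uu.
by have [v Sv uv] := H u e e0; exists v; split => //; exact: Ue.
Qed.

Lemma nrm_dense (S : set L) u e : dense S -> 0 < e -> exists2 v, S v & nrm (u - v) < e.
Proof.
move=> dS e0; have [|v [uv Sv]] := dS (ball u (sf_inj e : K)) _ (ball_open _ _).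
  by exists u; apply: ballxx; rewrite sf_inj_gt0.
by exists v => //; move: uv; rewrite -ball_normE /= nrmE sf_inj_lt.
Qed.

Lemma bounded_nrm (S : L -> L) (C : R) :
  (forall u, nrm (S u) <= C * nrm u) -> bounded_operator S.
Proof.
by move=> H; exists (sf_inj C) => u; rewrite !nrmE -sf_injM sf_inj_le.
Qed.

Lemma cvg_nrm0 (D : set nat) (u : nat -> L) :
  (forall e, 0 < e -> exists N, forall n, (N <= n)%N -> D n -> nrm (u n) < e) ->
  `|u n| @[n --> within D \oo] --> (0 : K).
Proof.
move=> H; apply/cvgrPdist_lt => a a0; have [ea e0] := scalar_gt0E a0.
have [N HN] := H _ e0; exists N => // n /= Nn Dn.
by rewrite sub0r normrN normr_id nrmE ea sf_inj_lt; exact: HN.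
Qed.

Lemma cvg_nrm_pinfty (D : set nat) (u : nat -> L) :
  (forall A : R, exists N, forall n, (N <= n)%N -> D n -> A < nrm (u n)) ->
  `|u n| @[n --> within D \oo] --> pinfty_nbhs K.
Proof.
move=> H S [M [Mr HM]]; have [N HN] := H (modulus M); exists N => // n /= Nn Dn.
apply: HM; apply: (le_lt_trans (real_ler_norm Mr)).
by rewrite modulusE nrmE sf_inj_lt; exact: HN.
Qed.

Lemma cvgn_nrm_cauchy (u : nat -> L) e : cvgn u -> 0 < e ->
  exists N, forall m n, (N <= m)%N -> (N <= n)%N -> nrm (u m - u n) < e.
Proof.
move=> /cvg_cauchy /cauchyP H e0.
have [|v /= [N _ HN]] := H (sf_inj (e / 2) : K).
  by rewrite sf_inj_gt0 divr_gt0.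
exists N => m n Nm Nn; have := HN m Nm; have := HN n Nn.
rewrite -ball_normE /= !nrmE !sf_inj_lt => h1 h2.
by have := nrm_dist_triangle v (u m) (u n); rewrite (nrm_distC (u m) v); lra.
Qed.

(** The [p]-th power of the norm, which adds up over disjoint supports. *)
Definition Lp_energy phi : \bar R := (\int[mu]_x (modulus (phi x) `^ p)%:E)%E.

Lemma energy_ge0 phi : (0 <= Lp_energy phi)%E.
Proof. by apply: integral_ge0 => x _; rewrite lee_fin powR_ge0. Qed.

Lemma kLnorm_energy phi : (kLnorm mu p phi `^ p = Lp_energy phi)%E.
Proof.
rewrite /kLnorm poweR_Lnorm ?gt_eqF //; apply: eq_integral => x _ /=.
by rewrite ger0_norm ?modulus_ge0.
Qed.

Lemma nrm_energy (f : fun_) : ((nrm (Lp_class f) `^ p)%:E = Lp_energy f)%E.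
Proof. by rewrite nrm_class -kLnorm_energy -poweR_EFin fineK // Lpfun_fin_num. Qed.

Lemma nrm_le (f : fun_) e : 0 <= e ->
  (Lp_energy f <= (e `^ p)%:E)%E -> nrm (Lp_class f) <= e.
Proof.
move=> e0; rewrite -nrm_energy lee_fin leNgt => H; rewrite leNgt; apply: contra H => lt.
by rewrite gt0_ltr_powR // ?nnegrE ?nrm_ge0.
Qed.

End Lp_interface.

(** * Composition operators of nonsingular maps *)

Section Koopman.
Context d (T : measurableType d) (R : realType).
Variables (mu : {measure set T -> \bar R}) (K : scalarField R).
Variables (p : R) (p1 : 1 <= p).
Local Notation L := (Lp mu K p1).
Local Notation fun_ := (Lpfun mu K p1).
Local Notation energy := (Lp_energy mu p).
Implicit Types (u v w : L) (phi psi : T -> K) (e : R).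

Let p0 : 0 < p. Proof. exact: Lp_gt0 p1. Qed.

Lemma eq_energy phi psi : phi =1 psi -> energy phi = energy psi.
Proof. by move=> /funext ->. Qed.

Lemma measurable_energy phi : kmeasurable phi ->
  measurable_fun [set: T] (fun x => (modulus (phi x) `^ p)%:E).
Proof.
move=> /(measurable_modulusX p); apply: eq_measurable_fun => x _ /=.
by rewrite ger0_norm ?modulus_ge0.
Qed.

Lemma Lp_predP phi : kmeasurable phi -> (energy phi < +oo)%E -> phi \in Lp_pred mu p1.
Proof.
move=> mphi ephi; apply/asboolP; split => //.
rewrite -[kLnorm _ _ _]poweRe1 ?Lnorm_ge0 // -(mulfV (lt0r_neq0 p0)) // poweRrM kLnorm_energy //.
exact: poweR_lty.
Qed.

Definition mkLp phi (m : kmeasurable phi) (e : (energy phi < +oo)%E) : fun_ :=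
  MkLpfun (Lp_predP m e).

Lemma Lpfun_energy_lty (phi : fun_) : (energy phi < +oo)%E.
Proof. by rewrite -nrm_energy ltry. Qed.

Lemma energy_le_integral phi (h : T -> \bar R) : kmeasurable phi ->
  measurable_fun [set: T] h -> (forall x, 0 <= h x)%E ->
  (forall x, (modulus (phi x) `^ p)%:E <= h x)%E -> (energy phi <= \int[mu]_x h x)%E.
Proof.
move=> mphi mh h0 H; apply: ge0_le_integral => //.
- by move=> x _; rewrite lee_fin powR_ge0.
- exact: measurable_energy.
Qed.

Lemma kmeasurable_comp (g : T -> T) phi : measurable_fun [set: T] g ->
  kmeasurable phi -> kmeasurable (phi \o g).
Proof.
by move=> mg [mr mi]; split; [exact: measurableT_comp mr mg|exact: measurableT_comp mi mg].
Qed.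

Lemma kmeasurable_cst (c : K) : kmeasurable (fun _ : T => c).
Proof. by split; exact: measurable_cst. Qed.

Lemma kmeasurable_glue (S : nat -> set T) (g : nat -> T -> K) phi :
  (forall j, measurable (S j)) -> \bigcup_j S j = setT ->
  (forall j, kmeasurable (g j)) -> (forall j x, S j x -> phi x = g j x) ->
  kmeasurable phi.
Proof.
move=> mS US mg phig; split; rewrite -US; apply/measurable_fun_bigcup => // j.
  apply: (@eq_measurable_fun _ _ _ _ _ (sf_re \o g j)).
    by move=> x /[!inE] Sx /=; rewrite (phig j).
  by apply: measurable_funTS; case: (mg j).
apply: (@eq_measurable_fun _ _ _ _ _ (sf_im \o g j)).
  by move=> x /[!inE] Sx /=; rewrite (phig j).
by apply: measurable_funTS; case: (mg j).
Qed.

Lemma kmeasurable_if (S : set T) phi psi : measurable S ->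
  kmeasurable phi -> kmeasurable psi ->
  kmeasurable (fun x => if x \in S then phi x else psi x).
Proof.
move=> mS mphi mpsi.
apply: (@kmeasurable_glue (fun j => if j == 0%N then S else ~` S)
  (fun j => if j == 0%N then phi else psi)).
- by case=> //= _; exact: measurableC.
- apply/seteqP; split=> // x _; have [Sx|Sx] := pselect (S x); first by exists 0%N.
  by exists 1%N.
- by case.
- case=> [|j] x /= Sx; first by rewrite mem_set.
  by rewrite memNset.
Qed.

Lemma kmeasurableB phi psi : kmeasurable phi -> kmeasurable psi ->
  kmeasurable (fun x => phi x - psi x).
Proof.
move=> mphi mpsi; have := kmeasurableD mphi (kmeasurableZ (-1) mpsi).
by congr kmeasurable; apply/funext => x /=; rewrite mulN1r.
Qed.

Lemma Lp_classB (phi psi : fun_) : Lp_class phi - Lp_class psi = Lp_class (phi - psi).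
Proof. by rewrite Lp_classD Lp_classN. Qed.

Section pullback.
Variables (g : T -> T) (C : R).
Hypotheses (mg : measurable_fun [set: T] g) (C0 : 0 <= C).
Hypothesis g_le : forall A, measurable A -> (mu (g @^-1` A) <= C%:E * mu A)%E.

Lemma integral_comp_le (h : T -> \bar R) : measurable_fun [set: T] h ->
  (forall x, 0 <= h x)%E -> (\int[mu]_x h (g x) <= C%:E * \int[mu]_x h x)%E.
Proof.
move=> mh h0; pose gm : {mfun T >-> T} := HB.pack g (isMeasurableFun.Build _ _ _ _ _ mg).
rewrite -(@ge0_integral_mscale _ _ _ mu setT measurableT (NngNum C0)) //.
have -> : (\int[mu]_x h (g x) = \int[pushforward mu gm]_x h x)%E.
  by rewrite ge0_integral_pushforward.
by apply: ge0_le_measure_integral => // S mS; exact: g_le.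
Qed.

Lemma ae_comp (Q : T -> Prop) : {ae mu, forall x, Q x} -> {ae mu, forall x, Q (g x)}.
Proof.
move=> [N [mN N0 QN]]; exists (g @^-1` N); split.
- by rewrite -[X in measurable X]setTI; exact: mg.
- apply/eqP; rewrite eq_le measure_ge0 andbT.
  by apply: (le_trans (g_le mN)); rewrite N0 mule0.
- by move=> x /= Qx; apply: QN.
Qed.

Lemma energy_comp_le phi : kmeasurable phi -> (energy (phi \o g) <= C%:E * energy phi)%E.
Proof.
move=> mphi; apply: (@integral_comp_le (fun x => (modulus (phi x) `^ p)%:E)).
  exact: measurable_energy.
by move=> x; rewrite lee_fin powR_ge0.
Qed.

Lemma energy_comp_lty (phi : fun_) : (energy (phi \o g) < +oo)%E.
Proof.
apply: (le_lt_trans (energy_comp_le (Lpfun_kmeasurable phi))).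
by rewrite lte_mul_pinfty ?lee_fin ?Lpfun_energy_lty.
Qed.

Definition comp_Lp (phi : fun_) : fun_ :=
  mkLp (kmeasurable_comp mg (Lpfun_kmeasurable phi)) (energy_comp_lty phi).

Definition koopman (u : L) : L := Lp_class (comp_Lp (repr u)).

Lemma koopman_class (phi : fun_) : koopman (Lp_class phi) = Lp_class (comp_Lp phi).
Proof. by apply/Lp_classP; exact: (ae_comp (repr_class phi)). Qed.

Lemma koopman_linear : linear koopman.
Proof.
move=> a; elim/Lp_ind=> phi; elim/Lp_ind=> psi.
rewrite Lp_scaleE -Lp_classZ Lp_addE -Lp_classD !koopman_class.
by rewrite Lp_scaleE -Lp_classZ Lp_addE -Lp_classD; apply/Lp_classP; exact: aeW.
Qed.

HB.instance Definition _ := GRing.isLinear.Build K L L _ koopman koopman_linear.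

Lemma koopman_composition : composition_operator g koopman.
Proof. by move=> phi; exists (comp_Lp phi); split => //; exact: koopman_class. Qed.

Lemma koopman_bounded : 1 <= C -> bounded_operator koopman.
Proof.
move=> C1; apply: (@bounded_nrm _ _ _ _ _ _ _ _ C); elim/Lp_ind=> phi.
rewrite koopman_class; apply: nrm_le; first by rewrite mulr_ge0 ?nrm_ge0.
apply: (le_trans (energy_comp_le (Lpfun_kmeasurable phi))).
rewrite powRM ?nrm_ge0 // EFinM nrm_energy; apply: lee_wpmul2r; first exact: energy_ge0.
by rewrite lee_fin le1r_powR.
Qed.

End pullback.
End Koopman.

(** * Gliding humps along an orbit *)

Lemma integral_scaled_indic d (T : measurableType d) (R : realType)
    (mu : {measure set T -> \bar R}) (S : set T) (c : R) : measurable S -> 0 <= c ->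
  (\int[mu]_x (c * \1_S x)%:E = c%:E * mu S)%E.
Proof.
move=> mS c0; under eq_integral do rewrite EFinM.
have -> : (\int[mu]_x (c%:E * (\1_S x)%:E) = c%:E * \int[mu]_x (\1_S x)%:E)%E.
  apply: ge0_integralZl => //.
  by apply/measurable_EFinP; exact: measurable_indic.
by rewrite integral_indic ?setIT.
Qed.

Section weighted_indicators.
Context d (T : measurableType d) (R : realType).
Variables (mu : {measure set T -> \bar R}) (S : nat -> set T) (c : nat -> R).
Hypotheses (mS : forall i, measurable (S i)) (c0 : forall i, 0 <= c i).

(** Dominates the [p]-th power of a function that is at most [c i `^ p^-1] on
    [S i] for every [i] and vanishes outside the union of the [S i]. *)
Definition indicator_series (x : T) : \bar R := (\sum_(i <oo) (c i * \1_(S i) x)%:E)%E.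

Let term_ge0 i x : (0 <= (c i * \1_(S i) x)%:E)%E.
Proof. by rewrite lee_fin mulr_ge0 ?indicE ?ler0n. Qed.

Let measurable_term i : measurable_fun [set: T] (fun x => (c i * \1_(S i) x)%:E).
Proof.
apply/measurable_EFinP; apply: measurable_funM; first exact: measurable_cst.
exact: measurable_indic.
Qed.

Lemma indicator_series_ge0 x : (0 <= indicator_series x)%E.
Proof. by apply: nneseries_ge0 => i _ _; exact: term_ge0. Qed.

Lemma measurable_indicator_series : measurable_fun [set: T] indicator_series.
Proof. by apply: (@ge0_emeasurable_sum _ _ _ _ _ xpredT) => // i x _ _; exact: term_ge0. Qed.

Lemma indicator_series_ge i x : S i x -> ((c i)%:E <= indicator_series x)%E.
Proof.
move=> Six; apply: (@le_trans _ _ (\sum_(0 <= k < i.+1) (c k * \1_(S k) x)%:E)%E).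
  rewrite big_nat_recr //= indicE mem_set // mulr1 leeDr //.
  by apply: sume_ge0 => k _; exact: term_ge0.
by apply: nneseries_lim_ge => k _ _; exact: term_ge0.
Qed.

Lemma integral_indicator_series_le (e : R) : 0 <= e ->
  (forall i, (c i)%:E * mu (S i) <= (e / (2 ^ i.+1)%:R)%:E)%E ->
  (\int[mu]_x indicator_series x <= e%:E)%E.
Proof.
move=> e0 H.
have -> : (\int[mu]_x indicator_series x = \sum_(i <oo) \int[mu]_x (c i * \1_(S i) x)%:E)%E.
  by apply: integral_nneseries => // i x _; exact: term_ge0.
apply: le_trans (epsilon_trick0 xpredT e0); apply: lee_nneseries => i *.
  by apply: integral_ge0 => x _; exact: term_ge0.
by rewrite integral_scaled_indic.
Qed.

End weighted_indicators.

Section composition_dynamics.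
Context d (T : measurableType d) (R : realType).
Variables (mu : probability T R) (K : scalarField R).
Variables (p : R) (p1 : 1 <= p).
Local Notation L := (Lp mu K p1).
Local Notation fun_ := (Lpfun mu K p1).
Local Notation energy := (Lp_energy mu p).
Variables (f : T -> T) (U : L -> L).
Hypotheses (mf : measurable_fun [set: T] f) (f_U : composition_operator f U).
Implicit Types (u v w : L) (phi psi : T -> K) (e : R).

Let p0 : 0 < p. Proof. exact: Lp_gt0 p1. Qed.

Lemma measurable_iterate n : measurable_fun [set: T] (iter n f).
Proof.
elim: n => [|n IH]; first exact: measurable_id.
exact: measurableT_comp mf IH.
Qed.

Lemma iter_class n (phi : fun_) : exists2 psi : fun_,
  forall x, psi x = phi (iter n f x) & iter n U (Lp_class phi) = Lp_class psi.
Proof.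
elim: n => [|n [psi psiE IH]]; first by exists phi.
have [psi' [psi'E e]] := f_U psi; exists psi' => [x|]; last by rewrite iterS IH e.
by rewrite psi'E /= psiE -iterSr.
Qed.

Lemma iter_class_periodic n (phi : fun_) : (forall x, phi (iter n f x) = phi x) ->
  iter n U (Lp_class phi) = Lp_class phi.
Proof.
move=> H; have [psi psiE ->] := iter_class n phi.
by apply/Lp_classP; apply: aeW => x; rewrite psiE.
Qed.

Lemma nrm_iter_le n (phi psi : fun_) e : 0 <= e ->
  (energy (fun x => phi (iter n f x) - psi x)%R <= (e `^ p)%:E)%E ->
  nrm (iter n U (Lp_class phi) - Lp_class psi) <= e.
Proof.
move=> e0 H; have [phi' phi'E ->] := iter_class n phi.
rewrite (Lp_classB phi' psi).
apply: nrm_le.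
  exact: e0.
apply: le_trans H.
rewrite le_eqVlt; apply/orP; left; apply/eqP; apply: eq_energy => x.
by rewrite LpfunD LpfunN phi'E.
Qed.

Lemma nrm_iter0_le n (phi : fun_) e : 0 <= e ->
  (energy (fun x => phi (iter n f x)) <= (e `^ p)%:E)%E ->
  nrm (iter n U (Lp_class phi)) <= e.
Proof.
move=> e0 H; have [phi' phi'E ->] := iter_class n phi.
by apply: (nrm_le e0); rewrite (eq_energy _ _ phi'E).
Qed.

Lemma bounded_energy phi (M : R) : kmeasurable phi ->
  (forall x, modulus (phi x) <= M) -> (energy phi <= (M `^ p)%:E)%E.
Proof.
move=> mphi H; apply: (@le_trans _ _ (\int[mu]_x (cst (M `^ p)%:E x))%E).
  apply: energy_le_integral => // x; rewrite lee_fin ?powR_ge0 //.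
  by rewrite ge0_ler_powR ?nnegrE ?modulus_ge0 ?(ltW p0) // (le_trans (modulus_ge0 (phi x))).
by rewrite integral_cst //= probability_setT mule1.
Qed.

Lemma bounded_Lp phi (M : R) : kmeasurable phi ->
  (forall x, modulus (phi x) <= M) -> exists psi : fun_, psi = phi :> (T -> K).
Proof.
move=> mphi H; have e := le_lt_trans (bounded_energy mphi H) (ltry _).
by exists (mkLp p1 mphi e).
Qed.

Lemma energy_support_le phi (S : set T) (M : R) : kmeasurable phi -> measurable S ->
  (forall x, ~ S x -> phi x = 0) -> (forall x, modulus (phi x) <= M) ->
  (energy phi <= (M `^ p)%:E * mu S)%E.
Proof.
move=> mphi mS phi0 H; have M0 : 0 <= M by exact: le_trans (modulus_ge0 (phi point)) (H point).
apply: (@le_trans _ _ (\int[mu]_x (M `^ p * \1_S x)%:E)%E); last first.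
  by rewrite integral_scaled_indic ?powR_ge0.
apply: energy_le_integral => //.
- by apply/measurable_EFinP; apply: measurable_funM;
    [exact: measurable_cst|exact: measurable_indic].
- by move=> x; rewrite lee_fin mulr_ge0 ?powR_ge0 ?indicE ?ler0n.
move=> x; rewrite lee_fin indicE; have [Sx|Sx] := pselect (S x).
  by rewrite mem_set // mulr1 ge0_ler_powR ?nnegrE ?modulus_ge0 ?(ltW p0).
by rewrite memNset // mulr0 phi0 // modulus0 powR0 // gt_eqF.
Qed.

Section gliding.
Variables (C : R) (S : nat -> set T) (M : nat -> R) (N : nat -> nat) (g : nat -> T -> K).
Hypotheses (C1 : 1 <= C) (mS : forall j, measurable (S j)).
Hypothesis f_le : forall A, measurable A -> (mu (f @^-1` A) <= C%:E * mu A)%E.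
Hypotheses (M0 : 0 <= M 0) (M_nd : {homo M : i j / (i <= j)%N >-> i <= j}).
Hypotheses (mg : forall j, kmeasurable (g j)) (gM : forall j x, modulus (g j x) <= M j).
(* [C ^+ N j] bounds the dilation of the measure by [N j] steps of [f]; the
   factors [2 ^ i.+1] make the series over [i] converge. *)
Hypothesis S_small0 : forall i,
  (((2 * M i) `^ p)%:E * mu (S i) <= (1 / (2 ^ i.+1)%:R)%:E)%E.
Hypothesis S_small : forall i j, (j < i)%N ->
  (((2 * M i) `^ p)%:E * mu (S i) <= ((2^-1 ^+ j / C ^+ N j) / (2 ^ i.+1)%:R)%:E)%E.

Let last_in j x := S j x /\ forall i, (j < i)%N -> ~ S i x.

(** The hump [g j] sits on [S j] and is only overwritten on the later, much
    smaller, sets [S i]. The points in infinitely many [S j] form a null set when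
    the measures of the [S j] are summable. *)
Definition glide x : K :=
  if pselect (exists j, last_in j x) is left e then g (projT1 (cid e)) x else 0.

Let last_in_inj i j x : last_in i x -> last_in j x -> i = j.
Proof.
move=> [Si Hi] [Sj Hj].
by case: (ltngtP i j) => // lt; [case: (Hi _ lt Sj)|case: (Hj _ lt Si)].
Qed.

Let glideE j x : last_in j x -> glide x = g j x.
Proof.
move=> jx; rewrite /glide; case: pselect => [e|]; last by case; exists j.
by rewrite (last_in_inj (projT2 (cid e)) jx).
Qed.

Let glide0 x : (forall j, ~ last_in j x) -> glide x = 0.
Proof. by move=> H; rewrite /glide; case: pselect => // e; have [j /H] := e. Qed.

Let M_ge0 i : 0 <= M i.
Proof. exact: le_trans M0 (M_nd (leq0n i)). Qed.

Lemma kmeasurable_glide : kmeasurable glide.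
Proof.
have mD j : measurable [set x | last_in j x].
  rewrite (_ : [set x | _] = S j `&` \bigcap_(i in [set i | (j < i)%N]) ~` S i).
    apply: measurableI => //; apply: bigcap_measurable; first by exists j.+1 => /=.
    by move=> i _; exact: measurableC.
  by apply/seteqP; split=> x [Sj H]; split => // i; exact: H.
apply: (@kmeasurable_glue _ _ _ _
  (fun j => if j is j'.+1 then [set x | last_in j' x] else ~` \bigcup_j [set x | last_in j x])
  (fun j => if j is j'.+1 then g j' else fun=> 0)).
- by case=> [|j] //; apply: measurableC; exact: bigcupT_measurable.
- apply/seteqP; split=> // x _; have [[j jx]|H] := pselect (exists j, last_in j x).
    by exists j.+1.
  by exists 0%N => // -[j _ jx]; apply: H; exists j.
- by case=> [|j]; [exact: kmeasurable_cst|exact: mg].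
- case=> [x H|j x]; last exact: glideE.
  by apply: glide0 => j jx; apply: H; exists j.
Qed.

Let tail_coef j i : R := if (j < i)%N then (2 * M i) `^ p else 0.

Let tail_coef_ge0 j i : 0 <= tail_coef j i.
Proof. by rewrite /tail_coef; case: ifP => _; rewrite ?powR_ge0. Qed.

(** Inside [S j] the function [glide] can differ from [g j] only where a later
    [S i] overwrites it; outside [S j], both are bounded by [M j] up to such
    overwriting. *)
Let glide_dist j x :
  ((modulus (glide x - g j x) `^ p)%:E <=
    indicator_series S (tail_coef j) x +
    ((2 * M j) `^ p * \1_(~` S j) x)%:E)%E.
Proof.
set c := tail_coef j; have c0 : forall i, 0 <= c i := tail_coef_ge0 j.
have far i : (j < i)%N -> S i x -> modulus (glide x - g j x) <= 2 * M i ->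
    ((modulus (glide x - g j x) `^ p)%:E <= indicator_series S c x +
    ((2 * M j) `^ p * \1_(~` S j) x)%:E)%E.
  move=> ji Six le; apply: (@le_trans _ _ (indicator_series S c x)); last first.
    by rewrite leeDl // lee_fin mulr_ge0 ?powR_ge0 ?indicE ?ler0n.
  apply: le_trans _ (indicator_series_ge (S := S) c0 Six); rewrite /c /tail_coef ji lee_fin.
  by rewrite ge0_ler_powR ?nnegrE ?modulus_ge0 ?mulr_ge0 ?(ltW p0).
have near_ : ~ S j x -> modulus (glide x - g j x) <= 2 * M j ->
    ((modulus (glide x - g j x) `^ p)%:E <= indicator_series S c x +
    ((2 * M j) `^ p * \1_(~` S j) x)%:E)%E.
  move=> Sjx le; apply: (@le_trans _ _ ((2 * M j) `^ p * \1_(~` S j) x)%:E); last first.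
    by rewrite leeDr // indicator_series_ge0.
  rewrite indicE mem_set // mulr1 lee_fin.
  by rewrite ge0_ler_powR ?nnegrE ?modulus_ge0 ?mulr_ge0 ?(ltW p0).
have [[i ix]|H] := pselect (exists i, last_in i x).
  rewrite (glideE ix) in far near_ *; have [ji|ij|ij] := ltngtP j i.
  - apply: (far i) => //; first by case: ix.
    rewrite (le_trans (modulusB _ _)) // mulr_natl mulr2n lerD //.
    exact: le_trans (gM j x) (M_nd (ltnW ji)).
  - apply: near_; first by case: ix => _; apply.
    rewrite (le_trans (modulusB _ _)) // mulr_natl mulr2n lerD //.
    exact: le_trans (gM i x) (M_nd (ltnW ij)).
  - rewrite ij subrr modulus0 powR0 ?gt_eqF // adde_ge0 ?indicator_series_ge0 //.
    by rewrite lee_fin mulr_ge0 ?powR_ge0 ?indicE ?ler0n.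
have gx : glide x = 0 by apply: glide0 => j' jx; apply: H; exists j'.
rewrite gx sub0r modulusN in far near_ *.
have le2 i : (j <= i)%N -> modulus (g j x) <= 2 * M i.
  move=> ji; rewrite (le_trans (gM j x)) // (le_trans (M_nd ji)) // ler_peMl ?M_ge0 //.
  by rewrite ler1n.
have [Sj|Sj] := pselect (S j x); last by apply: near_ => //; exact: le2.
have [[i [ji Si]]|H'] := pselect (exists i, (j < i)%N /\ S i x).
  by apply: (far i) => //; exact: le2 (ltnW ji).
by case: H; exists j; split=> // i ji Si; apply: H'; exists i.
Qed.

Lemma glide_energy_lty : (energy glide < +oo)%E.
Proof.
have c0 i : 0 <= (2 * M i) `^ p by exact: powR_ge0.
apply: (@le_lt_trans _ _ (1%:E)%E); last exact: ltry.
apply: le_trans (integral_indicator_series_le mS c0 ler01 S_small0).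
apply: energy_le_integral => //.
- exact: kmeasurable_glide.
- exact: measurable_indicator_series.
- by move=> x; exact: indicator_series_ge0.
move=> x; have [[i ix]|H] := pselect (exists i, last_in i x); last first.
  rewrite glide0 ?modulus0 ?powR0 ?gt_eqF ?indicator_series_ge0 // => j jx.
  by apply: H; exists j.
rewrite (glideE ix); apply: le_trans _ (indicator_series_ge (S := S) c0 (proj1 ix)).
rewrite lee_fin ge0_ler_powR ?nnegrE ?modulus_ge0 ?mulr_ge0 ?(ltW p0) //.
by rewrite (le_trans (gM i x)) // ler_peMl ?M_ge0 // ler1n.
Qed.

Definition glide_Lp : fun_ := mkLp p1 kmeasurable_glide glide_energy_lty.

Lemma f_iter_le n A : measurable A ->
  (mu (iter n f @^-1` A) <= (C ^+ n)%:E * mu A)%E.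
Proof.
elim: n A => [|n IH] A mA; first by rewrite expr0 mul1e.
have mfA : measurable (f @^-1` A) by rewrite -[X in measurable X]setTI; exact: mf.
rewrite (_ : iter n.+1 f @^-1` A = iter n f @^-1` (f @^-1` A)) //.
apply: (le_trans (IH _ mfA)); rewrite exprSr EFinM -muleA lee_wpmul2l ?lee_fin //.
  by rewrite exprn_ge0 // (le_trans ler01 C1).
exact: f_le.
Qed.

(** Outside the small set [S j], the point [iter n f x] lies in [S j], where
    [glide] follows [g j] up to the later sets, and these remain negligible after
    a dilation by [C ^+ n]. *)
Lemma glide_iter j n : (n <= N j)%N -> (forall x, ~ S j x -> S j (iter n f x)) ->
  (energy (fun x => glide (iter n f x) - g j (iter n f x))%R <= (2 * 2^-1 ^+ j)%:E)%E.
Proof.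
move=> nN Sf; have C0 : 0 <= C by exact: le_trans ler01 C1.
set c := tail_coef j; have c0 : forall i, 0 <= c i := tail_coef_ge0 j.
have mfn := measurable_iterate n.
have mH := measurable_indicator_series mS c0.
have mHn : measurable_fun [set: T] (fun x => indicator_series S c (iter n f x)).
  exact: measurableT_comp mH mfn.
have mI : measurable_fun [set: T] (fun x => ((2 * M j) `^ p * \1_(S j) x)%:E).
  by apply/measurable_EFinP; apply: measurable_funM;
    [exact: measurable_cst|exact: measurable_indic].
have I0 x : (0 <= ((2 * M j) `^ p * \1_(S j) x)%:E)%E.
  by rewrite lee_fin mulr_ge0 ?powR_ge0 ?indicE ?ler0n.
have H0 x : (0 <= indicator_series S c x)%E by exact: indicator_series_ge0.
apply: (@le_trans _ _ (\int[mu]_x (indicator_series S c (iter n f x) +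
    ((2 * M j) `^ p * \1_(S j) x)%:E))%E).
  apply: energy_le_integral => //.
  - apply: kmeasurableB; apply: kmeasurable_comp => //; exact: kmeasurable_glide.
  - exact: emeasurable_funD.
  - by move=> x; rewrite adde_ge0.
  move=> x; apply: (le_trans (glide_dist j (iter n f x))).
  rewrite leeD2l // lee_fin ler_wpM2l ?powR_ge0 // !indicE ler_nat.
  have [Sx|Sx] := pselect (S j x); first by rewrite (mem_set Sx) leq_b1.
  by rewrite (memNset (A := ~` S j)) //= => nSx; apply: nSx; exact: Sf.
have -> : (2 * 2^-1 ^+ j)%:E = ((2^-1 ^+ j)%:E + (2^-1 ^+ j)%:E)%E :> \bar R.
  by rewrite -EFinD; congr EFin; lra.
rewrite ge0_integralD // leeD //.
  have Cn0 : 0 <= C ^+ n by rewrite exprn_ge0.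
  apply: (le_trans (integral_comp_le mfn Cn0 (f_iter_le n) mH H0)).
  have e0 : 0 <= 2^-1 ^+ j / C ^+ N j by rewrite divr_ge0 ?exprn_ge0 ?invr_ge0.
  apply: (@le_trans _ _ ((C ^+ n)%:E * (2^-1 ^+ j / C ^+ N j)%:E)%E).
    rewrite lee_wpmul2l ?lee_fin //; apply: integral_indicator_series_le => // i.
    rewrite /c /tail_coef; case: ifP => ji; first exact: S_small.
    by rewrite mul0e lee_fin divr_ge0.
  have CN : 0 < C ^+ N j by rewrite exprn_gt0 // (lt_le_trans ltr01 C1).
  rewrite -EFinM lee_fin mulrCA ler_piMr ?exprn_ge0 ?invr_ge0 //.
  by rewrite ler_pdivrMr // mul1r ler_weXn2l.
rewrite integral_scaled_indic ?powR_ge0 //.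
apply: (le_trans (S_small0 j)); rewrite lee_fin natrX exprS mul1r invfM exprVn.
by rewrite ler_piMl ?invr_ge0 ?exprn_ge0 //; lra.
Qed.

End gliding.
End composition_dynamics.

(** * Unconditional convergence in L^p for p at least 2 *)

Section Clarkson.
Variable R : realType.

Lemma powR_superadditive (x y r : R) : 0 <= x -> 0 <= y -> 1 <= r ->
  x `^ r + y `^ r <= (x + y) `^ r.
Proof.
move=> x0 y0 r1; have r0 : 0 < r by exact: lt_le_trans r1.
rewrite -!(@mulr_powRB1 _ _ r) ?addr_ge0 // mulrDl.
by apply: lerD; apply: ler_wpM2l => //;
  rewrite ge0_ler_powR ?nnegrE ?subr_ge0 ?addr_ge0 ?lerDl ?lerDr.
Qed.

Lemma powR_midpoint (x y r : R) : 0 <= x -> 0 <= y -> 1 <= r ->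
  2 * ((x + y) / 2) `^ r <= x `^ r + y `^ r.
Proof.
move=> x0 y0 r1; have h : 0 <= 2^-1 :> R by [].
have h1 : 2^-1 <= 1 :> R by lra.
have c : (2^-1 * x + (1 - 2^-1) * y) `^ r <= 2^-1 * x `^ r + (1 - 2^-1) * y `^ r.
  by apply: (convex_powR r1 (Itv01 h h1)); rewrite inE /= in_itv /= andbT.
have e : 2^-1 * x + (1 - 2^-1) * y = (x + y) / 2 by lra.
by move: c; rewrite e; lra.
Qed.

Variable K : scalarField R.

Lemma sf_reN (a : K) : sf_re (- a) = - sf_re a.
Proof. by apply: (addIr (sf_re a)); rewrite -sf_reD !addNr sf_re0. Qed.

Lemma sf_imN (a : K) : sf_im (- a) = - sf_im a.
Proof. by apply: (addIr (sf_im a)); rewrite -sf_imD !addNr sf_im0. Qed.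

Lemma modulus_parallelogram (a b : K) :
  modulus (a + b) ^+ 2 + modulus (a - b) ^+ 2 = 2 * (modulus a ^+ 2 + modulus b ^+ 2).
Proof.
rewrite /modulus !sqr_sqrtr ?addr_ge0 ?sqr_ge0 // !sf_reD !sf_imD !sf_reN !sf_imN.
by ring.
Qed.

(** The parallelogram law, then convexity and superadditivity of the power
    [p / 2], which is at least [1]. *)
Lemma modulus_Clarkson (p : R) (a b : K) : 2 <= p ->
  2 * (modulus a `^ p + modulus b `^ p) <= modulus (a + b) `^ p + modulus (a - b) `^ p.
Proof.
move=> p2; pose r := p / 2; have r1 : 1 <= r by rewrite /r; lra.
have e (c : K) : modulus c `^ p = (modulus c ^+ 2) `^ r.
  rewrite -powR_mulrn ?modulus_ge0 // -powRrM; congr (_ `^ _).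
  by rewrite /r; lra.
rewrite !e; have s0 (c : K) : 0 <= modulus c ^+ 2 by exact: sqr_ge0.
apply: le_trans (powR_midpoint (s0 _) (s0 _) r1).
rewrite modulus_parallelogram ler_pM2l // mulrAC mulfV ?mul1r //.
exact: powR_superadditive.
Qed.

End Clarkson.

Section rearrangement.
Variables (N : nat -> nat) (F : nat -> pred nat).
Hypotheses (N0 : N 0%N = 0%N) (N_lt : forall k, (N k < N k.+1)%N).

Let N_mono i j : (i <= j)%N -> (N i <= N j)%N.
Proof.
elim: j => [|j IH]; first by rewrite leqn0 => /eqP->.
by rewrite leq_eqVlt => /predU1P[->//|/IH /leq_trans]; apply; exact: ltnW.
Qed.

Let N_ge i : (i <= N i)%N.
Proof. by elim: i => // i IH; exact: leq_ltn_trans IH (N_lt i). Qed.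

Let block_exists i : exists k, (N k <= i < N k.+1)%N.
Proof.
have ex : exists k, (i < N k.+1)%N by exists i; exact: N_ge.
case: (ex_minnP ex) => k ik kmin; exists k; rewrite ik andbT.
case: k ik kmin => [|k] ik kmin; first by rewrite N0.
by rewrite leqNgt; apply/negP => /kmin; rewrite ltnn.
Qed.

Let block i := projT1 (cid (block_exists i)).

Let blockP i : (N (block i) <= i < N (block i).+1)%N.
Proof. exact: projT2 (cid (block_exists i)). Qed.

Let block_uniq i k : (N k <= i < N k.+1)%N -> block i = k.
Proof.
have /andP[h1 h2] := blockP i; move=> /andP[h3 h4].
case: (ltngtP (block i) k) => // lt.
  by have := N_mono lt; rewrite leqNgt (leq_ltn_trans h3 h2).
by have := N_mono lt; rewrite leqNgt (leq_ltn_trans h1 h4).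
Qed.

Let order_ k := [seq i <- index_iota (N k) (N k.+1) | F k i] ++
  [seq i <- index_iota (N k) (N k.+1) | ~~ F k i].

Let order_perm k : perm_eq (order_ k) (index_iota (N k) (N k.+1)).
Proof. by rewrite /order_ perm_sym -(perm_filterC (F k)). Qed.

Let order_size k : size (order_ k) = (N k.+1 - N k)%N.
Proof. by rewrite (perm_size (order_perm k)) size_iota. Qed.

Let mem_order k i : (i \in order_ k) = (N k <= i < N k.+1)%N.
Proof. by rewrite (perm_mem (order_perm k)) mem_index_iota. Qed.

Let order_uniq k : uniq (order_ k).
Proof. by rewrite (perm_uniq (order_perm k)) iota_uniq. Qed.

(** The permutation that keeps each block of indices from [N k] to [N k.+1] and
    lists there the elements of [F k] first. A partial sum of the rearranged
    series that stops after them differs from the one stopped at [N k] by the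
    sum over [F k]. *)
Definition rearrange i := nth 0%N (order_ (block i)) (i - N (block i)).

Lemma rearrange_bijective : bijective rearrange.
Proof.
have bk i : block (rearrange i) = block i.
  apply: block_uniq; rewrite -mem_order mem_nth // order_size.
  by have /andP[h1 h2] := blockP i; rewrite ltn_sub2r // (leq_ltn_trans h1 h2).
have lt i : (i - N (block i) < size (order_ (block i)))%N.
  by rewrite order_size; have /andP[h1 h2] := blockP i; rewrite ltn_sub2r // (leq_ltn_trans h1 h2).
pose inv i := (N (block i) + index i (order_ (block i)))%N.
have mem i : i \in order_ (block i) by rewrite mem_order blockP.
have bi i : block (inv i) = block i.
  apply: block_uniq; rewrite leq_addr /= /inv -ltn_subRL -order_size index_mem.
  exact: mem.
exists inv => i.
  rewrite /inv bk /rearrange index_uniq // subnKC //.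
  by have /andP[] := blockP i.
by rewrite /rearrange bi /inv addKn nth_index.
Qed.

Lemma sum_rearrange (V : zmodType) (u : nat -> V) k :
  let c := size [seq i <- index_iota (N k) (N k.+1) | F k i] in
  \sum_(N k <= i < N k + c) u (rearrange i) = \sum_(N k <= i < N k.+1 | F k i) u i.
Proof.
move=> c; rewrite -[RHS]big_filter (big_nth 0%N) -/c -{1}[N k]add0n big_addn.
rewrite -{2}[N k]add0n addnC addnK; apply: eq_big_nat => i /andP[_ ic].
congr u; have ck : (c <= N k.+1 - N k)%N.
  by rewrite /c size_filter (leq_trans (count_size _ _)) // size_iota.
have b : block (i + N k) = k.
  by apply: block_uniq; rewrite leq_addl /= addnC -ltn_subRL (leq_trans ic).
by rewrite /rearrange b addnK /order_ nth_cat -/c ic.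
Qed.

End rearrangement.

Section not_FHC.
Context d (T : measurableType d) (R : realType).
Variables (mu : probability T R) (K : scalarField R).
Variables (p : R) (p1 : 1 <= p) (p2 : 2 <= p).
Local Notation L := (Lp mu K p1).
Local Notation fun_ := (Lpfun mu K p1).
Local Notation energy := (Lp_energy mu p).
Implicit Types (u v w : L).

Let p0 : 0 < p. Proof. exact: Lp_gt0 p1. Qed.

Lemma integral_two_sums_le (A B C D : T -> \bar R) :
  measurable_fun [set: T] A -> measurable_fun [set: T] B ->
  measurable_fun [set: T] C -> measurable_fun [set: T] D ->
  (forall x, 0 <= A x)%E -> (forall x, 0 <= B x)%E ->
  (forall x, 0 <= C x)%E -> (forall x, 0 <= D x)%E ->
  (forall x, 2%:E * (A x + B x) <= C x + D x)%E ->
  (2%:E * (\int[mu]_x A x + \int[mu]_x B x) <= \int[mu]_x C x + \int[mu]_x D x)%E.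
Proof.
move=> mA mB mC mD A0 B0 C0 D0 H.
have mAB : measurable_fun [set: T] (fun x => A x + B x)%E by exact: emeasurable_funD.
have mCD : measurable_fun [set: T] (fun x => C x + D x)%E by exact: emeasurable_funD.
have AB0 x : (0 <= A x + B x)%E by rewrite adde_ge0.
have CD0 x : (0 <= C x + D x)%E by rewrite adde_ge0.
rewrite -ge0_integralD // -[leRHS]ge0_integralD // -ge0_integralZl //.
apply: ge0_le_integral => //; last exact: measurable_funeM.
by move=> x _; rewrite mule_ge0.
Qed.

Lemma energy_Clarkson (phi psi : T -> K) : kmeasurable phi -> kmeasurable psi ->
  (2%:E * (energy phi + energy psi) <=
   energy (fun x => phi x + psi x)%R + energy (fun x => phi x - psi x)%R)%E.
Proof.
move=> kphi kpsi; have mphi := measurable_energy p kphi.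
have mpsi := measurable_energy p kpsi.
have mD := measurable_energy p (kmeasurableD kphi kpsi).
have mB := measurable_energy p (kmeasurableB kphi kpsi).
have ge0 (c : K) : (0 <= (modulus c `^ p)%:E)%E by rewrite lee_fin powR_ge0.
apply: (integral_two_sums_le mphi mpsi mD mB) => x; [exact: ge0..|].
by rewrite -!EFinD -EFinM lee_fin; exact: modulus_Clarkson.
Qed.

Lemma nrm_Clarkson u v :
  2 * (nrm u `^ p + nrm v `^ p) <= nrm (u + v) `^ p + nrm (u - v) `^ p.
Proof.
elim/Lp_ind: u => phi; elim/Lp_ind: v => psi.
have eD : ((nrm (Lp_class phi + Lp_class psi) `^ p)%:E = energy (fun x => phi x + psi x)%R)%E.
  have -> : Lp_class phi + Lp_class psi = Lp_class (phi + psi) by rewrite Lp_classD.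
  exact: nrm_energy.
have eB : ((nrm (Lp_class phi - Lp_class psi) `^ p)%:E = energy (fun x => phi x - psi x)%R)%E.
  rewrite (Lp_classB phi psi); exact: nrm_energy.
have := energy_Clarkson (Lpfun_kmeasurable phi) (Lpfun_kmeasurable psi).
by rewrite -eD -eB -(nrm_energy phi) -(nrm_energy psi) -!EFinD -EFinM lee_fin.
Qed.

Let average_le (s a b x y : R) : s <= a -> 2 * (a + b) <= y + x ->
  (x <= y -> s + b <= y) * (y <= x -> s + b <= x).
Proof. by move=> sa h; split; lra. Qed.

(** By Clarkson's inequality the sign of each new term can be chosen so that the
    [p]-th power of the norm grows at least by that of the term. *)
Lemma signed_sum_ge (u : nat -> L) m n : exists F : pred nat,
  \sum_(m <= i < n) nrm (u i) `^ p <=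
  nrm (\sum_(m <= i < n) (if F i then u i else - u i)) `^ p.
Proof.
elim: n => [|n [F HF]].
  by exists xpredT; rewrite !big_geq // powR_ge0.
have [mn|nm] := leqP m n; last by exists xpredT; rewrite !big_geq // powR_ge0.
set v := (X in nrm X `^ p) in HF.
have H := nrm_Clarkson v (u n).
have [b Hb] : exists b : bool, \sum_(m <= i < n) nrm (u i) `^ p + nrm (u n) `^ p <=
    nrm (v + if b then u n else - u n) `^ p.
  have [h|h] := leP (nrm (v - u n) `^ p) (nrm (v + u n) `^ p).
    by exists true; exact: (average_le HF H).1 h.
  by exists false; exact: (average_le HF H).2 (ltW h).
exists (fun i => if i == n then b else F i).
rewrite !(big_nat_recr _ _ _ mn) /= eqxx.
rewrite (_ : \sum_(m <= i < n) _ = v); first exact: Hb.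
by apply: eq_big_nat => i /andP[_ i_n]; rewrite ltn_eqF.
Qed.

(** The terms with sign [+] or those with sign [-] carry half of the norm of the
    signed sum. *)
Lemma subset_sum_ge (u : nat -> L) m n :
  2 `^ p <= \sum_(m <= i < n) nrm (u i) `^ p ->
  exists F : pred nat, 1 <= nrm (\sum_(m <= i < n | F i) u i).
Proof.
move=> H; have [F HF] := signed_sum_ge u m n.
have : 2 <= nrm (\sum_(m <= i < n) (if F i then u i else - u i)).
  rewrite leNgt; apply/negP => lt; have := le_trans H HF; rewrite leNgt => /negP; apply.
  by rewrite gt0_ltr_powR ?nnegrE ?nrm_ge0.
rewrite (bigID F) /= (eq_bigr u); last by move=> i ->.
rewrite [X in _ + X](_ : _ = - \sum_(m <= i < n | ~~ F i) u i); last first.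
  by rewrite -sumrN; apply: eq_bigr => i /negbTE ->.
move=> h; have [h1|h1] := leP 1 (nrm (\sum_(m <= i < n | F i) u i)); first by exists F.
exists (predC F); have := le_trans h (nrmD _ _); rewrite nrmN => h2.
by move: h1 h2; rewrite /=; lra.
Qed.

(** If the sums were unbounded, every tail would contain a block of indices with a
    subset of sum at least [1] in norm. The permutation that moves each of these
    subsets to the front of its block gives a series that is not Cauchy. *)
Lemma unconditional_bounded (u : nat -> L) : unconditionally_convergent u ->
  exists B : R, forall n, \sum_(0 <= i < n) nrm (u i) `^ p <= B.
Proof.
move=> uu; apply: contrapT => nB.
have blocks m : exists nF : nat * pred nat, (m < nF.1)%N /\
    1 <= nrm (\sum_(m <= i < nF.1 | nF.2 i) u i).
  have [n Hn] : exists n, \sum_(0 <= i < m) nrm (u i) `^ p + 2 `^ p <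
      \sum_(0 <= i < n) nrm (u i) `^ p.
    apply: contrapT => H; apply: nB.
    exists (\sum_(0 <= i < m) nrm (u i) `^ p + 2 `^ p) => n.
    by rewrite leNgt; apply/negP => lt; apply: H; exists n.
  have mn : (m < n)%N.
    rewrite ltnNge; apply/negP => nm; move: Hn; apply/negP; rewrite -leNgt.
    rewrite [in leRHS](big_cat_nat (leq0n n) nm) /= -addrA lerDl addr_ge0 ?powR_ge0 //.
    by apply: sumr_ge0 => i _; exact: powR_ge0.
  have [|F HF] := @subset_sum_ge u m n; last by exists (n, F).
  by move: Hn; rewrite (big_cat_nat (leq0n m) (ltnW mn)) /= ltrD2l => /ltW.
have [c Hc] := choice blocks.
pose N := fix N k := if k is k'.+1 then (c (N k')).1 else 0%N.
have N_lt k : (N k < N k.+1)%N by case: (Hc (N k)).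
pose F k := (c (N k)).2.
have := uu _ (rearrange_bijective F (erefl : N 0%N = 0%N) N_lt).
move=> /cvgn_nrm_cauchy /(_ ltr01)[n0 Hn0].
have N_ge k : (k <= N k)%N by elim: k => // k IH; exact: leq_ltn_trans IH (N_lt k).
set s := rearrange _ _ _ in Hn0.
pose l := size [seq i <- index_iota (N n0) (N n0.+1) | F n0 i].
have := Hn0 (N n0 + l)%N (N n0) (leq_trans (N_ge _) (leq_addr _ _)) (N_ge _).
rewrite /series /= (big_cat_nat (leq0n (N n0)) (leq_addr l (N n0))) /= addrAC subrr add0r.
have -> : \sum_(N n0 <= i < N n0 + l) u (s i) = \sum_(N n0 <= i < N n0.+1 | F n0 i) u i.
  exact: sum_rearrange.
by have [_] := Hc (N n0); rewrite -/(F n0) => /le_lt_trans H /H; rewrite ltxx.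
Qed.

End not_FHC.

(** * Conservative maps and the frequent hypercyclicity criterion *)

Section conservative.
Context d (T : measurableType d) (R : realType).
Variables (mu : probability T R) (f : T -> T) (C : R).
Hypotheses (mf : measurable_fun [set: T] f) (C1 : 1 <= C).
Hypothesis f_le : forall A, measurable A -> (mu (f @^-1` A) <= C%:E * mu A)%E.
Hypothesis f_conservative : forall W, measurable W ->
  (forall k x, (0 < k)%N -> W x -> ~ W (iter k f x)) -> mu W = 0%E.

Let mfn n A : measurable A -> measurable (iter n f @^-1` A).
Proof.
move=> mA; rewrite -[X in measurable X]setTI; exact: (measurable_iterate mf n).
Qed.

(** By Borel-Cantelli almost every point visits [B] finitely often. Its last visit
    lies in the set of the points of [B] that never return, which is wandering,
    hence null. *)
Lemma summable_visits_null B : measurable B ->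
  (\sum_(n <oo) mu (iter n.+1 f @^-1` B) < +oo)%E -> mu B = 0%E.
Proof.
move=> mB H; have mF n : measurable (iter n.+1 f @^-1` B) by exact: mfn.
have sup0 := lim_sup_set_cvg0 mF H.
pose W := B `\` \bigcup_n iter n.+1 f @^-1` B.
have mW : measurable W by apply: measurableD => //; exact: bigcupT_measurable.
have W0 : mu W = 0%E.
  apply: f_conservative => // -[//|k] x _ [_ nx] [Bx _].
  by apply: nx; exists k.
have sub : B `<=` lim_sup_set (fun n => iter n.+1 f @^-1` B) `|`
    \bigcup_n iter n f @^-1` W.
  move=> x Bx; have [[n nW]|H'] := pselect (exists n, W (iter n f x)).
    by right; exists n.
  left; have next m : B (iter m f x) -> exists2 n, (m < n)%N & B (iter n f x).
    move=> Bm; apply: contrapT => H''; apply: H'; exists m; split=> // -[k _ Bk].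
    apply: H''; exists (k.+1 + m)%N; first by rewrite addSn ltnS leq_addl.
    by rewrite iterD.
  have visits n : exists2 m, (n <= m)%N & B (iter m f x).
    elim: n => [|n [m nm Bm]]; first by exists 0%N.
    by have [m' mm' Bm'] := next m Bm; exists m' => //; exact: leq_ltn_trans mm'.
  move=> n _; have [[//|m] nm Bm] := visits n.+1.
  by exists m => //=.
have null n : mu.-negligible (iter n f @^-1` W).
  apply/negligibleP; first exact: mfn.
  apply/eqP; rewrite eq_le measure_ge0 andbT.
  by apply: (le_trans (f_iter_le mf C1 f_le n mW)); rewrite W0 mule0.
apply: measure_negligible => //; apply: (negligibleS sub); apply: negligibleU.
  apply/negligibleP => //; apply: bigcap_measurable => // n _.
  by apply: bigcup_measurable => k _; exact: mF.
exact: negligible_bigcup.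
Qed.

Variables (K : scalarField R) (p : R) (p1 : 1 <= p).
Local Notation L := (Lp mu K p1).
Variable U : L -> L.
Hypothesis f_U : composition_operator f U.

Let p0 : 0 < p. Proof. exact: Lp_gt0 p1. Qed.

(** By Chebyshev's inequality the visits to a set where [modulus u] is bounded
    below have summable measures. *)
Lemma summable_orbit_eq0 (u : L) (B : R) :
  (forall n, \sum_(0 <= i < n) nrm (iter i.+1 U u) `^ p <= B) -> u = 0.
Proof.
elim/Lp_ind: u => phi H; have kphi := Lpfun_kmeasurable phi.
have mphi := measurable_modulus kphi.
have orbit i : ((nrm (iter i.+1 U (Lp_class phi)) `^ p)%:E =
    Lp_energy mu p (fun x => phi (iter i.+1 f x)))%E.
  have [psi psiE ->] := iter_class f_U i.+1 phi.
  by rewrite nrm_energy; exact: eq_energy.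
pose A k := [set x | k.+1%:R^-1 <= modulus (phi x)].
have mA k : measurable (A k).
  rewrite (_ : A k = (@modulus R K \o phi) @^-1` `[k.+1%:R^-1, +oo[%classic).
    by rewrite -[X in measurable X]setTI; apply: mphi => //; exact: measurable_itv.
  by apply/seteqP; split=> x; rewrite /A /= in_itv /= andbT.
have A0 k : mu (A k) = 0%E.
  pose e := k.+1%:R^-1 `^ p; have e0 : 0 < e by rewrite powR_gt0 // invr_gt0.
  have visit i : (e%:E * mu (iter i.+1 f @^-1` A k) <=
      (nrm (iter i.+1 U (Lp_class phi)) `^ p)%:E)%E.
    rewrite orbit -(@integral_scaled_indic _ _ _ mu) ?(ltW e0) //; last exact: mfn.
    apply: ge0_le_integral => //.
    - by move=> x _; rewrite lee_fin mulr_ge0 ?(ltW e0) ?indicE ?ler0n.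
    - apply/measurable_EFinP; apply: measurable_funM; first exact: measurable_cst.
      by apply: measurable_indic; exact: mfn.
    - by apply: measurable_energy; exact: (kmeasurable_comp (measurable_iterate mf i.+1)).
    move=> x _; rewrite lee_fin indicE; have [Ax|Ax] := pselect (A k (iter i.+1 f x)).
      have -> : (x \in iter i.+1 f @^-1` A k) = true by exact/mem_set.
      by rewrite mulr1 ge0_ler_powR ?nnegrE ?modulus_ge0 ?(ltW p0) ?invr_ge0.
    have -> : (x \in iter i.+1 f @^-1` A k) = false by exact/memNset.
    by rewrite mulr0 powR_ge0.
  apply: (summable_visits_null (mA k)).
  apply: (@le_lt_trans _ _ (e^-1%:E * B%:E)%E); last by rewrite -EFinM ltry.
  apply: lime_le; first by apply: is_cvg_nneseries => n _ _; exact: measure_ge0.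
  apply: nearW => n; rewrite lee_pdivlMl // ge0_sume_distrr; last first.
    by move=> i _; exact: measure_ge0.
  apply: (@le_trans _ _ (\sum_(0 <= i < n) (nrm (iter i.+1 U (Lp_class phi)) `^ p)%:E)%E).
    by apply: lee_sum => i _; exact: visit.
  by rewrite sumEFin lee_fin.
rewrite -[RHS]/(Lp_class 0); apply/Lp_classP.
apply: (@negligibleS _ _ _ _ (\bigcup_k A k)); last first.
  by apply: negligible_bigcup => k; apply/negligibleP; [exact: mA|exact: A0].
move=> x /= phix; have phi0 : 0 < modulus (phi x).
  rewrite lt_neqAle modulus_ge0 andbT eq_sym; apply/eqP => /modulus_eq0; exact: phix.
have [k _ /(_ k (leqnn k))] := near_infty_natSinv_lt (PosNum phi0).
by exists k => //; exact: ltW.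
Qed.

Lemma not_FHC : 2 <= p -> ~ frequent_hypercyclicity_criterion U.
Proof.
move=> p2 [X0 [V [X0_dense _ HX0]]].
have mod1 : modulus (1 : K) = 1.
  by apply: (@mulfI _ (modulus (1 : K))); rewrite ?mulr1 -?modulusM ?mulr1 //;
    apply/eqP => /modulus_eq0 /eqP; rewrite oner_eq0.
have [one oneE] : exists psi : Lpfun mu K p1, psi = (fun=> 1) :> (T -> K).
  apply: (@bounded_Lp _ T R mu K p p1 (fun=> 1) 1); first exact: kmeasurable_cst.
  by move=> x; rewrite mod1.
have n1 : 1 <= nrm (Lp_class one).
  rewrite leNgt; apply/negP => lt.
  have := nrm_energy one; rewrite oneE.
  have -> : Lp_energy mu p (fun=> (1 : K)) = 1%E.
    rewrite /Lp_energy mod1 powR1 integral_cst //= probability_setT mule1 //.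
  move=> [e]; move: lt; rewrite -(powRr1 (nrm_ge0 (Lp_class one))) => lt.
  have : nrm (Lp_class one) `^ p < 1 `^ p.
    by rewrite gt0_ltr_powR ?nnegrE ?nrm_ge0 // -(powRr1 (nrm_ge0 (Lp_class one))).
  by rewrite e powR1 ltxx.
have [x Xx nx] := nrm_dense (Lp_class one) X0_dense ltr01.
have [ux _ _] := HX0 x Xx.
have [B HB] := unconditional_bounded p2 ux.
have x0 : x = 0 by exact: summable_orbit_eq0 HB.
by move: nx; rewrite x0 subr0 ltNge n1.
Qed.

End conservative.

(** * Approximation by countably many values *)

Section simple_approximation.
Context d (T : measurableType d) (R : realType).
Variables (mu : probability T R) (K : scalarField R) (q : nat -> K).
Hypothesis q_dense : forall (z : K) (e : R), 0 < e -> exists i, modulus (z - q i) < e.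

Lemma decreasing_measure_small (F : nat -> set T) (e : R) : (forall i, measurable (F i)) ->
  (forall m n, (m <= n)%N -> F n `<=` F m) -> (forall x, exists n, ~ F n x) -> 0 < e ->
  exists n, (mu (F n) <= e%:E)%E.
Proof.
move=> mF F_dec F0 e0.
have I0 : \bigcap_n F n = set0.
  by apply/seteqP; split=> // x H; have [n] := F0 x; apply; exact: H.
have := @nonincreasing_cvg_mu _ _ _ mu F.
rewrite I0 measure0 => /(_ _ mF measurable0) H.
have {H} : mu \o F @ \oo --> 0%E.
  apply: H; first by rewrite (le_lt_trans (probability_le1 _ _)) ?ltry.
  by move=> m n mn; apply/subsetPset; exact: F_dec.
move=> /(_ [set y | (y < e%:E)%E]) []; first by apply: open_ereal_lt'; rewrite lte_fin.
by move=> n _ /(_ n (leqnn n)) /= lt; exists n; exact: ltW.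
Qed.

Section nearest.
Variables (phi : T -> K) (delta : R).
Hypotheses (kphi : kmeasurable phi) (delta0 : 0 < delta).

Let ex x : exists i, modulus (phi x - q i) < delta := q_dense (phi x) delta0.

Definition nearest x := ex_minn (ex x).

Lemma nearestP x : modulus (phi x - q (nearest x)) < delta.
Proof. by rewrite /nearest; case: ex_minnP. Qed.

Lemma measurable_nearest i : measurable (nearest @^-1` [set i]).
Proof.
pose A j := [set x | modulus (phi x - q j) < delta].
have mA j : measurable (A j).
  have m := measurable_modulus (kmeasurableB kphi (kmeasurable_cst T (q j))).
  rewrite (_ : A j = (@modulus R K \o (fun x => phi x - q j)) @^-1` `]-oo, delta[%classic).
    by rewrite -[X in measurable X]setTI; apply: m => //; exact: measurable_itv.
  by apply/seteqP; split=> x; rewrite /A /= in_itv /=.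
rewrite (_ : _ @^-1` _ = A i `\` \bigcup_(j in [set j | (j < i)%N]) A j).
  by apply: measurableD => //; apply: bigcup_measurable.
apply/seteqP; split=> x; rewrite /nearest /=; case: ex_minnP => k kx kmin.
  move=> <-; split=> // -[j /= jk] /kmin; by rewrite leqNgt jk.
move=> [ix H]; apply/eqP; rewrite eqn_leq kmin //= leqNgt; apply/negP => ki.
by apply: H; exists k.
Qed.

End nearest.

Lemma tail_integral_small (G : T -> \bar R) (h : T -> nat) (e : R) :
  mu.-integrable setT G -> (forall x, 0 <= G x)%E ->
  (forall i, measurable (h @^-1` [set i])) -> 0 < e ->
  exists n, (\int[mu]_x (if (n <= h x)%N then G x else 0) <= e%:E)%E.
Proof.
move=> iG G0 mh e0; have mG := measurable_int _ iG.
have mH n : measurable [set x | (n <= h x)%N].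
  rewrite (_ : [set x | _] = \bigcup_(i in [set i | (n <= i)%N]) h @^-1` [set i]).
    exact: bigcup_measurable.
  by apply/seteqP; split=> x => [nx|[i ni hx]]; [exists (h x)|rewrite /= hx].
pose F n x := if (n <= h x)%N then G x else 0%E.
have mF n : measurable_fun [set: T] (F n).
  apply: measurable_fun_ifT => //.
  by apply: (measurable_fun_bool true); rewrite setTI; exact: mH.
have [] := @dominated_convergence _ _ _ mu setT measurableT F (cst 0%E) G mF (measurable_cst _).
- apply: aeW => x _; apply: cvg_near_cst.
  exists (h x).+1 => // n /= hn; apply/eqP; by rewrite /F leqNgt hn.
- exact: iG.
- by apply: aeW => x n _; rewrite /F; case: ifP => _; rewrite ?gee0_abs // abse0.
move=> _ _; rewrite integral0 => /(_ [set y | (y < e%:E)%E]) [].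
  by apply: open_ereal_lt'; rewrite lte_fin.
by move=> n _ /(_ n (leqnn n)) /= lt; exists n; exact: ltW.
Qed.

End simple_approximation.

(** * Upper density of a set with long stretches *)

Section upper_density.
Variable R : realType.

(** A stretch from [a] to [b] with [a * 2 ^ j <= b] occupies all but a proportion
    [2^-j] of the integers up to [b]. *)
Lemma upper_density_windows (D : set nat) (a b : nat -> nat) :
  (forall i, exists j, (i <= j)%N /\ (0 < a j)%N /\ (a j * 2 ^ j <= b j)%N /\
     forall k, (a j <= k < b j)%N -> D k) ->
  @upper_density R D = 1%E.
Proof.
move=> H; rewrite /upper_density limn_esup_lim.
set u := fun N : nat => _.
have u1 n : (u n <= 1)%E.
  rewrite /u lee_fin; case: n => [|n]; first by rewrite invr0 mulr0.
  rewrite ler_pdivrMr ?ltr0n // mul1r ler_nat.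
  apply: (@leq_trans (\sum_(1 <= k < n.+2) 1)%N); first by apply: leq_sum => k _; exact: leq_b1.
  by rewrite sum_nat_const_nat muln1 subSS subn0.
rewrite (_ : esups u = cst 1%E) ?lim_cst //; apply/funext => n /=.
apply/eqP; rewrite eq_le; apply/andP; split.
  by apply: ge_ereal_sup => _ [m _ <-]; exact: u1.
apply/lee_addgt0Pr => e e0.
have [i [_ ie]] : exists i, (0 < i)%N /\ 2^-1 ^+ i <= e.
  have [i _ /(_ i (leqnn i)) Hi] := near_infty_natSinv_expn_lt (PosNum e0).
  by exists i.+1; split=> //; rewrite exprVn exprS invfM (le_trans _ (ltW Hi)) // div1r;
    rewrite ler_piMl ?invr_ge0 ?exprn_ge0 //; lra.
have [j [ij [aj [abj Dj]]]] := H (maxn i n.+1).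
have jn : (n <= b j)%N.
  rewrite (leq_trans _ abj) // (leq_trans _ (leq_pmull _ aj)) //.
  by rewrite (leq_trans _ (ltnW (ltn_expl j (ltnSn 1)))) // (leq_trans _ ij) // leq_max leqnSn orbT.
apply: (@le_trans _ _ (u (b j) + e%:E)%E); last first.
  by apply: leeD2r; apply: ereal_sup_ubound; exists (b j) => //=.
have bj0 : (0 < b j)%N by rewrite (leq_trans _ abj) // muln_gt0 aj expn_gt0.
have count : (b j - a j <= \sum_(1 <= k < (b j).+1) (k \in D))%N.
  have ab : (a j <= b j)%N by rewrite (leq_trans _ abj) // leq_pmulr // expn_gt0.
  rewrite (big_cat_nat (n := a j)) //=; last exact: leqW.
  rewrite (leq_trans _ (leq_addl _ _)) // big_nat_recr //=.
  rewrite (leq_trans _ (leq_addr _ _)) //.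
  rewrite (eq_big_nat _ _ (F2 := fun=> 1%N)); last by move=> k kab; rewrite mem_set //; exact: Dj.
  by rewrite sum_nat_const_nat muln1.
rewrite /u -EFinD lee_fin -lerBlDr ler_pdivlMr ?ltr0n //.
apply: (@le_trans _ _ ((b j)%:R - (a j)%:R)); last first.
  rewrite -natrB ?ler_nat // (leq_trans _ abj) // leq_pmulr // expn_gt0 //.
rewrite mulrBl mul1r lerD2l lerN2.
apply: (@le_trans _ _ (2^-1 ^+ j * (b j)%:R)).
  rewrite exprVn ler_pdivlMl ?exprn_gt0 // -natrX -natrM ler_nat mulnC //.
rewrite ler_wpM2r ?ler0n // (le_trans _ ie) // ler_wiXn2l ?invr_ge0 ?invf_le1 ?ler1n //.
by rewrite (leq_trans _ ij) // leq_maxl.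
Qed.

End upper_density.

(** * Arithmetic of the binary odometer *)

Definition binary_base : odometer_base := @OdometerBase (fun=> 2%N) (fun=> isT).
Local Notation X := (odometer_space binary_base).
Local Notation f := (@odometer binary_base).

Section residue.
Local Open Scope nat_scope.
Implicit Types (x y : X) (n m k c : nat).

Definition digit x i : nat := nat_of_ord (x i : 'I_2).
(** The class modulo [2 ^ n] of [x] read as a 2-adic integer. *)
Definition residue n x : nat := \sum_(i < n) digit x i * 2 ^ i.

Lemma digit_lt2 x i : digit x i < 2.
Proof. exact: ltn_ord. Qed.

Lemma digit_inj x y i : digit x i = digit y i -> x i = y i.
Proof. exact: ord_inj. Qed.

Lemma point_ext x y : (forall i, x i = y i) -> x = y.
Proof. exact: (@functional_extensionality_dep nat (fun=> 'I_2)). Qed.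

Lemma residue0 x : residue 0 x = 0.
Proof. by rewrite /residue big_ord0. Qed.

Lemma residueS n x : residue n.+1 x = residue n x + digit x n * 2 ^ n.
Proof. by rewrite /residue big_ord_recr. Qed.

Lemma residue_lt n x : residue n x < 2 ^ n.
Proof.
elim: n => [|n IH]; first by rewrite residue0.
have := digit_lt2 x n; rewrite residueS expnS; case: digit => [|[|//]] _; lia.
Qed.

Lemma residue_mod m n x : m <= n -> residue n x %% 2 ^ m = residue m x.
Proof.
elim: n => [|n IH]; first by rewrite leqn0 => /eqP->; rewrite residue0 mod0n.
rewrite leq_eqVlt => /predU1P[->|]; first by rewrite modn_small ?residue_lt.
rewrite ltnS => mn; rewrite residueS -(subnK mn) expnD mulnA addnC modnMDl subnK //.
exact: IH.
Qed.

Lemma residue_digit n x i : i < n -> digit x i = residue n x %/ 2 ^ i %% 2.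
Proof.
move=> i_n; have := residue_mod x i_n; rewrite residueS => /(congr1 (fun k => k %/ 2 ^ i)).
rewrite addnC divnMDl ?expn_gt0 // (divn_small (residue_lt i x)) addn0 => <-.
by rewrite modn_divl expnS.
Qed.

Lemma eq_residue n x y : (forall i, i < n -> x i = y i) -> residue n x = residue n y.
Proof. by move=> xy; apply: eq_bigr => i _; rewrite /digit xy. Qed.

Lemma residue_inj n x y i : residue n x = residue n y -> i < n -> x i = y i.
Proof. by move=> xy i_n; apply: digit_inj; rewrite !(residue_digit _ i_n) xy. Qed.

Lemma residue_max n x : ((residue n x).+1 == 2 ^ n) = [forall i : 'I_n, digit x i == 1].
Proof.
elim: n => [|n IH]; first by rewrite residue0 expn0 eqxx; apply/esym/forallP => -[].
have h : [forall i : 'I_n.+1, digit x i == 1] =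
    [forall i : 'I_n, digit x i == 1] && (digit x n == 1).
  apply/forallP/andP => [H|[/forallP H xn] i].
    by split; [apply/forallP => i; exact: (H (widen_ord (leqnSn n) i))|exact: (H ord_max)].
  have := ltn_ord i; rewrite ltnS leq_eqVlt => /predU1P[->//|i_n].
  exact: (H (Ordinal i_n)).
rewrite h -IH residueS expnS; have := residue_lt n x; have := digit_lt2 x n.
by case: digit => [|[|//]] _; lia.
Qed.

(** A carry reaches the digit [n] exactly when all the lower digits are [1], that
    is when the residue is [2 ^ n - 1]. *)
Lemma odometer_digit x n :
  digit (f x) n = if (residue n x).+1 == 2 ^ n then 1 - digit x n else digit x n.
Proof.
rewrite residue_max /digit /odometer; case: pselect => [e|H] /=; last first.
  have one i : digit x i = 1.
    have := digit_lt2 x i; case D: (digit x i) => [|[|//]] _ //.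
    by case: H; exists i; rewrite -[nat_of_ord _]/(digit x i) D.
  case: forallP => [_|[]]; first by rewrite -/(digit x n) one.
  by move=> i; rewrite -/(digit x i) one.
case: ex_minnP => l xl lmin.
have one i : i < l -> digit x i = 1.
  by move=> il; apply/eqP; apply: contraLR il => xi; rewrite -leqNgt lmin.
have zero : digit x l = 0.
  by have := digit_lt2 x l; move: xl; rewrite -[nat_of_ord _]/(digit x l); case: digit => [|[|]].
case: ltngtP => [nl|ln|->].
- case: forallP => [_|[]]; first by rewrite -/(digit x n) one.
  by move=> i; rewrite -/(digit x i) one // (ltn_trans (ltn_ord i)).
- case: forallP => // /(_ (Ordinal ln)) /=.
  by rewrite -[nat_of_ord _]/(digit x l) zero.
- rewrite -[nat_of_ord (x l)]/(digit x l) /= -[nat_of_ord (x l)]/(digit x l) zero.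
  case: forallP => // [[]] i.
  by rewrite -/(digit x i) one.
Qed.

Lemma residue_odometer n x : residue n (f x) = (residue n x).+1 %% 2 ^ n.
Proof.
suff -> : residue n (f x) = if (residue n x).+1 == 2 ^ n then 0 else (residue n x).+1.
  case: eqP => [->|]; first by rewrite modnn.
  by move=> ne; rewrite modn_small //; have := residue_lt n x; lia.
elim: n => [|n IH]; first by rewrite !residue0.
rewrite !residueS IH odometer_digit expnS; have := residue_lt n x; have := digit_lt2 x n.
by case: digit => [|[|//]] _; case: eqP; case: eqP; lia.
Qed.

Lemma residue_iter n k x : residue n (iter k f x) = (residue n x + k) %% 2 ^ n.
Proof.
elim: k => [|k IH]; first by rewrite addn0 modn_small ?residue_lt.
by rewrite iterS residue_odometer IH -addn1 modnDml addn1 addnS.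
Qed.

Lemma odometer_tail n x i : (residue n x).+1 < 2 ^ n -> n <= i -> f x i = x i.
Proof.
move=> lt ni; apply: digit_inj; rewrite odometer_digit; case: eqP => // e.
have := residue_mod x ni; move: (residue_lt i x); rewrite -e ltnS leq_eqVlt.
have -> : residue i x = (2 ^ (i - n)).-1 * 2 ^ n + (2 ^ n).-1.
  have h : 2 ^ i = 2 ^ (i - n) * 2 ^ n by rewrite -expnD subnK.
  have : 0 < 2 ^ (i - n) by rewrite expn_gt0.
  have : 0 < 2 ^ n by rewrite expn_gt0.
  by nia.
rewrite modnMDl modn_small; last by rewrite ltn_predL expn_gt0.
by lia.
Qed.

Lemma iter_carry_free n k x : residue n x + k < 2 ^ n ->
  forall i, n <= i -> iter k f x i = x i.
Proof.
elim: k => // k IH lt i ni; rewrite iterS.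
rewrite (@odometer_tail n) ?IH //; first by lia.
by rewrite residue_iter modn_small; lia.
Qed.

(** Adding the difference of the residues causes no carry into the common tail. *)
Lemma same_tail_orbit n k x y : (forall i, n <= i -> x i = y i) ->
  residue n x + k = residue n y -> iter k f x = y.
Proof.
move=> xy vk; have lt : residue n x + k < 2 ^ n by rewrite vk residue_lt.
apply: point_ext => i; have [ni|i_n] := leqP n i.
  by rewrite (iter_carry_free lt ni) xy.
by apply: residue_inj i_n; rewrite residue_iter vk modn_small ?residue_lt.
Qed.

Definition splice n c x : X := fun i =>
  if i < n then inZp (c %/ 2 ^ i) : 'I_2 else x i.

Lemma splice_tail n c x i : n <= i -> splice n c x i = x i.
Proof. by rewrite /splice ltnNge => ->. Qed.

Lemma residue_splice n c x : c < 2 ^ n -> residue n (splice n c x) = c.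
Proof.
move=> cn; have -> : residue n (splice n c x) = \sum_(i < n) (c %/ 2 ^ i %% 2) * 2 ^ i.
  by apply: eq_bigr => i _; rewrite /digit /splice ltn_ord.
elim: n c cn => [|n IH] c; first by rewrite expn0 big_ord0; case: c.
rewrite expnS mul2n => cn; rewrite big_ord_recl expn0 divn1 muln1 /=.
under eq_bigr => i _.
  rewrite /bump /= add1n expnS divnMA mulnCA; over.
rewrite -big_distrr /= IH; last by rewrite ltn_divLR // muln2.
by rewrite addnC mulnC -divn_eq.
Qed.

Lemma splice_residue n x y : (forall i, n <= i -> x i = y i) -> splice n (residue n x) y = x.
Proof.
move=> xy; apply: point_ext => i; have [ni|i_n] := leqP n i.
  by rewrite splice_tail ?xy.
apply: residue_inj i_n; exact/residue_splice/residue_lt.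
Qed.

End residue.

(** * Sigma-algebra generated by the cylinders *)

Section cylinders.
Implicit Types (A : set X) (x y : X) (n m : nat).

Definition determined n A := forall x y, residue n x = residue n y -> A x -> A y.

Definition cylinder_sets : set (set X) := [set A | exists n, determined n A].

Lemma eq_residue_le n m x y : (n <= m)%N -> residue m x = residue m y -> residue n x = residue n y.
Proof. by move=> nm xy; rewrite -(residue_mod x nm) xy residue_mod. Qed.

Lemma determined_le n m A : (n <= m)%N -> determined n A -> determined m A.
Proof. by move=> nm dA x y /(eq_residue_le nm); exact: dA. Qed.

Lemma determined_residue n (B : set nat) : determined n [set x | B (residue n x)].
Proof. by move=> x y /= ->. Qed.

Lemma determinedI n A B : determined n A -> determined n B -> determined n (A `&` B).
Proof. by move=> dA dB x y xy [Ax Bx]; split; [exact: dA Ax|exact: dB Bx]. Qed.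

Lemma determinedC n A : determined n A -> determined n (~` A).
Proof. by move=> dA x y xy Ax Ay; apply: Ax; exact: dA Ay. Qed.

Lemma cylinder_setsI : setI_closed cylinder_sets.
Proof.
move=> A B [n dA] [m dB]; exists (maxn n m); apply: determinedI.
  exact: determined_le (leq_maxl _ _) dA.
exact: determined_le (leq_maxr _ _) dB.
Qed.

Lemma nbhs_residue n (x : digit_product binary_base) :
  nbhs x [set y : digit_product binary_base | residue n y = residue n x].
Proof.
elim: n => [|n IH].
  by apply: filterS filterT => y _ /=; rewrite !residue0.
have xn : nbhs x [set y : digit_product binary_base | y n = x n].
  apply: (@proj_continuous nat
    (fun n => discrete_topology 'I_(binary_base n) : topologicalType) n x [set x n]).
  exact: discrete_set1.
by apply: filterS2 IH xn => y /= yx yn; rewrite !residueS yx /digit yn.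
Qed.

Lemma determined_open n A : determined n A ->
  open (A : set (digit_product binary_base)).
Proof.
move=> dA; rewrite openE => x Ax; apply: filterS (nbhs_residue n x) => y /= yx.
exact: dA Ax.
Qed.

Lemma nbhs_cylinder (x : digit_product binary_base) U : nbhs x U ->
  exists n, forall y : X, residue n y = residue n x -> U y.
Proof.
pose F := filter_from [set: nat] (fun n => [set y : X | residue n y = residue n x]).
have FF : Filter F.
  apply: filter_from_filter; first by exists 0%N.
  move=> i j _ _; exists (maxn i j) => // y /= yx; split; apply: eq_residue_le yx.
    exact: leq_maxl.
  exact: leq_maxr.
have : F --> (x : product_topology_def (fun n => discrete_topology 'I_(binary_base n))).
  apply/cvg_sup => i V.
  rewrite nbhsE => -[W [[B oB <-] Bx] WV].
  exists i.+1 => // y /= yx; apply: WV => /=.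
  by rewrite (residue_inj yx).
by move=> /[apply] -[n _ H]; exists n => y; exact: H.
Qed.

Definition cylinder n x : set X := [set y | residue n y = residue n x].
Arguments cylinder : simpl never.

Lemma determined_cylinder n x : determined n (cylinder n x).
Proof. by move=> y z yz; rewrite /cylinder /= yz. Qed.

Lemma cylinderS n x y : cylinder n.+1 x y <-> cylinder n x y /\ y n = x n.
Proof.
rewrite /cylinder /= !residueS; split=> [e|[-> xy]]; last by rewrite /digit xy.
have e' : residue n.+1 y = residue n.+1 x by rewrite !residueS.
by split; [exact: eq_residue_le (leqnSn n) e'|exact: residue_inj e' _].
Qed.

Lemma measurable_determined n A : determined n A -> measurable A.
Proof. by move=> dA; apply: sub_sigma_algebra; exact: determined_open dA. Qed.

(** An open set is the increasing union over [n] of the sets of points whose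
    cylinder of depth [n] it contains. *)
Lemma measurable_cylinder_sets : @measurable _ X = <<s cylinder_sets >>.
Proof.
rewrite eqEsubset; split; last first.
  apply: smallest_sub; first exact: sigma_algebra_measurable.
  by move=> A [n /measurable_determined].
apply: smallest_sub; first exact: smallest_sigma_algebra.
move=> U oU; pose A n := [set x : X | forall y, residue n y = residue n x -> U y].
have -> : U = \bigcup_n A n.
  apply/seteqP; split=> [x Ux|x [n _ Ax]]; last exact: Ax.
  have [n H] := @nbhs_cylinder x U (open_nbhs_nbhs (conj oU Ux)).
  by exists n.
apply: (@bigcup_measurable _ (g_sigma_algebraType cylinder_sets)) => n _.
by apply: sub_sigma_algebra; exists n => x y xy /= Ax z; rewrite -xy; exact: Ax.
Qed.

Lemma cylinder_measure_unique (R : realType) (m1 m2 : {measure set X -> \bar R}) :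
  (forall n A, determined n A -> m1 A = m2 A) -> (m1 setT < +oo)%E ->
  forall A, measurable A -> m1 A = m2 A.
Proof.
move=> m12 m1T; apply: (measure_unique cylinder_sets (fun=> setT)).
- exact: measurable_cylinder_sets.
- exact: cylinder_setsI.
- by move=> _; exists 0%N.
- by apply/seteqP; split => // x _; exists 0%N.
- by move=> A [n /m12].
- by [].
Qed.

Lemma measurable_to_X d (T : measurableType d) (g : T -> X) :
  (forall n A, determined n A -> measurable (g @^-1` A)) ->
  measurable_fun [set: T] g.
Proof.
move=> H; apply: (measurability cylinder_sets measurable_cylinder_sets).
by move=> _ [A [n dA] <-]; rewrite setTI; exact: H dA.
Qed.

Lemma measurable_odometer : measurable_fun [set: X] f.
Proof.
apply: measurable_to_X => n A dA; apply: (@measurable_determined n) => x y xy.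
by apply: dA; rewrite !residue_odometer xy.
Qed.

Lemma measurable_iter n : measurable_fun [set: X] (iter n f).
Proof. exact: (measurable_iterate measurable_odometer n). Qed.

Lemma measurable_splice n c : measurable_fun [set: X] (splice n c).
Proof.
apply: measurable_to_X => m A dA; apply: (@measurable_determined (maxn n m)) => x y xy.
apply: dA; apply: eq_residue => i im; rewrite /splice; case: ltnP => // _.
by apply: residue_inj xy _; rewrite leq_max im orbT.
Qed.

End cylinders.

(** * A product probability as an image of Lebesgue measure *)

Section masses.
Variable R : realType.
Implicit Types (x y : X) (n m : nat) (w : R).

(** The probability [1 / (n + 2)] of a digit [1] tends to [0], so that almost all
    the mass sits on a single digit, but so slowly that the product of the largest
    masses up to [n], namely [1 / (n + 1)], tends to [0]. *)
Definition digit_mass n (d : nat) : R :=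
  if d == 0%N then n.+1%:R / n.+2%:R else n.+2%:R^-1.

Definition cylinder_mass n x : R := \prod_(i < n) digit_mass i (digit x i).

(** The cylinder of depth [n] of [x] is coded by the interval of [0, 1) with this
    left end and length [cylinder_mass n x]. *)
Definition cylinder_left n x : R :=
  \sum_(i < n) (digit x i)%:R * (cylinder_mass i x * digit_mass i 0).

Lemma mass_gt0 n d : 0 < digit_mass n d.
Proof. by rewrite /digit_mass; case: ifP => _; rewrite ?divr_gt0 ?invr_gt0 ?ltr0n. Qed.

Lemma mass_sum n : digit_mass n 0 + digit_mass n 1 = 1.
Proof.
have h : n.+2%:R != 0 :> R by rewrite pnatr_eq0.
by apply: (mulIf h); rewrite /digit_mass /= mulrDl divfK // mulVf // mul1r natr1.
Qed.

Lemma cylinder_massS n x : cylinder_mass n.+1 x = cylinder_mass n x * digit_mass n (digit x n).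
Proof. by rewrite /cylinder_mass big_ord_recr. Qed.

Lemma cylinder_mass_gt0 n x : 0 < cylinder_mass n x.
Proof. by apply: prodr_gt0 => i _; exact: mass_gt0. Qed.

Lemma eq_cylinder_mass n x y : residue n x = residue n y ->
  cylinder_mass n x = cylinder_mass n y.
Proof.
by move=> xy; apply: eq_bigr => i _; rewrite /digit (residue_inj xy).
Qed.

Lemma cylinder_leftS n x : cylinder_left n.+1 x =
  cylinder_left n x + (digit x n)%:R * (cylinder_mass n x * digit_mass n 0).
Proof. by rewrite /cylinder_left big_ord_recr. Qed.

Lemma eq_cylinder_left n x y : residue n x = residue n y ->
  cylinder_left n x = cylinder_left n y.
Proof.
move=> xy; apply: eq_bigr => i _; rewrite /digit (residue_inj xy) //.
by rewrite (@eq_cylinder_mass i x y) // (eq_residue_le _ xy) // ltnW.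
Qed.

Definition in_cylinder n x w := cylinder_left n x <= w < cylinder_left n x + cylinder_mass n x.

Lemma in_cylinderS n x w : in_cylinder n.+1 x w =
  in_cylinder n x w &&
  ((digit x n == 0%N) == (w < cylinder_left n x + cylinder_mass n x * digit_mass n 0)).
Proof.
rewrite /in_cylinder cylinder_leftS cylinder_massS.
have := mass_gt0 n 0; have := mass_gt0 n 1; have := mass_sum n.
have := cylinder_mass_gt0 n x; have := digit_lt2 x n.
move: (cylinder_left _ _) (cylinder_mass _ _) => l m.
case: digit => [|[|//]] _ m0 q q1 q0 /=.
  rewrite mul0r addr0; have h : m * digit_mass n 0 < m.
    by rewrite gtr_pMr //; lra.
  case: (ltP w (l + m * digit_mass n 0)) => hw; rewrite ?andbF //= !andbT.
  by rewrite (_ : w < l + m) ?andbT //; lra.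
rewrite mul1r; have h : 0 < m * digit_mass n 0 by rewrite mulr_gt0.
have -> : l + m * digit_mass n 0 + m * digit_mass n 1 = l + m by rewrite -addrA -mulrDr q mulr1.
case: (ltP w (l + m * digit_mass n 0)) => hw; rewrite ?andbF //= !andbT.
by rewrite (_ : l <= w) //; lra.
Qed.

(** Left end and length of the interval of depth [n] that contains [w]. *)
Fixpoint expansion_state n w : R * R :=
  if n is n'.+1 then
    let: (l, m) := expansion_state n' w in
    if w < l + m * digit_mass n' 0 then (l, m * digit_mass n' 0)
    else (l + m * digit_mass n' 0, m * digit_mass n' 1)
  else (0, 1).

Definition expansion w : X := fun n =>
  let: (l, m) := expansion_state n w in
  if w < l + m * digit_mass n 0 then ord0 else ord_max : 'I_2.

Lemma expansion_stateE n w :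
  expansion_state n w = (cylinder_left n (expansion w), cylinder_mass n (expansion w)).
Proof.
elim: n => [|n IH] /=; first by rewrite /cylinder_left /cylinder_mass !big_ord0.
have e : digit (expansion w) n = if w < cylinder_left n (expansion w) +
    cylinder_mass n (expansion w) * digit_mass n 0 then 0%N else 1%N.
  by rewrite /digit {1}/expansion IH; case: ifP.
rewrite cylinder_leftS cylinder_massS IH e.
by case: ifP => _ /=; rewrite ?mul0r ?mul1r ?addr0.
Qed.

Lemma digit_expansion n w : (digit (expansion w) n == 0%N) =
  (w < cylinder_left n (expansion w) + cylinder_mass n (expansion w) * digit_mass n 0).
Proof. by rewrite {1}/digit {1}/expansion expansion_stateE; case: ifP. Qed.

Lemma expansionP n x w : 0 <= w < 1 ->
  in_cylinder n x w <-> residue n (expansion w) = residue n x.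
Proof.
move=> w01; have self k : in_cylinder k (expansion w) w.
  elim: k => [|k IH]; last by rewrite in_cylinderS IH digit_expansion eqxx.
  by rewrite /in_cylinder /cylinder_left /cylinder_mass !big_ord0 add0r.
split; last first.
  by move=> e; rewrite /in_cylinder -(eq_cylinder_left e) -(eq_cylinder_mass e); exact: self.
elim: n => [|n IH]; first by rewrite !residue0.
rewrite in_cylinderS => /andP[/IH e]; rewrite !residueS -e.
rewrite -(eq_cylinder_left e) -(eq_cylinder_mass e) -digit_expansion => /eqP.
have := digit_lt2 x n; have := digit_lt2 (expansion w) n.
by do 2 case: (digit _ n) => [|[|//]].
Qed.

Lemma cylinder_left_ge0 n x : 0 <= cylinder_left n x.
Proof. by apply: sumr_ge0 => i _; rewrite !mulr_ge0 ?ler0n ?ltW ?mass_gt0 ?cylinder_mass_gt0. Qed.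

Lemma cylinder_right_le1 n x : cylinder_left n x + cylinder_mass n x <= 1.
Proof.
elim: n => [|n IH]; first by rewrite /cylinder_left /cylinder_mass !big_ord0 add0r.
apply: le_trans IH; rewrite cylinder_leftS cylinder_massS.
have := mass_sum n; have := mass_gt0 n 1; have := cylinder_mass_gt0 n x.
have := digit_lt2 x n; case: digit => [|[|//]] _ m0 q1 q; last first.
  by rewrite mul1r -addrA -mulrDr q mulr1.
by rewrite mul0r addr0 lerD2l ger_pMr //; lra.
Qed.

Let I01 : set (measurableTypeR R) := `[0%R, 1%R[%classic.

Let mI : measurable I01. Proof. exact: measurable_itv. Qed.

Definition unit_length : set (measurableTypeR R) -> \bar R := mrestr (@lebesgue_measure R) mI.

HB.instance Definition _ := Measure.copy unit_length
  (mrestr (@lebesgue_measure R : {measure set (measurableTypeR R) -> \bar R}) mI).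

Let unit_lengthT : unit_length setT = 1%E.
Proof. by rewrite /unit_length /mrestr setTI lebesgue_measure_itv /= lte_fin ltr01 sube0. Qed.

HB.instance Definition _ := @Measure_isProbability.Build _ (measurableTypeR R) R
  unit_length unit_lengthT.

(** The image of Lebesgue measure on [0, 1): the points with a given prefix form
    an interval, whose length is the product of the masses of its digits. *)
Lemma product_probability_exists : exists P : probability X R,
  forall n x, P (cylinder n x) = (cylinder_mass n x)%:E.
Proof.
(* Points outside [0, 1) have no expansion; they are sent anywhere inside. *)
pose g w : R := if (0 <= w) && (w < 1) then w else 0.
have mg : measurable_fun [set: measurableTypeR R] (g : _ -> measurableTypeR R).
  apply: measurable_fun_ifT; [|exact: measurable_id|exact: measurable_cst].
  by apply: measurable_and; apply: measurable_fun_ler || apply: measurable_fun_ltr.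
have g01 w : 0 <= g w < 1 by rewrite /g; case: ifP => // _; rewrite lexx ltr01.
pose D w := expansion (g w).
have Dcyl n x : D @^-1` (cylinder n x) =
    g @^-1` `[cylinder_left n x, cylinder_left n x + cylinder_mass n x[%classic.
  apply/seteqP; split=> w; rewrite /cylinder /= in_itv /= -/(in_cylinder n x (g w)) expansionP //.
have mD : measurable_fun [set: measurableTypeR R] D.
  apply: measurable_to_X => n A dA.
  pose B c := [set y | A y /\ residue n y = c].
  have -> : D @^-1` A = \bigcup_c D @^-1` (B c).
    apply/seteqP; split=> [w Aw|w [c _ []] //]; by exists (residue n (D w)).
  apply: bigcup_measurable => c _; have [[x [Ax xc]]|H] := pselect (exists x, B c x).
    have -> : B c = cylinder n x.
      apply/seteqP; split=> y; rewrite /cylinder /= xc; first by case.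
      by move=> yc; split => //; apply: dA Ax; rewrite xc yc.
    by rewrite Dcyl -[X in measurable X]setTI; apply: mg => //; exact: measurable_itv.
  have -> : B c = set0 by apply/seteqP; split => // y By; case: H; exists y.
  by rewrite preimage_set0.
pose DP : {mfun measurableTypeR R >-> X} := HB.pack D (isMeasurableFun.Build _ _ _ _ _ mD).
exists (distribution unit_length DP) => n x.
rewrite /distribution /pushforward /= -[X in unit_length X]/(D @^-1` _) Dcyl /unit_length /mrestr.
rewrite (_ : _ `&` _ = `[cylinder_left n x, cylinder_left n x + cylinder_mass n x[%classic).
  rewrite lebesgue_measure_itv /= lte_fin ltrDl cylinder_mass_gt0.
  by rewrite -EFinB addrC addKr.
have := cylinder_left_ge0 n x; have := cylinder_right_le1 n x => h1 h0.
apply/seteqP; split=> w; rewrite /I01 /= !in_itv /= /g.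
  by move=> [+ w01]; rewrite w01.
move=> /andP[lw wr]; have w01 : (0 <= w) && (w < 1) by apply/andP; split; lra.
by rewrite w01 lw wr.
Qed.

End masses.

(** * Independence of the digits, nonsingularity, conservativity *)

Lemma measure_finite_partition d (T : measurableType d) (R : realType)
    (m : {measure set T -> \bar R}) (N : nat) (g : T -> nat) (A : set T) :
  measurable A -> (forall x, (g x < N)%N) ->
  (forall c, measurable (g @^-1` [set c])) ->
  m A = (\sum_(c < N) m (A `&` g @^-1` [set nat_of_ord c]))%E.
Proof.
move=> mA gN mg; rewrite -measure_bigsetU_ord //; last 2 first.
- by move=> c; exact: measurableI.
- by move=> i j _ _ [x [[_ /= xi] [_ /= xj]]]; apply: ord_inj; rewrite -xi -xj.
congr (m _); rewrite -(@bigcup_mkord _ N (fun c => A `&` g @^-1` [set c])).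
by apply/seteqP; split=> [x Ax|x [c _ []] //]; exists (g x) => //=; exact: gN.
Qed.

Lemma determined_measure_eq (R : realType) n (m1 m2 : {measure set X -> \bar R}) :
  (forall x, m1 (cylinder n x) = m2 (cylinder n x)) ->
  forall A, determined n A -> m1 A = m2 A.
Proof.
move=> m12 A dA; have mg c : measurable (residue n @^-1` [set c]).
  by apply: (@measurable_determined n); exact: determined_residue.
have mA := measurable_determined dA.
rewrite !(measure_finite_partition _ mA (@residue_lt n) mg); apply: eq_bigr => c _.
have [[x [Ax xc]]|H] := pselect (exists x, (A `&` residue n @^-1` [set nat_of_ord c]) x).
  suff -> : A `&` residue n @^-1` [set nat_of_ord c] = cylinder n x by exact: m12.
  apply/seteqP; split=> y; rewrite /cylinder /= xc; first by case.
  by move=> yc; split => //; apply: dA Ax; rewrite xc yc.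
suff -> : A `&` residue n @^-1` [set nat_of_ord c] = set0 by rewrite !measure0.
by apply/seteqP; split => // y By; case: H; exists y.
Qed.

Lemma cylinder_measure_eq (R : realType) n0 (m1 m2 : {measure set X -> \bar R}) :
  (forall n x, (n0 <= n)%N -> m1 (cylinder n x) = m2 (cylinder n x)) ->
  (m1 setT < +oo)%E -> forall A, measurable A -> m1 A = m2 A.
Proof.
move=> m12; apply: cylinder_measure_unique => n A dA.
apply: (@determined_measure_eq _ (maxn n0 n)); last exact: determined_le (leq_maxr _ _) dA.
by move=> x; apply: m12; exact: leq_maxl.
Qed.

Section product_measure.
Variables (R : realType) (P : probability X R).
Hypothesis P_cylinder : forall n x, P (cylinder n x) = (cylinder_mass R n x)%:E.
Implicit Types (A B W : set X) (x y : X).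

Local Notation mass := (digit_mass R).
Local Notation cmass := (cylinder_mass R).

(** By additivity it is enough to treat one cylinder of depth [n], which the digit
    [n] splits in the proportions of its masses. *)
Lemma P_determined_digit n A (B : {set 'I_2}) : determined n A ->
  P (A `&` [set x | (x n : 'I_2) \in B]) =
  ((\sum_(a in B) mass n a)%:E * P A)%E.
Proof.
have w0 : 0 <= \sum_(a in B) mass n a by apply: sumr_ge0 => a _; exact/ltW/mass_gt0.
have mB : measurable [set x : X | (x n : 'I_2) \in B].
  apply: (@measurable_determined n.+1) => x y xy /=.
  by rewrite (residue_inj xy).
apply: (@determined_measure_eq _ n (mrestr P mB) (mscale (NngNum w0) P)) => x.
rewrite /= /mrestr /mscale /= P_cylinder.
have mg c : measurable ((fun x : X => digit x n) @^-1` [set c]).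
  apply: (@measurable_determined n.+1) => y z yz /=.
  by rewrite /digit (residue_inj yz).
have mC := measurable_determined (@determined_cylinder n x).
rewrite (measure_finite_partition P (measurableI _ _ mC mB) (digit_lt2^~ n) mg).
pose u (d : 'I_2) : X := fun i => if i == n then d else x i : 'I_2.
have un d : u d n = d by rewrite /u eqxx.
have ux d : residue n (u d) = residue n x.
  by apply: eq_residue => i i_n; rewrite /u ltn_eqF.
transitivity (\sum_(d < 2 | d \in B) P (cylinder n.+1 (u d)))%E.
  rewrite [RHS]big_mkcond /=; apply: eq_bigr => d _.
  have -> : cylinder n x `&` [set y | (y n : 'I_2) \in B] `&`
      (fun y => digit y n) @^-1` [set nat_of_ord d] =
      if d \in B then cylinder n.+1 (u d) else set0.
    apply/seteqP; split=> y.
      move=> [[xy /= yB] yd]; have {}yd : y n = d :> 'I_2 by exact: ord_inj.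
      rewrite -yd yB; apply/cylinderS; rewrite un yd; split=> //.
      by rewrite /cylinder /= ux.
    case: ifP => // dB /cylinderS [yx]; rewrite un => yd; split; last by rewrite /= /digit yd.
    by split; [move: yx; rewrite /cylinder /= ux|rewrite /= yd].
  by case: ifP => // _; rewrite measure0.
transitivity (\sum_(d < 2 | d \in B) (mass n d)%:E * (cmass n x)%:E)%E.
  apply: eq_bigr => d _; rewrite P_cylinder cylinder_massS (eq_cylinder_mass _ (ux d)).
  by rewrite /digit un mulrC EFinM.
by rewrite -ge0_sume_distrl ?sumEFin // => d _; rewrite lee_fin ltW ?mass_gt0.
Qed.

Lemma P_product N (B : forall n, {set 'I_(binary_base n)}) :
  P [set x | forall n, (n < N)%N -> x n \in B n] =
  (\prod_(n < N) \sum_(a in B n) mass n (a : 'I_2))%:E.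
Proof.
elim: N => [|N IH].
  rewrite big_ord0 (_ : [set x | _] = setT) ?probability_setT //.
  by apply/seteqP; split.
rewrite (_ : [set x | _] = [set x | forall n, (n < N)%N -> x n \in B n] `&`
    [set x : X | (x N : 'I_2) \in B N]); last first.
  apply/seteqP; split=> [x H|x [H xN] n].
    by split=> [n nN|]; [exact: (H n (ltnW nN))|exact: (H N (ltnSn N))].
  by rewrite ltnS leq_eqVlt => /predU1P[->|]; [exact: xN|exact: H].
have dN : determined N [set x : X | forall n, (n < N)%N -> x n \in B n].
  by move=> x y xy /= H n nN; rewrite -(residue_inj xy nN) H.
have := P_determined_digit (B N) dN; rewrite IH => ->.
by rewrite -EFinM big_ord_recr /= mulrC.
Qed.

Lemma splice_splice n c c' x : splice n c (splice n c' x) = splice n c x.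
Proof. by apply: point_ext => i; rewrite /splice; case: (i < n)%N. Qed.

Lemma measurable_residue n c : measurable [set x : X | residue n x = c].
Proof. by apply: (@measurable_determined n); exact: (determined_residue (B := [set c])). Qed.

Lemma measurable_preimage (g : X -> X) A : measurable_fun [set: X] g -> measurable A ->
  measurable (g @^-1` A).
Proof. by move=> mg mA; rewrite -[X in measurable X]setTI; exact: mg. Qed.

(** The first [n] digits are independent of the tail: both sides are measures in
    [A], and they agree on the cylinders of depth at least [n]. This computes the
    effect on the measure of any map that only rewrites the first [n] digits. *)
Lemma P_transport n c A : (c < 2 ^ n)%N -> measurable A ->
  P ([set x | residue n x = c] `&` A) =
  (P [set x | residue n x = c] * P (splice n c @^-1` A))%E.
Proof.
move=> cn; pose z : X := splice n c (fun=> ord0 : 'I_2).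
have zc : residue n z = c by exact: residue_splice.
have -> : [set x | residue n x = c] = cylinder n z by rewrite /cylinder zc.
have mC := measurable_determined (@determined_cylinder n z).
pose sp : {mfun X >-> X} := HB.pack (splice n c)
  (isMeasurableFun.Build _ _ _ _ _ (measurable_splice n c)).
rewrite P_cylinder setIC => mA.
have r0 := ltW (cylinder_mass_gt0 R n z).
apply: (@cylinder_measure_eq _ n (mrestr P mC)
  (mscale (NngNum r0) (distribution P sp))) mA => /=; last first.
  by rewrite /mrestr setTI P_cylinder ltry.
move=> N x nN; rewrite /mrestr /mscale /distribution /pushforward /=.
have [xc|xc] := eqVneq (residue n x) c; last first.
  rewrite [X in P X](_ : _ = set0); last first.
    apply/seteqP; split=> // y [/(eq_residue_le nN) yx]; rewrite /cylinder /= zc => yc.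
    by move: xc; rewrite -yx yc eqxx.
  rewrite [X in (_ * P X)%E](_ : _ = set0) ?measure0 ?mule0 //.
  apply/seteqP; split=> // y /= /(eq_residue_le nN); rewrite residue_splice // => yx.
  by move: xc; rewrite -yx eqxx.
rewrite [X in P X](_ : _ = cylinder N x); last first.
  apply/seteqP; split=> [y []//|y yx]; split=> //.
  by move: (eq_residue_le nN yx); rewrite /cylinder /= zc xc.
rewrite P_cylinder.
pose B i : {set 'I_(binary_base i)} := if (i < n)%N then [set: _]%SET else [set (x i : 'I_2)]%SET.
rewrite [X in (_ * P X)%E](_ : _ = [set y | forall i, (i < N)%N -> y i \in B i]); last first.
  apply/seteqP; split=> y; rewrite /cylinder /= => H.
    move=> i iN; rewrite /B; case: ltnP => [_|ni]; first by rewrite inE.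
    by rewrite inE -(residue_inj H iN) splice_tail.
  apply: eq_residue => i iN; have [ni|i_n] := leqP n i.
    by rewrite splice_tail //; move: (H i iN); rewrite /B ltnNge ni /= inE => /eqP.
  by apply: residue_inj i_n; rewrite residue_splice.
rewrite P_product -EFinM; congr EFin.
rewrite /cylinder_mass (bigID (fun i : 'I_N => (i < n)%N)) /=; congr (_ * _).
  rewrite (big_ord_widen N (fun i => mass i (digit z i)) nN).
  by apply: eq_bigr => i i_n; rewrite /digit (@residue_inj n z x i _ i_n) // zc xc.
rewrite big_mkcond /=; apply: eq_bigr => i _; rewrite /B -leqNgt.
case: ltnP => _; last by rewrite big_set1.
rewrite (eq_bigl predT); last by move=> a; rewrite inE.
by rewrite !big_ord_recl big_ord0 addr0 /= mass_sum.
Qed.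

Lemma mass_le0 n d : mass n d <= mass n 0.
Proof.
rewrite /digit_mass /=; case: eqP => // _.
by rewrite ler_peMl ?invr_ge0 ?ler1n.
Qed.

Lemma prod_mass0 n : \prod_(i < n) mass i 0 = n.+1%:R^-1.
Proof.
elim: n => [|n IH]; first by rewrite big_ord0 invr1.
by rewrite big_ord_recr /= IH /digit_mass eqxx mulrA mulVf ?mul1r // pnatr_eq0.
Qed.

Lemma prod_mass1 n : \prod_(i < n) mass i 1 = n.+1`!%:R^-1.
Proof.
elim: n => [|n IH]; first by rewrite big_ord0 invr1.
by rewrite big_ord_recr /= IH /digit_mass /= [in RHS]factS natrM invfM mulrC.
Qed.

Lemma cylinder_mass_le n x : cmass n x <= n.+1%:R^-1.
Proof.
rewrite -prod_mass0; apply: ler_prod => i _.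
by rewrite mass_le0 ltW ?mass_gt0.
Qed.

Lemma residue_all_ones n x : residue n x = (2 ^ n).-1 ->
  forall i, (i < n)%N -> digit x i = 1%N.
Proof.
move=> e i i_n; have := residue_max n x.
rewrite e prednK ?expn_gt0 // eqxx => /esym /forallP /(_ (Ordinal i_n)) /eqP //.
Qed.

Lemma residue_all_zeros n x : residue n x = 0%N ->
  forall i, (i < n)%N -> digit x i = 0%N.
Proof. by move=> e i i_n; rewrite (residue_digit _ i_n) e div0n. Qed.

Lemma P_residue n c : (c < 2 ^ n)%N ->
  exists2 x, residue n x = c & P [set x | residue n x = c] = (cmass n x)%:E.
Proof.
move=> cn; have e := residue_splice (fun=> ord0 : 'I_2) cn.
by exists (splice n c (fun=> ord0 : 'I_2)) => //; rewrite -P_cylinder /cylinder e.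
Qed.

Lemma P_all_ones n : P [set x | residue n x = (2 ^ n).-1] = (n.+1`!%:R^-1)%:E.
Proof.
have [|x xn ->] := @P_residue n (2 ^ n).-1; first by rewrite prednK ?expn_gt0.
by congr EFin; rewrite -prod_mass1; apply: eq_bigr => i _; rewrite (residue_all_ones xn).
Qed.

Lemma P_ones_zero n : P [set x | residue n.+1 x = (2 ^ n).-1] =
  (n.+1`!%:R^-1 * (n.+1%:R / n.+2%:R))%:E.
Proof.
have lt : ((2 ^ n).-1 < 2 ^ n.+1)%N.
  by rewrite prednK ?expn_gt0 // leq_exp2l.
have [x xn ->] := P_residue lt; congr EFin.
have xn' : residue n x = (2 ^ n).-1.
  by rewrite -(residue_mod x (leqnSn n)) xn modn_small // prednK ?expn_gt0.
rewrite cylinder_massS -prod_mass1; congr (_ * _).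
  by apply: eq_bigr => i _; rewrite (residue_all_ones xn').
by rewrite (residue_digit _ (ltnSn n)) xn divn_small ?mod0n ?prednK ?expn_gt0.
Qed.

Lemma P_zeros_one n : P [set x | residue n.+1 x = (2 ^ n)%N] =
  (n.+1%:R^-1 / n.+2%:R)%:E.
Proof.
have lt : (2 ^ n < 2 ^ n.+1)%N by rewrite ltn_exp2l.
have [x xn ->] := P_residue lt; congr EFin.
have xn' : residue n x = 0%N.
  by rewrite -(residue_mod x (leqnSn n)) xn modnn.
rewrite cylinder_massS -prod_mass0; congr (_ * _).
  by apply: eq_bigr => i _; rewrite (residue_all_zeros xn').
by rewrite (residue_digit _ (ltnSn n)) xn divnn expn_gt0.
Qed.

Lemma succ_le_double_fact n : (n.+1 <= 2 * n`!)%N.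
Proof. by elim: n => [|[|n] IH] //; rewrite factS; have := fact_gt0 n.+1; nia. Qed.

(** The quotient of the two measures is [(n + 1) / n!]. *)
Lemma P_carry_le n : (P [set x | residue n.+1 x = (2 ^ n).-1] <=
  2%:E * P [set x | residue n.+1 x = (2 ^ n)%N])%E.
Proof.
rewrite P_ones_zero P_zeros_one -EFinM lee_fin mulrA [_ * (_ / _)]mulrA.
rewrite ler_pM2r ?invr_gt0 ?ltr0n // factS natrM invfM mulrAC mulVf ?mul1r ?pnatr_eq0 //.
rewrite ler_pdivlMr ?ltr0n // mulrC ler_pdivrMr ?ltr0n ?fact_gt0 //.
by rewrite -natrM ler_nat succ_le_double_fact.
Qed.

Lemma P_null_of_le A : measurable A -> (forall n, P A <= (n.+1%:R^-1)%:E)%E -> P A = 0%E.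
Proof.
move=> mA H; apply/eqP; rewrite eq_le measure_ge0 andbT.
have fA := fin_num_measure P A mA.
have {}H n : fine (P A) <= n.+1%:R^-1 by rewrite -lee_fin fineK.
rewrite -(fineK fA) lee_fin leNgt; apply/negP => e0.
have [n _ /(_ n (leqnn n))] := near_infty_natSinv_lt (PosNum e0).
by rewrite /= ltNge H.
Qed.

(** On the points with [n] leading digits [1] followed by a [0], the odometer only
    rewrites the first [n + 1] digits, and it dilates the measure by the constant
    of [P_carry_le]. The point with all digits [1] is null. *)
Lemma P_preimage_odometer_le A : measurable A -> (P (f @^-1` A) <= 2%:E * P A)%E.
Proof.
move=> mA.
(* [Z n] is the image of the points at which the carry stops at the digit [n];
   [Z0] is the single point left over. *)
pose Z n : set X := [set x | residue n.+1 x = (2 ^ n)%N].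
pose Z0 : set X := [set x | forall n, residue n x = 0%N].
have mZ n : measurable (Z n) by exact: measurable_residue.
have mZ0 : measurable Z0.
  rewrite (_ : Z0 = \bigcap_n [set x | residue n x = 0%N]).
    by apply: bigcapT_measurable => n; exact: measurable_residue.
  by apply/seteqP; split=> x H n; [move=> _; exact: H|exact: (H n Logic.I)].
have Zn x n : Z n x -> residue n x = 0%N /\ digit x n = 1%N.
  move=> xn; split; first by rewrite -(residue_mod x (leqnSn n)) xn modnn.
  by rewrite (residue_digit _ (ltnSn n)) xn divnn expn_gt0.
have tZ : trivIset setT Z.
  apply/trivIsetP => i j _ _; wlog ij : i j / (i < j)%N => [H|_].
    move=> ne; move: (ne); rewrite neq_ltn => /orP[ij|ij]; first exact: H.
    by rewrite setIC; apply: H => //; rewrite eq_sym.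
  apply/seteqP; split=> // x [/Zn[_ xi] /Zn[xj _]].
  by move: xi; rewrite (residue_all_zeros xj).
have cover : A `<=` Z0 `|` \bigcup_n (A `&` Z n).
  move=> x Ax; have [x0|] := pselect (Z0 x); [by left|right].
  have [n xn Hmin] : exists2 n, residue n x != 0%N & forall m, residue m x != 0%N -> (n <= m)%N.
    have ex : exists n, residue n x != 0%N.
      by apply: contra_notP b => H n; apply/eqP/negPn/negP => xn; apply: H; exists n.
    by case: (ex_minnP ex) => n xn Hmin; exists n.
  case: n xn Hmin => [|n]; first by rewrite residue0.
  move=> xn Hmin; exists n => //; split=> //; rewrite /Z /=.
  have x0 : residue n x = 0%N.
    by apply/eqP/negPn/negP => /Hmin; rewrite ltnn.
  move: xn; rewrite residueS x0 add0n; have := digit_lt2 x n.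
  by case: digit => [|[|//]] _; rewrite ?mul0n ?mul1n.
have mf := measurable_odometer.
have Z0null : P (f @^-1` Z0) = 0%E.
  apply: P_null_of_le => [|n]; first exact: measurable_preimage.
  apply: (@le_trans _ _ (P [set x | residue n x = (2 ^ n).-1])).
    apply: le_measure; rewrite ?inE; [exact: measurable_preimage|exact: measurable_residue|].
    move=> x /(_ n) /=; rewrite residue_odometer; have := residue_lt n x.
    rewrite leq_eqVlt => /predU1P[<-//|lt]; rewrite modn_small //.
  rewrite P_all_ones lee_fin lef_pV2 ?posrE ?ltr0n ?fact_gt0 // ler_nat.
  by rewrite factS leq_pmulr ?fact_gt0.
have piece n : (P (f @^-1` (A `&` Z n)) <= 2%:E * P (A `&` Z n))%E.
  have lt1 : ((2 ^ n).-1 < 2 ^ n.+1)%N by rewrite prednK ?expn_gt0 // leq_exp2l.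
  have lt2 : (2 ^ n < 2 ^ n.+1)%N by rewrite ltn_exp2l.
  set E := splice n.+1 (2 ^ n) @^-1` A.
  have mE : measurable E by apply: measurable_preimage => //; exact: measurable_splice.
  have -> : f @^-1` (A `&` Z n) = [set x | residue n.+1 x = (2 ^ n).-1] `&` E.
    have h x : residue n.+1 x = (2 ^ n).-1 -> f x = splice n.+1 (2 ^ n) x.
      move=> xn; have lt : ((residue n.+1 x).+1 < 2 ^ n.+1)%N by rewrite xn prednK ?expn_gt0.
      have e : residue n.+1 (f x) = (2 ^ n)%N.
        by rewrite residue_odometer modn_small // xn prednK ?expn_gt0.
      rewrite -e; symmetry; apply: splice_residue => i ni; exact: odometer_tail lt ni.
    apply/seteqP; split=> x.
      move=> [Afx]; rewrite /Z /= residue_odometer => e.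
      have xn : residue n.+1 x = (2 ^ n).-1.
        move: e; have := residue_lt n.+1 x; rewrite leq_eqVlt => /predU1P[->|lt].
          by rewrite modnn => /eqP; rewrite eq_sym expn_eq0.
        by rewrite modn_small // => <-.
      by split=> //; rewrite /E /= -h.
    move=> [xn]; rewrite /E /= -h // => Afx; split=> //.
    by rewrite /Z /= residue_odometer xn prednK ?expn_gt0 // modn_small.
  have -> : A `&` Z n = [set x | residue n.+1 x = (2 ^ n)%N] `&` A by rewrite setIC.
  rewrite !P_transport // -/E.
  have -> : splice n.+1 (2 ^ n).-1 @^-1` E = E.
    by apply/seteqP; split=> x; rewrite /E /= splice_splice.
  by rewrite muleA lee_wpmul2r ?measure_ge0 // P_carry_le.
apply: (@le_trans _ _ (P (f @^-1` Z0 `|` \bigcup_n f @^-1` (A `&` Z n)))).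
  apply: le_measure; rewrite ?inE.
  - exact: measurable_preimage.
  - apply: measurableU; first exact: measurable_preimage.
    by apply: bigcupT_measurable => n; apply: measurable_preimage => //; exact: measurableI.
  - by rewrite -preimage_bigcup -preimage_setU; exact: preimage_subset.
have mU : measurable (\bigcup_n f @^-1` (A `&` Z n)).
  by apply: bigcupT_measurable => n; apply: measurable_preimage => //; exact: measurableI.
apply: (@le_trans _ _ (P (f @^-1` Z0) + P (\bigcup_n f @^-1` (A `&` Z n)))%E).
  by apply: measureU2 => //; exact: measurable_preimage.
rewrite Z0null add0e.
apply: (@le_trans _ _ (\sum_(n <oo) P (f @^-1` (A `&` Z n)))%E).
  apply: measure_sigma_subadditive => // n.
  by apply: measurable_preimage => //; exact: measurableI.
apply: (@le_trans _ _ (\sum_(n <oo) (2%:E * P (A `&` Z n)))%E).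
  by apply: lee_nneseries => n *; [exact: measure_ge0|exact: piece].
rewrite nneseriesZl; last by move=> n _; exact: measure_ge0.
rewrite lee_pmul2l // -measure_semi_bigcup //.
- apply: le_measure; rewrite ?inE //.
    by apply: bigcupT_measurable => n; exact: measurableI.
  by apply: bigcup_sub => n _; exact: subIsetl.
- by move=> n; exact: measurableI.
- exact: trivIset_setIl.
- by apply: bigcupT_measurable => n; exact: measurableI.
Qed.

(** Points with the same tail lie on one orbit, so a wandering set contains at most
    one of them: its slices over the cylinders of depth [n] have disjoint tails, and
    its measure is at most that of the largest cylinder, for every [n]. *)
Lemma wandering_null W : measurable W ->
  (forall k x, (0 < k)%N -> W x -> ~ W (iter k f x)) -> P W = 0%E.
Proof.
move=> mW wW; apply: P_null_of_le => // n.
have mg c : measurable (residue n @^-1` [set c]) by exact: measurable_residue.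
have -> : P W = (\sum_(c < 2 ^ n) P (W `&` residue n @^-1` [set nat_of_ord c]))%E.
  exact: measure_finite_partition mW (@residue_lt n) mg.
have msp c : measurable (splice n c @^-1` W).
  by apply: measurable_preimage => //; exact: measurable_splice.
apply: (@le_trans _ _ (\sum_(c < 2 ^ n) (n.+1%:R^-1)%:E * P (splice n c @^-1` W))%E).
  apply: lee_sum => c _; rewrite setIC P_transport // lee_wpmul2r ?measure_ge0 //.
  have [x _ ->] := P_residue (ltn_ord c); rewrite lee_fin; exact: cylinder_mass_le.
rewrite -ge0_sume_distrr; last by move=> c _; exact: measure_ge0.
have -> : (\sum_(c < 2 ^ n) P (splice n c @^-1` W) =
    P (\big[setU/set0]_(c < 2 ^ n) (splice n c @^-1` W)))%E.
  symmetry; apply: measure_bigsetU_ord => //.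
  move=> i j _ _ [x [Wi Wj]]; apply/eqP/negPn/negP => ij.
  wlog lt : i j Wi Wj ij / (i < j)%N => [H|].
    have /orP[lt|lt] : (i < j)%N || (j < i)%N by rewrite -neq_ltn.
      exact: (H i j).
    by apply: (H j i) => //; rewrite eq_sym.
  apply: (wW (j - i)%N (splice n i x)) => //; first by rewrite subn_gt0.
  rewrite (@same_tail_orbit n _ _ (splice n j x)) //.
    by move=> k nk; rewrite !splice_tail.
  by rewrite !residue_splice // subnKC // ltnW.
rewrite -[leRHS]mule1; apply: lee_wpmul2l; first by rewrite lee_fin.
apply: probability_le1; exact: bigsetU_measurable.
Qed.

(** The points with a digit [1] at some index between [m] and [m + s]. *)
Definition window m s : set X := [set x | (2 ^ m <= residue (m + s).+1 x)%N].

Lemma measurable_window m s : measurable (window m s).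
Proof.
apply: (@measurable_determined (m + s).+1).
exact: (determined_residue (B := [set c | (2 ^ m <= c)%N])).
Qed.

Lemma P_windowC m s : P (~` window m s) = (m.+1%:R / (m + s).+2%:R)%:E.
Proof.
have -> : ~` window m s = [set x | (residue (m + s).+1 x < 2 ^ m)%N].
  by apply/seteqP; split=> x; rewrite /window /= ltnNge => /negP.
have step t : P [set x | (residue (m + t) x < 2 ^ m)%N] = (m.+1%:R / (m + t).+1%:R)%:E.
  elim: t => [|t IH].
    rewrite addn0 divff ?pnatr_eq0 // -(probability_setT P); congr (P _).
    by apply/seteqP; split=> x // _; exact: residue_lt.
  rewrite addnS (_ : [set x | _] = [set x | (residue (m + t) x < 2 ^ m)%N] `&`
      [set x : X | (x (m + t)%N : 'I_2) \in [set ord0]%SET]); last first.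
    apply/seteqP; split=> x /=; rewrite residueS inE.
      move=> lt; have x0 : digit x (m + t) = 0%N.
        have := digit_lt2 x (m + t); case: digit lt => [//|[|//]].
        by rewrite mul1n => lt _; have := leq_pexp2l (ltn0Sn 1) (leq_addr t m); lia.
      by split; [move: lt; rewrite x0 mul0n addn0|apply/eqP; exact: ord_inj].
    by move=> [lt /eqP xt]; rewrite /digit xt mul0n addn0.
  rewrite P_determined_digit ?IH; last exact: (determined_residue (B := [set c | (c < 2 ^ m)%N])).
  rewrite big_set1 -EFinM /digit_mass /=; congr EFin.
  by rewrite mulrC mulrA mulfVK ?pnatr_eq0.
by have := step s.+1; rewrite addnS.
Qed.

Lemma P_window_le m s : (P (window m s) <= (s.+1%:R / m.+1%:R)%:E)%E.
Proof.
have /eqP := P_windowC m s; rewrite probability_setC; last exact: measurable_window.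
have fA := fin_num_measure P _ (measurable_window m s).
rewrite -(fineK fA) -EFinB eqe => /eqP e; rewrite lee_fin.
have -> : fine (P (window m s)) = s.+1%:R / (m + s).+2%:R.
  have h : (m + s).+2%:R != 0 :> R by rewrite pnatr_eq0.
  apply: (mulIf h); rewrite divfK //.
  have := congr1 (fun z => z * (m + s).+2%:R) e; rewrite /= divfK // mulrBl mul1r.
  have -> : (m + s).+2%:R = m.+1%:R + s.+1%:R :> R by rewrite -natrD addSn addnS.
  by lra.
by rewrite ler_pM2l ?ltr0n // lef_pV2 ?posrE ?ltr0n // ler_nat ltnS -addnS leq_addr.
Qed.

(** Adding [k] to a residue below [2 ^ m] gives at least [2 ^ m] and does not
    overflow the digit [m + s]. Hence for long stretches of times [k] almost all
    points are moved into a set of small measure. *)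
Lemma window_shift m s k x : (2 ^ m <= k < 2 ^ (m + s))%N ->
  ~ window m s x -> window m s (iter k f x).
Proof.
move=> /andP[mk ks] /negP; rewrite /window /= -ltnNge residue_iter => lt.
have h : (2 ^ m <= 2 ^ (m + s))%N by rewrite leq_pexp2l // leq_addr.
rewrite modn_small ?expnS; lia.
Qed.

End product_measure.

(** * Density of the functions of finitely many digits *)

Section cylinder_approximation.
Variables (R : realType) (P : probability X R).
Implicit Types (A E : set X).

Let symdiff A E := (A `\` E) `|` (E `\` A).

Definition approximable A := measurable A /\ forall e : R, 0 < e ->
  exists n E, determined n E /\ (P (symdiff A E) <= e%:E)%E.

Let measurable_symdiff A E : measurable A -> measurable E -> measurable (symdiff A E).
Proof. by move=> mA mE; apply: measurableU; exact: measurableD. Qed.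

(** The approximable sets form a sigma-algebra that contains the cylinder sets. *)
Lemma measurable_approximable A : measurable A -> approximable A.
Proof.
rewrite measurable_cylinder_sets; move: A; apply: smallest_sub; last first.
  move=> A [n dA]; split=> [|e e0]; first exact: measurable_determined dA.
  exists n, A; split=> //; rewrite (_ : symdiff A A = set0) ?measure0 ?lee_fin ?(ltW e0) //.
  by rewrite /symdiff setDv setU0.
have apU A B : approximable A -> approximable B -> approximable (A `|` B).
  move=> [mA aA] [mB aB]; split=> [|e e0]; first exact: measurableU.
  have e20 : 0 < e / 2 by rewrite divr_gt0.
  have [n [E [dE AE]]] := aA _ e20; have [m [E' [dE' BE']]] := aB _ e20.
  have mE := measurable_determined dE; have mE' := measurable_determined dE'.
  exists (maxn n m), (E `|` E'); split.
    move=> x y xy [Ex|Ex]; [left|right].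
      exact: determined_le (leq_maxl _ _) dE _ _ xy Ex.
    exact: determined_le (leq_maxr _ _) dE' _ _ xy Ex.
  apply: (@le_trans _ _ (P (symdiff A E `|` symdiff B E'))).
    apply: le_measure; rewrite ?inE; try by [apply: measurable_symdiff; exact: measurableU|
      apply: measurableU; exact: measurable_symdiff].
    move=> x [[[Ax|Bx] /not_orP[nE nE']]|[[Ex|Ex] /not_orP[nA nB]]].
    - by left; left.
    - by right; left.
    - by left; right.
    - by right; right.
  apply: (@le_trans _ _ (P (symdiff A E) + P (symdiff B E'))%E).
    by apply: measureU2; exact: measurable_symdiff.
  by rewrite (splitr e) EFinD leeD.
split.
- split=> // e e0; exists 0%N, set0; split=> //.
  by rewrite /symdiff setDv setU0 measure0 lee_fin ltW.
- move=> A [mA aA]; rewrite setTD; split=> [|e e0]; first exact: measurableC.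
  have [n [E [dE AE]]] := aA e e0; exists n, (~` E); split; first exact: determinedC.
  by rewrite (_ : symdiff _ _ = symdiff A E) //
    /symdiff !setDE !setCK setUC setIC [X in _ `|` X]setIC.
move=> A aA; have mA n : measurable (A n) by case: (aA n).
have mU : measurable (\bigcup_k A k) by exact: bigcupT_measurable.
pose U n := \big[setU/set0]_(k < n) A k.
have aU n : approximable (U n).
  elim: n => [|n IH]; rewrite /U ?big_ord0 ?big_ord_recr /=; last exact: apU.
  split=> // e e0; exists 0%N, set0; split=> //.
  by rewrite /symdiff setDv setU0 measure0 lee_fin ltW.
have mUn n : measurable (U n) by case: (aU n).
split=> // e e0; have e20 : 0 < e / 2 by rewrite divr_gt0.
have [|m n mn x [Ux nUx]|x|n Hn] := @decreasing_measure_small _ _ _ P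
    (fun n => \bigcup_k A k `\` U n) _ _ _ _ e20.
- by move=> n; exact: measurableD.
- split=> // Um; apply: nUx; move: Um; rewrite /U -!bigcup_mkord => -[k /= km Ak].
  by exists k => //=; exact: leq_trans mn.
- have [[k _ Ak]|nA] := pselect ((\bigcup_k A k) x); last by exists 0%N => -[].
  by exists k.+1 => -[_]; apply; rewrite /U -bigcup_mkord; exists k => /=.
have [_ /(_ _ e20)[m [E [dE UE]]]] := aU n.
have mE := measurable_determined dE.
exists m, E; split=> //.
apply: (@le_trans _ _ (P ((\bigcup_k A k `\` U n) `|` symdiff (U n) E))).
  apply: le_measure; rewrite ?inE.
  - exact: measurable_symdiff.
  - by apply: measurableU; [exact: measurableD|exact: measurable_symdiff].
  move=> x [[Ax nE]|[Ex nA]].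
    by have [Ux|Ux] := pselect (U n x); [right; left|left].
  right; right; split=> // Ux; apply: nA; move: Ux; rewrite /U -bigcup_mkord.
  by case=> k _ Ak; exists k.
apply: (@le_trans _ _ (P (\bigcup_k A k `\` U n) + P (symdiff (U n) E))%E).
  by apply: measureU2; [exact: measurableD|exact: measurable_symdiff].
by rewrite (splitr e) EFinD leeD.
Qed.

End cylinder_approximation.

Section density.
Variables (R : realType) (P : probability X R) (K : scalarField R) (q : nat -> K).
Hypotheses (q0 : q 0%N = 0)
  (q_dense : forall (z : K) (e : R), 0 < e -> exists i, modulus (z - q i) < e).
Variables (p : R) (p1 : 1 <= p).
Local Notation energy := (Lp_energy P p).

Let p0 : 0 < p. Proof. exact: Lp_gt0 p1. Qed.

(** Approximate each level set of [k] by a set [E i] determined by [n] digits, and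
    pick for [x] some [i] with [x] in [E i]: this only depends on the residue, and
    is right outside the symmetric differences. *)
Lemma index_approx (k : X -> nat) (N : nat) (e : R) :
  (forall i, measurable (k @^-1` [set i])) -> (forall x, (k x <= N)%N) -> 0 < e ->
  exists (n : nat) (t : seq nat) (S : set X), [/\ forall c, (nth 0%N t c <= N)%N,
    measurable S, (P S <= e%:E)%E &
    forall x, ~ S x -> k x = nth 0%N t (residue n x)].
Proof.
move=> mk kN e0; have e1 : 0 < e / N.+1%:R by rewrite divr_gt0 ?ltr0n.
have H i : exists nE : nat * set X, determined nE.1 nE.2 /\
    (P ((k @^-1` [set i] `\` nE.2) `|` (nE.2 `\` k @^-1` [set i])) <= (e / N.+1%:R)%:E)%E.
  have [_ /(_ _ e1)[n [E [dE HE]]]] := measurable_approximable P (mk i).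
  by exists (n, E).
have [nE HnE] := choice H.
pose n := (\max_(i < N.+1) (nE i).1)%N.
have dE (i : 'I_N.+1) : determined n (nE i).2.
  by apply: determined_le (proj1 (HnE i));
  exact: (leq_bigmax_cond (F := fun i : 'I_N.+1 => (nE i).1)).
pose g x : nat := if [pick i : 'I_N.+1 | `[< (nE i).2 x >]] is Some i then i else 0%N.
have g_det x y : residue n x = residue n y -> g x = g y.
  move=> xy; rewrite /g (eq_pick (Q := fun i : 'I_N.+1 => `[< (nE i).2 y >])) // => i /=.
  by apply/asboolP/asboolP; apply: dE.
have gN x : (g x <= N)%N.
  by rewrite /g; case: pickP => // i _; rewrite -ltnS.
pose t := mkseq (fun c => g (splice n c (fun=> ord0 : 'I_2))) (2 ^ n).
pose D i := (k @^-1` [set i] `\` (nE i).2) `|` ((nE i).2 `\` k @^-1` [set i]).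
have mD i : (i < N.+1)%N -> measurable (D i).
  move=> iN; have mE := measurable_determined (dE (Ordinal iN)).
  by apply: measurableU; exact: measurableD.
exists n, t, (\big[setU/set0]_(i < N.+1) D i); split.
- move=> c; have [cn|nc] := ltnP c (2 ^ n); first by rewrite nth_mkseq.
  by rewrite nth_default // size_mkseq.
- by apply: bigsetU_measurable => i _; apply: mD.
- apply: (le_trans (Boole_inequality P mD)).
  apply: (@le_trans _ _ (\sum_(i < N.+1) (e / N.+1%:R)%:E)%E).
    by apply: lee_sum => i _; case: (HnE i).
  by rewrite sumEFin sumr_const card_ord -[_ *+ N.+1]mulr_natr divfK ?pnatr_eq0.
move=> x nD; rewrite nth_mkseq ?residue_lt //.
rewrite (@g_det _ x); last by rewrite residue_splice ?residue_lt.
have {nD} inE' (i : 'I_N.+1) : (nE i).2 x <-> k x = i.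
  split=> [Ex|kx]; apply: contrapT => H'; apply: nD; rewrite -bigcup_mkord; exists i => //=.
    by right.
  by left.
rewrite /g; case: pickP => [i /asboolP /inE' //|none].
by have := none (Ordinal (kN x : (k x < N.+1)%N)); move/asboolP; rewrite inE'.
Qed.

Lemma kmeasurable_index (k : X -> nat) : (forall i, measurable (k @^-1` [set i])) ->
  kmeasurable (fun x => q (k x)).
Proof.
move=> mk; apply: (@kmeasurable_glue _ _ _ _ (fun i => k @^-1` [set i]) (fun i => fun=> q i)) => //.
- by apply/seteqP; split=> // x _; exists (k x).
- by move=> i; exact: kmeasurable_cst.
- by move=> i x /= ->.
Qed.

(** A function of the first [n] digits, given by a table of indices of values in a
    countable dense set of scalars; there are countably many of them. *)
Definition cylinder_fun n (t : seq nat) (x : X) : K := q (nth 0%N t (residue n x)).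

Definition cylinder_bound n (t : seq nat) : R :=
  \sum_(c < 2 ^ n) modulus (q (nth 0%N t c)).

Lemma cylinder_bound_ge0 n t : 0 <= cylinder_bound n t.
Proof. by apply: sumr_ge0 => c _; exact: modulus_ge0. Qed.

Lemma cylinder_fun_le n t x : modulus (cylinder_fun n t x) <= cylinder_bound n t.
Proof.
rewrite /cylinder_bound (bigD1 (Ordinal (residue_lt n x))) //= lerDl.
by apply: sumr_ge0 => c _; exact: modulus_ge0.
Qed.

Lemma kmeasurable_cylinder_fun n t : kmeasurable (cylinder_fun n t).
Proof.
apply: (@kmeasurable_index (fun x => nth 0%N t (residue n x))) => i.
by apply: (@measurable_determined n) => x y xy /=; rewrite xy.
Qed.

Lemma cylinder_fun_periodic n t k x :
  cylinder_fun n t (iter (k * 2 ^ n) f x) = cylinder_fun n t x.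
Proof. by rewrite /cylinder_fun residue_iter addnC modnMDl modn_small ?residue_lt. Qed.

Lemma cylinder_energy_lty n t : (energy (cylinder_fun n t) < +oo)%E.
Proof.
apply: (le_lt_trans (bounded_energy P p1 (kmeasurable_cylinder_fun n t) (@cylinder_fun_le n t))).
exact: ltry.
Qed.

Definition cylinder_Lp n t : Lpfun P K p1 :=
  mkLp p1 (kmeasurable_cylinder_fun n t) (cylinder_energy_lty n t).

(** Replace a function by the first value of [q] within [e / 4] of it, keep only
    the indices below some [N], which costs a tail of an integral, and approximate
    the resulting function of finitely many values. *)
Lemma cylinder_Lp_dense (u : Lp P K p1) (e : R) : 0 < e ->
  exists n t, nrm (u - Lp_class (cylinder_Lp n t)) < e.
Proof.
elim/Lp_ind: u => phi e0; have kphi := Lpfun_kmeasurable phi.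
have e4 : 0 < e / 4 by rewrite divr_gt0.
pose h := nearest q_dense phi e4.
have mh i : measurable (h @^-1` [set i]) by exact: measurable_nearest.
pose G x := (modulus (phi x) `^ p)%:E.
have mG : measurable_fun [set: X] G by exact: measurable_energy.
have G0 x : (0 <= G x)%E by rewrite lee_fin powR_ge0.
have iG : P.-integrable setT G.
  apply/integrableP; split=> //; under eq_integral do rewrite gee0_abs //.
  exact: Lpfun_energy_lty.
have e4p : 0 < (e / 4) `^ p by rewrite powR_gt0.
have [N HN] := tail_integral_small iG G0 mh e4p.
pose k x := if (h x < N)%N then h x else 0%N.
have kN x : (k x <= N)%N by rewrite /k; case: ltnP => // /ltnW.
have mk i : measurable (k @^-1` [set i]).
  rewrite (_ : k @^-1` [set i] =
    \bigcup_(j in [set j | (if (j < N)%N then j else 0%N) = i]) h @^-1` [set j]).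
    by apply: bigcup_measurable => j _.
  by apply/seteqP; split=> x; [move=> kx; exists (h x)|move=> [j /= <- hx]; rewrite /k hx].
have kphi1 := kmeasurable_index mk.
have near1 : (energy (fun x => phi x - q (k x))%R <= ((e / 2) `^ p)%:E)%E.
  pose F x := if (N <= h x)%N then G x else 0%E.
  have F0 x : (0 <= F x)%E by rewrite /F; case: ifP.
  have mF : measurable_fun [set: X] F.
    apply: measurable_fun_ifT => //; apply: (measurable_fun_bool true); rewrite setTI.
    rewrite (_ : _ @^-1` _ = \bigcup_(i in [set i | (N <= i)%N]) h @^-1` [set i]).
      exact: bigcup_measurable.
    by apply/seteqP; split=> x => [nx|[i ni hx]]; [exists (h x)|rewrite /= hx].
  apply: (@le_trans _ _ (\int[P]_x (cst ((e / 4) `^ p)%:E x + F x))%E).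
    apply: energy_le_integral => //.
    - exact: kmeasurableB.
    - exact: emeasurable_funD.
    - by move=> x; rewrite adde_ge0 // lee_fin powR_ge0.
    move=> x; rewrite /F /k /=; case: ltnP => hN.
      rewrite adde0 lee_fin ge0_ler_powR ?nnegrE ?modulus_ge0 ?(ltW p0) ?(ltW e4) //.
      exact: (ltW (nearestP q_dense phi e4 x)).
    by rewrite q0 subr0 leeDr // lee_fin powR_ge0.
  rewrite ge0_integralD //; last by move=> x _; rewrite lee_fin powR_ge0.
  rewrite integral_cst //= probability_setT mule1.
  apply: (@le_trans _ _ (((e / 4) `^ p)%:E + ((e / 4) `^ p)%:E)%E); first exact: leeD2l.
  (* Both errors fit into [(e / 2) `^ p] since [2 <= 2 `^ p]. *)
  rewrite -EFinD lee_fin (_ : e / 2 = 2 * (e / 4)); last by lra.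
  rewrite (powRM p (ler0n _ 2) (ltW e4)).
  apply: (@le_trans _ _ (2 * (e / 4) `^ p)); first by lra.
  by rewrite ler_pM2r // le1r_powR // ler1n.
pose M := \sum_(i < N.+1) modulus (q i).
have qM i : (i <= N)%N -> modulus (q i) <= M.
  move=> iN; rewrite /M (bigD1 (Ordinal (iN : (i < N.+1)%N))) //= lerDl.
  by apply: sumr_ge0 => c _; exact: modulus_ge0.
have M0 : 0 <= M by apply: sumr_ge0 => c _; exact: modulus_ge0.
have M1 : 0 < (2 * M) `^ p + 1 by rewrite ltr_wpDl ?powR_ge0.
have [n [t [S [tN mS PS HS]]]] := index_approx mk kN (divr_gt0 e4p M1).
exists n, t.
have near2 : (energy (fun x => q (k x) - cylinder_fun n t x)%R <= ((e / 4) `^ p)%:E)%E.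
  apply: (le_trans (energy_support_le (S := S) (M := 2 * M) P p1 _ mS _ _)).
  - by apply: kmeasurableB => //; exact: kmeasurable_cylinder_fun.
  - by move=> x /HS kx; rewrite /cylinder_fun -kx subrr.
  - by move=> x; rewrite (le_trans (modulusB _ _)) // mulr_natl mulr2n lerD ?qM.
  apply: (@le_trans _ _ (((2 * M) `^ p)%:E * ((e / 4) `^ p / ((2 * M) `^ p + 1))%:E)%E).
    by rewrite lee_wpmul2l // lee_fin powR_ge0.
  rewrite -EFinM lee_fin mulrCA ler_piMr ?(ltW e4p) //.
  by rewrite ler_pdivrMr // mul1r lerDl.
have e_phi1 : (energy (fun x => q (k x)) < +oo)%E.
  apply: (le_lt_trans (bounded_energy P p1 kphi1 (fun x => qM _ (kN x)))); exact: ltry.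
pose phi1 : Lpfun P K p1 := mkLp p1 kphi1 e_phi1.
have d1 : nrm (Lp_class phi - Lp_class phi1) <= e / 2.
  by rewrite (Lp_classB phi phi1); apply: nrm_le; first by rewrite divr_ge0 // ltW.
have d2 : nrm (Lp_class phi1 - Lp_class (cylinder_Lp n t)) <= e / 4.
  by rewrite (Lp_classB phi1 (cylinder_Lp n t)); apply: nrm_le; first by rewrite divr_ge0 // ltW.
by have := nrm_dist_triangle (Lp_class phi1) (Lp_class phi) (Lp_class (cylinder_Lp n t)); lra.
Qed.

End density.

(** * Dynamics of the composition operator of the odometer *)

Section mixing.
Variables (R : realType) (P : probability X R) (K : scalarField R) (q : nat -> K).
Hypothesis P_cylinder : forall n x, P (cylinder n x) = (cylinder_mass R n x)%:E.
Hypotheses (q0 : q 0%N = 0)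
  (q_dense : forall (z : K) (e : R), 0 < e -> exists i, modulus (z - q i) < e).
Variables (p : R) (p1 : 1 <= p).
Local Notation L := (Lp P K p1).
Local Notation energy := (Lp_energy P p).
Variable U : {linear L -> L}.
Hypothesis f_U : composition_operator f U.

Let p0 : 0 < p. Proof. exact: Lp_gt0 p1. Qed.

Local Notation cyl := (cylinder_Lp P q p1).

Lemma dense_periodic : dense (periodic_point U).
Proof.
apply: dense_nrm => u e e0; have [n [t H]] := cylinder_Lp_dense q0 q_dense u e0.
exists (Lp_class (cyl n t)) => //; exists (2 ^ n)%N; split; first by rewrite expn_gt0.
apply: (iter_class_periodic f_U) => x.
by have := cylinder_fun_periodic q n t 1 x; rewrite mul1n.
Qed.

Lemma P_window_small s (B : nat) (e : R) : 0 < e ->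
  exists2 m0, (B <= m0)%N & forall m, (m0 <= m)%N -> (P (window m s) <= e%:E)%E.
Proof.
move=> e0; have se : 0 < e / s.+1%:R by rewrite divr_gt0 ?ltr0n.
have [i _ Hi] := near_infty_natSinv_lt (PosNum se).
exists (maxn B i); first exact: leq_maxl.
move=> m; rewrite geq_max => /andP[_ im]; apply: (le_trans (P_window_le P_cylinder m s)).
by rewrite lee_fin mulrC -ler_pdivlMr ?ltr0n //; exact/ltW/Hi.
Qed.

(** Let [g] and [h] be functions of finitely many digits, and [S] a small window
    that the [n]-th iterate of the odometer reaches from everywhere outside. The
    function equal to [g] outside [S] and to [h] composed with the inverse of this
    iterate on [S] is close to [g], and its image is close to [h]. *)
Lemma mixing_binary : mixing U.
Proof.
move=> A W oA [a Aa] oW [w Ww].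
have [ea ea0 HA] := open_nrm oA Aa; have [ew ew0 HW] := open_nrm oW Ww.
have ea2 : 0 < ea / 2 by rewrite divr_gt0.
have ew2 : 0 < ew / 2 by rewrite divr_gt0.
have [na [ta Ha]] := cylinder_Lp_dense q0 q_dense a ea2.
have [nw [tw Hw]] := cylinder_Lp_dense q0 q_dense w ew2.
pose e := Order.min (ea / 4) (ew / 4).
have e0 : 0 < e by rewrite lt_min !divr_gt0.
pose M := cylinder_bound q na ta + cylinder_bound q nw tw.
have M0 : 0 <= M by rewrite addr_ge0 ?cylinder_bound_ge0.
have M1 : 0 < (2 * M) `^ p + 1 by rewrite ltr_wpDl ?powR_ge0.
have e1 : 0 < e `^ p / ((2 * M) `^ p + 1) by rewrite divr_gt0 // powR_gt0.
have [m0 _ Hm0] := P_window_small 1 0 e1.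
exists (2 ^ m0)%N; split=> [|n m0n]; first by rewrite expn_gt0.
have n0 : (0 < n)%N by rewrite (leq_trans _ m0n) // expn_gt0.
pose m := trunc_log 2 n.
have mn : (2 ^ m <= n < 2 ^ (m + 1))%N by rewrite addn1; exact: trunc_log_bounds.
have m0m : (m0 <= m)%N by exact: trunc_log_max.
pose S := window m 1.
have mS : measurable S by exact: measurable_window.
have PS : (((2 * M) `^ p)%:E * P S <= (e `^ p)%:E)%E.
  apply: (@le_trans _ _ (((2 * M) `^ p)%:E * (e `^ p / ((2 * M) `^ p + 1))%:E)%E).
    by rewrite lee_wpmul2l ?lee_fin ?powR_ge0 //; exact: Hm0.
  rewrite -EFinM lee_fin mulrCA ler_piMr ?powR_ge0 //.
  by rewrite ler_pdivrMr // mul1r lerDl.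
(* [n + k] is a multiple of the period of [h], so [k] steps forward amount to
   [n] steps backward. *)
pose k := (n * (2 ^ nw).-1)%N.
have kn x : cylinder_fun q nw tw (iter k f (iter n f x)) = cylinder_fun q nw tw x.
  rewrite -iterD /k -{2}[n]muln1 -mulnDr addn1 prednK ?expn_gt0 //.
  exact: cylinder_fun_periodic.
pose g x := cylinder_fun q na ta x.
pose h x := cylinder_fun q nw tw (iter k f x).
have kg : kmeasurable g by exact: kmeasurable_cylinder_fun.
have kh : kmeasurable h.
  exact: kmeasurable_comp (measurable_iter k) (kmeasurable_cylinder_fun q nw tw).
pose y x := if x \in S then h x else g x.
have ky : kmeasurable y by exact: kmeasurable_if.
have gM x : modulus (g x) <= M.
  by rewrite (le_trans (cylinder_fun_le _ _ _ _)) // lerDl cylinder_bound_ge0.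
have hM x : modulus (h x) <= M.
  by rewrite (le_trans (cylinder_fun_le _ _ _ _)) // lerDr cylinder_bound_ge0.
have wM x : modulus (cylinder_fun q nw tw x) <= M.
  by rewrite (le_trans (cylinder_fun_le _ _ _ _)) // lerDr cylinder_bound_ge0.
have yM x : modulus (y x) <= M by rewrite /y; case: ifP.
have [psi psiE] := bounded_Lp P p1 ky yM.
have twoM (c d : K) : modulus c <= M -> modulus d <= M -> modulus (c - d) <= 2 * M.
  by move=> hc hd; rewrite (le_trans (modulusB _ _)) // mulr_natl mulr2n lerD.
have d1 : nrm (Lp_class (cyl na ta) - Lp_class psi) <= e.
  rewrite (Lp_classB (cyl na ta) psi); apply: (nrm_le (ltW e0)); apply: le_trans PS.
  rewrite (_ : energy _ = energy (fun x => g x - y x)); last first.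
    by apply: eq_energy => x; rewrite LpfunD LpfunN psiE.
  apply: energy_support_le => //; first exact: kmeasurableB.
  - by move=> x Sx; rewrite /y memNset // subrr.
  - by move=> x; exact: twoM.
have d2 : nrm (iter n U (Lp_class psi) - Lp_class (cyl nw tw)) <= e.
  apply: (nrm_iter_le f_U (ltW e0)); apply: le_trans PS; rewrite psiE.
  apply: energy_support_le => //.
  - apply: kmeasurableB; last exact: kmeasurable_cylinder_fun.
    exact: (kmeasurable_comp (measurable_iter n) ky).
  - move=> x Sx; rewrite /y mem_set; last exact: window_shift mn Sx.
    by rewrite /h kn subrr.
  - by move=> x; apply: twoM; [exact: yM|exact: wM].
have ee1 : e <= ea / 4 by rewrite ge_min lexx.
have ee2 : e <= ew / 4 by rewrite ge_min lexx orbT.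
exists (iter n U (Lp_class psi)); split.
  exists (Lp_class psi) => //; apply: HA.
  have := nrm_dist_triangle (Lp_class (cyl na ta)) a (Lp_class psi); lra.
apply: HW; rewrite nrm_distC.
have := nrm_dist_triangle (Lp_class (cyl nw tw)) (iter n U (Lp_class psi)) w.
rewrite (nrm_distC (Lp_class (cyl nw tw)) w); lra.
Qed.

End mixing.

Section gliding_orbits.
Variables (R : realType) (P : probability X R) (K : scalarField R).
Hypothesis P_cylinder : forall n x, P (cylinder n x) = (cylinder_mass R n x)%:E.
Variables (p : R) (p1 : 1 <= p).
Local Notation L := (Lp P K p1).
Local Notation energy := (Lp_energy P p).

Let p0 : 0 < p. Proof. exact: Lp_gt0 p1. Qed.

(** The windows are chosen one after the other, each so far that its measure is
    negligible compared with the bound [M i] and with the dilation of the measure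
    over the stretch of times of the previous window. *)
Lemma glide_exists (M : nat -> R) (s : nat -> nat) :
  0 <= M 0%N -> {homo M : i j / (i <= j)%N >-> i <= j} ->
  exists m : nat -> nat,
    (forall i, (m i <= 2 ^ (m i + s i) <= m i.+1)%N) /\
    forall g : nat -> X -> K, (forall j, kmeasurable (g j)) ->
    (forall j x, modulus (g j x) <= M j) ->
    exists eta : Lpfun P K p1, forall j n, (2 ^ m j <= n < 2 ^ (m j + s j))%N ->
      (energy (fun x => eta (iter n f x) - g j (iter n f x))%R <= (2 * 2^-1 ^+ j)%:E)%E.
Proof.
move=> M0 M_nd.
have small (iB : nat * nat) : exists m0, (iB.2 <= m0)%N /\
    (((2 * M iB.1) `^ p)%:E * P (window m0 (s iB.1)) <=
      ((2^-1 ^+ iB.1 / 2 ^+ iB.2) / (2 ^ iB.1.+1)%:R)%:E)%E.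
  case: iB => i B /=; pose e : R := (2^-1 ^+ i / 2 ^+ B) / (2 ^ i.+1)%:R.
  have e0 : 0 < e by rewrite /e !divr_gt0 ?exprn_gt0 ?ltr0n ?expn_gt0 ?invr_gt0.
  set a := (2 * M i) `^ p; have a0 : 0 <= a by exact: powR_ge0.
  have a1 : 0 < a + 1 by rewrite ltr_wpDl.
  have [m0 Bm0 Hm0] := P_window_small P_cylinder (s i) B (divr_gt0 e0 a1).
  exists m0; split=> //; rewrite -/e; apply: (@le_trans _ _ (a%:E * (e / (a + 1))%:E)%E).
    by apply: lee_wpmul2l; [rewrite lee_fin|exact: Hm0].
  rewrite -EFinM lee_fin mulrCA ler_piMr ?(ltW e0) //.
  by rewrite ler_pdivrMr // mul1r lerDl.
have [G HG] := choice small.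
pose m := fix m i := if i is i'.+1 then G (i, 2 ^ (m i' + s i'))%N else G (0, 0)%N.
pose N i := (2 ^ (m i + s i))%N.
have mN i : (m i <= N i)%N.
  by rewrite (leq_trans (leq_addr (s i) (m i))) // ltnW // ltn_expl.
have Nm i : (N i <= m i.+1)%N by case: (HG (i.+1, N i)).
have N_mono i j : (i <= j)%N -> (N i <= N j)%N.
  elim: j => [|j IH]; first by rewrite leqn0 => /eqP->.
  rewrite leq_eqVlt => /predU1P[->//|/IH /leq_trans]; apply.
  exact: leq_trans (Nm j) (mN _).
have prev i : exists B, (forall j, (j < i)%N -> (N j <= B)%N) /\
    (((2 * M i) `^ p)%:E * P (window (m i) (s i)) <=
      ((2^-1 ^+ i / 2 ^+ B) / (2 ^ i.+1)%:R)%:E)%E.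
  case: i => [|i]; first by exists 0%N; split=> //; case: (HG (0, 0)%N).
  exists (N i); split; last by case: (HG (i.+1, N i)).
  by move=> j; rewrite ltnS; exact: N_mono.
exists m; split=> [i|g kg gM]; first by rewrite mN Nm.
pose S i := window (m i) (s i).
have mS i : measurable (S i) by exact: measurable_window.
have le1 (x : R) n : 0 <= x <= 1 -> 0 <= x ^+ n <= 1.
  by move=> /andP[x0 x1]; rewrite exprn_ge0 // exprn_ile1.
have h2 : 0 <= (2^-1 : R) <= 1 by rewrite invr_ge0 ler0n invf_le1 ?ler1n.
have S_small0 i : (((2 * M i) `^ p)%:E * P (S i) <= (1 / (2 ^ i.+1)%:R)%:E)%E.
  have [B [_ HB]] := prev i; apply: (le_trans HB); rewrite lee_fin.
  rewrite ler_pM2r ?invr_gt0 ?ltr0n ?expn_gt0 // -exprVn.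
  by have /andP[? ?] := le1 _ i h2; have /andP[? ?] := le1 _ B h2; rewrite mulr_ile1.
have S_small i j : (j < i)%N ->
    (((2 * M i) `^ p)%:E * P (S i) <= ((2^-1 ^+ j / 2 ^+ N j) / (2 ^ i.+1)%:R)%:E)%E.
  move=> ji; have [B [HN HB]] := prev i; apply: (le_trans HB); rewrite lee_fin.
  rewrite ler_pM2r ?invr_gt0 ?ltr0n ?expn_gt0 // -!exprVn.
  by apply: ler_pM; rewrite ?exprn_ge0 ?invr_ge0 //; apply: ler_wiXn2l;
    rewrite ?invr_ge0 ?invf_le1 ?ler1n ?HN // ltnW.
exists (glide_Lp p1 mS M0 M_nd kg gM S_small0) => j n jn.
apply: (glide_iter (mu := P) p1 measurable_odometer (ler1n _ 2) mS
  (P_preimage_odometer_le P_cylinder) M0 M_nd kg gM S_small0 S_small).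
  by case/andP: jn => _ /ltnW.
by move=> x; exact: window_shift jn.
Qed.

Variable q : nat -> K.
Hypotheses (q0 : q 0%N = 0)
  (q_dense : forall (z : K) (e : R), 0 < e -> exists i, modulus (z - q i) < e).
Variable U : {linear L -> L}.
Hypothesis f_U : composition_operator f U.

Local Notation cyl := (cylinder_Lp P q p1).

Lemma geometric_small (e : R) : 0 < e -> exists J, forall j, (J <= j)%N -> 2 * 2^-1 ^+ j <= e.
Proof.
move=> e0; have e2 : 0 < e / 2 by rewrite divr_gt0.
have [J _ HJ] := near_infty_natSinv_expn_lt (PosNum e2).
exists J => j Jj; rewrite mulrC -ler_pdivlMr //; apply: le_trans (ltW (HJ j Jj)).
by rewrite div1r exprVn.
Qed.

Lemma large_code (T : countType) (x : T) (J : nat) :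
  exists2 j, (J <= j)%N & exists k : nat, unpickle j = Some (k, x).
Proof.
apply: contrapT => H.
have lt (k : 'I_J.+1) : (pickle (nat_of_ord k, x) < J)%N.
  rewrite ltnNge; apply/negP => Jk; apply: H.
  by exists (pickle (nat_of_ord k, x)) => //; exists k; rewrite pickleK.
pose F (k : 'I_J.+1) : 'I_J := Ordinal (lt k).
have /leq_card : injective F.
  move=> k l /(congr1 (@nat_of_ord _)) /= /(pcan_inj pickleK) [] kl.
  exact: ord_inj.
by rewrite !card_ord ltnn.
Qed.

(** The humps are the items of a dense sequence moved backward in time, the [j]-th
    by [2 ^ m j] steps, so that the orbit approaches this item at the time
    [2 ^ m j]. Each item has to occur for arbitrarily large [j]. *)
Lemma hypercyclic_binary : hypercyclic U.
Proof.
pose dec j : nat * seq nat :=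
  if unpickle j is Some kx then (kx : nat * (nat * seq nat)).2 else (0%N, [::]).
pose M j := \sum_(i < j.+1) cylinder_bound q (dec i).1 (dec i).2.
have M0 : 0 <= M 0%N by apply: sumr_ge0 => i _; exact: cylinder_bound_ge0.
have M_nd : {homo M : i j / (i <= j)%N >-> i <= j}.
  move=> i j ij; rewrite /M -(big_mkord xpredT (fun i => cylinder_bound q (dec i).1 (dec i).2)).
  rewrite -(big_mkord xpredT (fun i => cylinder_bound q (dec i).1 (dec i).2)).
  rewrite [leRHS](big_cat_nat (n := i.+1)) //= lerDl.
  by apply: sumr_ge0 => k _; exact: cylinder_bound_ge0.
have [m [_ Hm]] := @glide_exists M (fun=> 1%N) M0 M_nd.
(* [2 ^ m j + k j] is a multiple of the period of the [j]-th item. *)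
pose k j := (2 ^ m j * (2 ^ (dec j).1).-1)%N.
pose g j x := cylinder_fun q (dec j).1 (dec j).2 (iter (k j) f x).
have [j|j x|eta Heta] := Hm g.
- exact: kmeasurable_comp (measurable_iter (k j)) (kmeasurable_cylinder_fun q _ _).
- rewrite (le_trans (cylinder_fun_le _ _ _ _)) // /M big_ord_recr /= lerDr.
  by apply: sumr_ge0 => i _; exact: cylinder_bound_ge0.
exists (Lp_class eta); apply: dense_nrm => u e e0.
have e2 : 0 < e / 2 by rewrite divr_gt0.
have [n [t Hnt]] := cylinder_Lp_dense q0 q_dense u e2.
have [J HJ] := geometric_small (powR_gt0 p e2).
have [j Jj [i ji]] := large_code (n, t) J.
have decj : dec j = (n, t) by rewrite /dec ji.
have gj x : g j (iter (2 ^ m j) f x) = cylinder_fun q n t x.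
  rewrite /g /k decj /= -iterD -{2}[(2 ^ m j)%N]muln1 -mulnDr addn1 prednK ?expn_gt0 //.
  exact: cylinder_fun_periodic.
have near_ : nrm (iter (2 ^ m j) U (Lp_class eta) - Lp_class (cyl n t)) <= e / 2.
  apply: (nrm_iter_le f_U (ltW e2)).
  have := Heta j (2 ^ m j)%N; rewrite leqnn ltn_exp2l // addn1 ltnSn => /(_ isT) H.
  apply: (@le_trans _ _ (2 * 2^-1 ^+ j)%:E); last by rewrite lee_fin HJ.
  by apply: le_trans H; rewrite le_eqVlt; apply/orP; left; apply/eqP;
    apply: eq_energy => x; rewrite gj.
exists (iter (2 ^ m j) U (Lp_class eta)); first by exists (2 ^ m j)%N => //=; rewrite expn_gt0.
have := nrm_dist_triangle (Lp_class (cyl n t)) u (iter (2 ^ m j) U (Lp_class eta)).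
rewrite (nrm_distC (Lp_class (cyl n t))); lra.
Qed.

(** The humps are alternately [0] and large constants, which composition with the
    odometer leaves unchanged: the orbit stays close to them during the whole
    stretch from [2 ^ m j] to [2 ^ (m j + j)]. *)
Lemma distributionally_chaotic_binary : distributionally_chaotic R U.
Proof.
pose M j : R := j%:R.
have M_nd : {homo M : i j / (i <= j)%N >-> i <= j} by move=> i j ij; rewrite ler_nat.
have [m [mN Hm]] := @glide_exists M id (lexx 0) M_nd.
pose c j : K := if odd j then sf_inj (j%:R : R) else 0.
have mod_c j : modulus (c j) = if odd j then j%:R else 0.
  rewrite /c; case: ifP => _; last exact: modulus0.
  apply: (@sf_inj_inj _ K); rewrite -modulusE ger0_norm //.
  by rewrite -(sf_inj0 K) sf_inj_le ler0n.
have [j|j x|eta Heta] := Hm (fun j => fun=> c j); first exact: kmeasurable_cst.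
  by rewrite mod_c /M; case: ifP => // _; rewrite ler0n.
pose W b := [set n | exists j, odd j = b /\ (2 ^ m j <= n < 2 ^ (m j + j))%N].
have W_gt0 b : W b `<=` [set n | (0 < n)%N].
  by move=> n [j [_ /andP[+ _]]] /=; apply: leq_trans; rewrite expn_gt0.
have W_dens b : @upper_density R (W b) = 1%E.
  apply: (@upper_density_windows _ _ (fun j => 2 ^ m j)%N (fun j => 2 ^ (m j + j))%N) => i.
  have [j ij ob] : exists2 j, (i <= j)%N & odd j = b.
    have [<-|ne] := eqVneq (odd i) b; first by exists i.
    by exists i.+1 => //=; case: (odd i) ne; case: b.
  exists j; split=> //; split; first by rewrite expn_gt0.
  by split=> [|k jk]; [rewrite expnD|exists j].
have N_mono i j : (i <= j)%N -> (2 ^ (m i + i) <= 2 ^ (m j + j))%N.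
  elim: j => [|j IH]; first by rewrite leqn0 => /eqP->.
  rewrite leq_eqVlt => /predU1P[->//|/IH /leq_trans]; apply.
  have /andP[_ h] := mN j; apply: (leq_trans h).
  by have /andP[+ _] := mN j.+1.
have late J n j : (2 ^ (m J + J) <= n)%N -> (n < 2 ^ (m j + j))%N -> (J < j)%N.
  move=> h1 h2; rewrite ltnNge; apply/negP => /N_mono h3.
  by have := leq_ltn_trans h1 (leq_trans h2 h3); rewrite ltnn.
exists (Lp_class eta), (W false), (W true); split=> //.
- apply: (@cvg_nrm0 _ _ _ P K p p1) => e e0; have e2 : 0 < e / 2 by rewrite divr_gt0.
  have [J HJ] := geometric_small (powR_gt0 p e2).
  exists (2 ^ (m J + J))%N => n Jn [j [oj jn]].
  have Jj : (J < j)%N by apply: late Jn _; case/andP: jn.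
  apply: (@le_lt_trans _ _ (e / 2)); last by lra.
  apply: (nrm_iter0_le f_U (ltW e2)).
  apply: (@le_trans _ _ (2 * 2^-1 ^+ j)%:E); last by rewrite lee_fin HJ // ltnW.
  apply: le_trans (Heta j n jn); rewrite le_eqVlt; apply/orP; left; apply/eqP.
  by apply: eq_energy => x; rewrite /c oj subr0.
apply: (@cvg_nrm_pinfty _ _ _ P K p p1) => A.
pose J := Num.bound `|A + 2|.
exists (2 ^ (m J + J))%N => n Jn [j [oj jn]].
have Jj : (J < j)%N by apply: late Jn _; case/andP: jn.
have kc : kmeasurable (fun _ : X => c j) by exact: kmeasurable_cst.
have [psi psiE] := bounded_Lp P p1 kc (fun x => lexx (modulus (c j))).
have psi_j : nrm (Lp_class psi) = j%:R.
  apply: (powR_injective p0); rewrite ?nnegrE ?nrm_ge0 ?ler0n //.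
  have := nrm_energy psi; rewrite psiE /Lp_energy mod_c oj integral_cst //=.
  by rewrite probability_setT mule1 => -[].
have psi_fix : iter n U (Lp_class psi) = Lp_class psi.
  by apply: (iter_class_periodic f_U) => x; rewrite psiE.
have near_ : nrm (iter n U (Lp_class eta) - Lp_class psi) <= 2.
  apply: (nrm_iter_le f_U (ler0n _ 2)).
  apply: (@le_trans _ _ (2 * 2^-1 ^+ j)%:E).
    apply: le_trans (Heta j n jn); rewrite le_eqVlt; apply/orP; left; apply/eqP.
    by apply: eq_energy => x; rewrite psiE.
  rewrite lee_fin (@le_trans _ _ 2) //; last by rewrite le1r_powR // ler1n.
  by rewrite ler_piMr // exprn_ile1 ?invr_ge0 // invf_le1 // ler1n.
have AJ : A + 2 < J%:R by rewrite (le_lt_trans (ler_norm _)) // archi_boundP.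
have Jj' : J%:R <= j%:R - 1 :> R by rewrite lerBrDr natr1 ler_nat.
have := nrm_dist_triangle (iter n U (Lp_class eta)) (Lp_class psi) 0.
rewrite !subr0 (nrm_distC (Lp_class psi)) psi_j; lra.
Qed.

End gliding_orbits.

(** * The two scalar fields and the odometer system *)

Lemma modulus_le_re_im (R : realType) (K : scalarField R) (z : K) :
  modulus z <= `|sf_re z| + `|sf_im z|.
Proof.
rewrite /modulus -(@ler_pXn2r _ 2) ?nnegrE ?sqrtr_ge0 ?addr_ge0 //.
rewrite sqr_sqrtr ?addr_ge0 ?sqr_ge0 // sqrrD !real_normK ?num_real //.
by rewrite lerD2r lerDl mulrn_wge0 // mulr_ge0.
Qed.

Lemma rat_near (R : realType) (x e : R) : 0 < e -> exists r : rat, `|x - ratr r| < e.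
Proof.
move=> e0; have lt : x - e < x + e by lra.
have [r] := rat_in_itvoo lt; rewrite in_itv /= => /andP[h1 h2].
by exists r; rewrite ltr_norml; apply/andP; split; lra.
Qed.

Lemma dense_scalars_of_code (R : realType) (K : scalarField R) (T : countType) (c : T -> K) :
  (forall z e, 0 < e -> exists t, modulus (z - c t) < e) ->
  exists q : nat -> K, q 0%N = 0 /\
    forall (z : K) (e : R), 0 < e -> exists i, modulus (z - q i) < e.
Proof.
move=> H; exists (fun i => if i is i'.+1 then oapp c 0 (unpickle i') else 0); split=> // z e e0.
by have [t Ht] := H z e e0; exists (pickle t).+1; rewrite pickleK.
Qed.

Lemma dense_scalars (R : realType) (K : scalarField R) :
  K = real_scalars R \/ K = complex_scalars R ->
  exists q : nat -> K, q 0%N = 0 /\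
    forall (z : K) (e : R), 0 < e -> exists i, modulus (z - q i) < e.
Proof.
case=> ->.
  apply: (@dense_scalars_of_code R (real_scalars R) rat (fun r => ratr r : R)) => z e e0.
  have [r Hr] := rat_near z e0; exists r.
  by rewrite (@modulus_real R (z - ratr r)).
apply: (@dense_scalars_of_code R (complex_scalars R) (rat * rat)%type
  (fun r => Complex (ratr r.1 : R) (ratr r.2 : R))) => -[a b] e e0.
have e2 : 0 < e / 2 by rewrite divr_gt0.
have [r Hr] := rat_near a e2; have [s Hs] := rat_near b e2.
exists (r, s); apply: (le_lt_trans (modulus_le_re_im _)) => /=.
by lra.
Qed.

Lemma mass_max (R : realType) n :
  \big[Num.max/0]_(a : 'I_2) digit_mass R n a = digit_mass R n 0.
Proof.
rewrite !big_ord_recl big_ord0 /= (max_idPl (ltW (mass_gt0 R n _))).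
by apply/max_idPl; exact: mass_le0.
Qed.

Section system.
Variables (R : realType) (P : probability (odometer_space binary_base) R).
Hypothesis P_cylinder : forall n x, P (cylinder n x) = (cylinder_mass R n x)%:E.

Let mass_digit n (a : 'I_(binary_base n)) : R := digit_mass R n a.

Let mass_digit_gt0 n (a : 'I_(binary_base n)) : 0 < mass_digit a.
Proof. exact: mass_gt0. Qed.

Let mass_digit_sum1 n : \sum_(a : 'I_(binary_base n)) mass_digit a = 1.
Proof. by rewrite /mass_digit !big_ord_recl big_ord0 addr0 /= mass_sum. Qed.

Let mass_digit_max :
  (\prod_(n < N) \big[Num.max/0]_(a : 'I_(binary_base n)) mass_digit a)
    @[N --> \oo] --> (0 : R).
Proof.
rewrite (_ : (fun N => _) = @harmonic R); first exact: cvg_harmonic.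
apply/funext => N; rewrite /harmonic /= -prod_mass0; apply: eq_bigr => n _.
exact: mass_max.
Qed.

Definition binary_system : odometer_system R :=
  @OdometerSystem R binary_base mass_digit P mass_digit_gt0 mass_digit_sum1
    (P_product P_cylinder) mass_digit_max.

End system.

Theorem theoremD (R : realType) :
  exists O : odometer_system R,
  forall K : scalarField R, K = real_scalars R \/ K = complex_scalars R ->
  forall (p : R) (p1 : 1 <= p),
  exists T : {linear Lp (odo_mu O) K p1 -> Lp (odo_mu O) K p1},
    [/\ composition_operator (@odometer (odo_base O)) T,
        bounded_operator T,
        mixing T,
        distributionally_chaotic R T &
        Devaney_chaotic T]
    /\ (2 <= p -> ~ frequent_hypercyclicity_criterion T).
Proof.
have [P P_cylinder] := product_probability_exists R.
exists (binary_system P_cylinder) => K /dense_scalars[q [q0 q_dense]] p p1 /=.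
have f_le := P_preimage_odometer_le P_cylinder.
pose T : {linear Lp P K p1 -> Lp P K p1} :=
  koopman (mu := P) (K := K) (p1 := p1) measurable_odometer (ler0n R 2) f_le.
have f_T : composition_operator (@odometer binary_base) T by exact: koopman_composition.
exists T; split; last first.
  exact: (not_FHC measurable_odometer (ler1n R 2) f_le (wandering_null P_cylinder) f_T).
split=> //.
- by apply: koopman_bounded; rewrite ler1n.
- exact: (mixing_binary P_cylinder q0 q_dense f_T).
- exact: (distributionally_chaotic_binary P_cylinder f_T).
- split; first exact: (hypercyclic_binary P_cylinder q0 q_dense f_T).
  exact: (dense_periodic q0 q_dense f_T).
Qed.
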